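(* Let $0\le\nu\le n$, $J=\mathrm{diag}(I_\nu,-I_{n-\nu})$, and let $\pi=(n_1,\ldots,n_m)$ be a partition of $n$ that refines $(\nu,n-\nu)$. Let $\mathcal{O}\in\mathcal{B}_{sg}^{(m)}$. Then the full block $J$-Jacobi method defined by the cyclic pivot strategy $I_{\mathcal{O}}$, which uses $\mathrm{UBCE}$ $J$-orthogonal transformation matrices, is globally convergent; that is, for every symmetric positive definite matrix $A$ of order $n$, the matrices $A^{(k)}$ generated by the method satisfy $\lim_{k\to\infty}S(A^{(k)})=0$, and, under the kernel convention stated in the context, $A^{(k)}$ converges to a diagonal matrix as $k\to\infty$.
   Context: **Partitions and blocks.** A partition $\pi=(n_1,\ldots,n_m)$ of $n$ ($m\ge 2$) is a tuple of positive integers with $n_1+\cdots+n_m=n$; it refines $(\nu,n-\nu)$ if $n_1+\cdots+n_r=\nu$ for some $0\le r\le m$. An $n\times n$ matrix is viewed as a block matrix $A=(A_{rs})$ with $A_{rs}$ of size $n_r\times n_s$. For symmetric $A=(a_{st})$, $S(A)=\big(\sum_{s<t}|a_{st}|^2\big)^{1/2}$. The pivot submatrix for $(i,j)$, $i<j$, is $\widehat A_{ij}=\begin{bmatrix} A_{ii} & A_{ij} \\ A_{ji} & A_{jj} \end{bmatrix}$. For $\widehat F=\begin{bmatrix} F_{ii} & F_{ij} \\ F_{ji} & F_{jj} \end{bmatrix}$ of order $n_i+n_j$, $\mathcal E(i,j,\widehat F)$ is the $n\times n$ matrix equal to $I_n$ except that its blocks at positions $(i,i),(i,j),(j,i),(j,j)$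 are $F_{ii},F_{ij},F_{ji},F_{jj}$. **Full block $J$-Jacobi method.** Given symmetric positive definite $A$, $A^{(0)}=A$ and $A^{(k+1)}=F_k^TA^{(k)}F_k$, where $F_k=\mathcal E(i,j,\widehat F_k)$ with $(i,j)=I_{\mathcal O}(k)$ is $J$-orthogonal, $F_k^TJF_k=J$, and is such that the pivot submatrix of $A^{(k+1)}$ for $(i,j)$ is diagonal. If the block indices $i,j$ belong to the same part of $(\nu,n-\nu)$, $F_k$ is an orthogonal matrix; otherwise it is hyperbolic: $\widehat F_k^T\mathrm{diag}(I_{n_i},-I_{n_j})\widehat F_k=\mathrm{diag}(I_{n_i},-I_{n_j})$. ''UBCE $J$-orthogonal'' means that the orthogonal $F_k$ satisfy $\sigma_{\min}(F_{ii}^{(k)})=\sigma_{\min}(F_{jj}^{(k)})\ge\gamma_{ij}$ with $\gamma_{ij}=3/\sqrt{(4^{n_i}+6n_j-1)(n_j+1)}$ (for hyperbolic $F_k$ one automatically has $\sigma_{\min}(F_{ii}^{(k)})\ge1$). **Kernel convention (for convergence of diagonal elements).** The kernel algorithm that diagonalizes the pivot submatrices either always delivers diagonal elements sorted nonincreasingly (or always nondecreasingly) — for an orthogonal step along the whole diagonal of the transformed pivot submatrix, for a hyperbolic step within each of the two diagonal blocks — or it is a globally convergent element-wise ($J$-)Jacobi method, with plane rotations of angle in $[-\pi/4,\pi/4]$ and hyperbolic plane rotations, whose limit is the diagonal matrix delivered. **Pivot sequences and equivalences.** $\mathcal P_m=\{(r,s):1\le r<s\le m\}$; $\mathbf O(\mathcal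 P_m)$ is the set of finite sequences of elements of $\mathcal P_m$ containing every element at least once; those of length $m(m-1)/2$ are orderings of $\mathcal P_m$. For $\mathcal O=(i_0,j_0),\ldots,(i_{T-1},j_{T-1})$, $I_{\mathcal O}(k)=(i_{k\bmod T},j_{k\bmod T})$. $\mathcal O\sim\mathcal O'$: one is obtained from the other by finitely many transpositions of adjacent terms $(i_r,j_r),(i_{r+1},j_{r+1})$ with $\{i_r,j_r\}\cap\{i_{r+1},j_{r+1}\}=\emptyset$. $\mathcal O\stackrel{\mathsf s}{\sim}\mathcal O'$: $\mathcal O=[\mathcal O_1,\mathcal O_2]$, $\mathcal O'=[\mathcal O_2,\mathcal O_1]$ (concatenations). $\mathcal O\stackrel{\mathsf w}{\sim}\mathcal O'$: there is a finite chain from $\mathcal O$ to $\mathcal O'$ in which adjacent terms are linked by $\sim$ or $\stackrel{\mathsf s}{\sim}$. $\mathcal O(\mathsf q)=(\mathsf q(i_0),\mathsf q(j_0)),\ldots$, where a pair $(a,b)$ with $a>b$ is replaced by $(b,a)$; $\mathcal O'\stackrel{\mathsf p}{\sim}\mathcal O$ if $\mathcal O'=\mathcal O(\mathsf q)$ for some permutation $\mathsf q$ of $\{1,\ldots,m\}$. $\mathcal O^{\leftarrow}$ is $\mathcal O$ written in reverse order. **Classes of orderings.** $\mathcal B_c^{(m)}$: orderings $(1,2),(\tau_3(1),3),(\tau_3(2),3),\ldots,(\tau_m(1),m),\ldots,(\tau_m(m-1),m)$ with $\tau_j$ a permutation of $\{1,\ldots,j-1\}$. $\mathcal B_r^{(m)}$: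 orderings $(m-1,m),(m-2,\widetilde\tau_{m-2}(m-1)),(m-2,\widetilde\tau_{m-2}(m)),\ldots,(1,\widetilde\tau_1(2)),\ldots,(1,\widetilde\tau_1(m))$ with $\widetilde\tau_i$ a permutation of $\{i+1,\ldots,m\}$. $\mathcal B_{sp}^{(m)}=\{\mathcal O:\ \mathcal O\text{ or }\mathcal O^{\leftarrow}\in\mathcal B_c^{(m)}\cup\mathcal B_r^{(m)}\}$. $\mathcal B_{sg}^{(m)}$ (generalized serial orderings) is the set of $\mathcal O\in\mathbf O(\mathcal P_m)$ such that, for some $\mathcal O'\in\mathbf O(\mathcal P_m)$ and $\mathcal O''\in\mathcal B_{sp}^{(m)}$, either $\mathcal O\stackrel{\mathsf p}{\sim}\mathcal O'\stackrel{\mathsf w}{\sim}\mathcal O''$ or $\mathcal O\stackrel{\mathsf w}{\sim}\mathcal O'\stackrel{\mathsf p}{\sim}\mathcal O''$. *)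

(* Defs.v *)
From Stdlib Require Import Relations.Relation_Operators.
From mathcomp Require Import all_boot all_order all_algebra all_fingroup.
From mathcomp Require Import all_classical all_reals all_analysis.

Set Implicit Arguments.
Unset Strict Implicit.
Unset Printing Implicit Defensive.

Import Order.TTheory GRing.Theory Num.Theory.
Import numFieldNormedType.Exports.

Local Open Scope classical_set_scope.
Local Open Scope ring_scope.

(** * Pivot sequences

    Block indices are zero-based: the block index r of {1, ..., m} is the
    ordinal r - 1. *)

Definition pivot_seq (m : nat) (O : seq ('I_m * 'I_m)) : Prop :=
  O =i [pred x : 'I_m * 'I_m | (x.1 < x.2)%N].

Definition disjoint_pairs (m : nat) (x y : 'I_m * 'I_m) : bool :=
  [&& x.1 != y.1, x.1 != y.2, x.2 != y.1 & x.2 != y.2].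

Definition adj_transposition (m : nat) (O O' : seq ('I_m * 'I_m)) : Prop :=
  exists U V x y,
    [/\ disjoint_pairs x y, O = U ++ x :: y :: V & O' = U ++ y :: x :: V].

Definition equiv (m : nat) : seq ('I_m * 'I_m) -> seq ('I_m * 'I_m) -> Prop :=
  clos_refl_trans _ (@adj_transposition m).

Definition shift_equiv (m : nat) (O O' : seq ('I_m * 'I_m)) : Prop :=
  exists O1 O2, O = O1 ++ O2 /\ O' = O2 ++ O1.

Definition weak_equiv (m : nat) : seq ('I_m * 'I_m) -> seq ('I_m * 'I_m) -> Prop :=
  clos_refl_trans _ (fun O O' => equiv O O' \/ shift_equiv O O').

Definition sort_pair (m : nat) (x : 'I_m * 'I_m) : 'I_m * 'I_m :=
  if (x.2 < x.1)%N then (x.2, x.1) else x.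

Definition relabel (m : nat) (q : 'S_m) (O : seq ('I_m * 'I_m)) :=
  [seq sort_pair (q x.1, q x.2) | x <- O].

Definition perm_equiv (m : nat) (O' O : seq ('I_m * 'I_m)) : Prop :=
  exists q : 'S_m, O' = relabel q O.

(** The permutation tau_j of {1, ..., j - 1} is represented by the list [t j] of
    its successive values. *)
Definition col_ordering (m : nat) (O : seq ('I_m * 'I_m)) : Prop :=
  exists t : 'I_m -> seq 'I_m,
    (forall j, perm_eq (t j) [seq i : 'I_m <- enum 'I_m | (i < j)%N]) /\
    O = [seq (i, j) | j <- enum 'I_m, i <- t j].

Definition row_ordering (m : nat) (O : seq ('I_m * 'I_m)) : Prop :=
  exists t : 'I_m -> seq 'I_m,
    (forall i, perm_eq (t i) [seq j : 'I_m <- enum 'I_m | (i < j)%N]) /\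
    O = [seq (i, j) | i <- rev (enum 'I_m), j <- t i].

Definition serial_with_perm (m : nat) (O : seq ('I_m * 'I_m)) : Prop :=
  (col_ordering O \/ row_ordering O) \/
  (col_ordering (rev O) \/ row_ordering (rev O)).

Definition generalized_serial (m : nat) (O : seq ('I_m * 'I_m)) : Prop :=
  pivot_seq O /\
  exists O' O'', [/\ pivot_seq O', serial_with_perm O'' &
    (perm_equiv O O' /\ weak_equiv O' O'') \/
    (weak_equiv O O' /\ perm_equiv O' O'')].

(** * Partitions and block matrices

    A partition (p 0, ..., p (m-1)) of n is a function [p : 'I_m -> nat] with
    positive values, with n := \sum_i p i. *)

Definition refines (m : nat) (p : 'I_m -> nat) (nu : nat) : Prop :=
  exists2 r, (r <= m)%N & (\sum_(i < m | (i < r)%N) p i)%N = nu.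

(** For p refining (nu, n - nu), block i lies within the first nu indices. *)
Definition in_first_part (m : nat) (p : 'I_m -> nat) (nu : nat) (i : 'I_m) : bool :=
  (\sum_(r < m | (r <= i)%N) p r <= nu)%N.

Definition same_part (m : nat) (p : 'I_m -> nat) (nu : nat) (i j : 'I_m) : bool :=
  in_first_part p nu i == in_first_part p nu j.

Definition pivot_submx (T : Type) (m : nat) (p : 'I_m -> nat) (i j : 'I_m)
    (A : 'M[T]_(\sum_r p r)) : 'M[T]_(p i + p j) :=
  block_mx (submxblock A i i) (submxblock A i j)
           (submxblock A j i) (submxblock A j j).

(** [conform_mx] is only a type cast here: wherever its second argument is used
    the dimensions agree. *)
Definition block_elementary (R : realType) (m : nat) (p : 'I_m -> nat) (i j : 'I_m)
    (Fh : 'M[R]_(p i + p j)) : 'M[R]_(\sum_r p r) :=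
  \mxblock_(r < m, s < m)
    let B : 'M[R]_(p r, p s) := submxblock (1%:M : 'M[R]_(\sum_r p r)) r s in
    if (r == i) && (s == i) then conform_mx B (ulsubmx Fh)
    else if (r == i) && (s == j) then conform_mx B (ursubmx Fh)
    else if (r == j) && (s == i) then conform_mx B (dlsubmx Fh)
    else if (r == j) && (s == j) then conform_mx B (drsubmx Fh)
    else B.

Definition sym_posdef (R : realType) (n : nat) (A : 'M[R]_n) : Prop :=
  A^T = A /\ forall x : 'cV[R]_n, x != 0 -> 0 < (x^T *m A *m x) 0 0.

Definition off_norm (R : realType) (n : nat) (A : 'M[R]_n) : R :=
  Num.sqrt (\sum_(s < n) \sum_(t < n | (s < t)%N) `|A s t| ^+ 2).

Definition signature_mx (R : realType) (n nu : nat) : 'M[R]_n :=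
  diag_mx (\row_(s < n) if (s < nu)%N then 1 else -1).

Definition singular_value (R : realType) (n : nat) (M : 'M[R]_n) (s : R) : Prop :=
  0 <= s /\ eigenvalue (M^T *m M) (s ^+ 2).

(** For n > 0 the set is finite and nonempty, so that [inf] is its minimum. *)
Definition sigma_min (R : realType) (n : nat) (M : 'M[R]_n) : R :=
  inf [set s | singular_value M s].

(** * The full block J-Jacobi method with UBCE transformations *)

Definition ubce_bound (R : realType) (ni nj : nat) : R :=
  3 / Num.sqrt ((4 ^+ ni + 6 * nj%:R - 1) * (nj%:R + 1)).

Definition ubce (R : realType) (ni nj : nat) (Fh : 'M[R]_(ni + nj)) : Prop :=
  sigma_min (ulsubmx Fh) = sigma_min (drsubmx Fh) /\
  ubce_bound R ni nj <= sigma_min (ulsubmx Fh).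

Definition orthogonal_mx (R : realType) (n : nat) (F : 'M[R]_n) : Prop :=
  F^T *m F = 1%:M.

Definition J_orthogonal (R : realType) (n : nat) (J F : 'M[R]_n) : Prop :=
  F^T *m J *m F = J.

Definition block_jacobi_step (R : realType) (m : nat) (p : 'I_m -> nat) (nu : nat)
    (i j : 'I_m) (A F A' : 'M[R]_(\sum_r p r)) : Prop :=
  exists Fh : 'M[R]_(p i + p j),
    [/\ F = block_elementary Fh,
        J_orthogonal (signature_mx R _ nu) F,
        (if same_part p nu i j then orthogonal_mx F /\ ubce Fh
         else J_orthogonal (block_mx 1%:M 0 0 (- 1%:M)) Fh),
        A' = F^T *m A *m F &
        is_diag_mx (pivot_submx i j A')].

(** [onth O (k %% size O)] is the pivot pair I_O(k) of the cyclic strategy; it is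
    [Some _] for every k because O is nonempty. *)
Definition pivot_at (m : nat) (O : seq ('I_m * 'I_m)) (k : nat) : option ('I_m * 'I_m) :=
  onth O (k %% size O).

Definition block_J_jacobi (R : realType) (m : nat) (p : 'I_m -> nat) (nu : nat)
    (O : seq ('I_m * 'I_m)) (A F : nat -> 'M[R]_(\sum_r p r)) : Prop :=
  forall k i j, pivot_at O k = Some (i, j) ->
    block_jacobi_step nu i j (A k) (F k) (A k.+1).

(** * Kernel algorithms *)

Definition diag_sorted (R : realType) (le : rel R) (n : nat) (M : 'M[R]_n) : Prop :=
  forall a b : 'I_n, (a <= b)%N -> le (M a a) (M b b).

Definition sorting_kernel (R : realType) (le : rel R) (m : nat) (p : 'I_m -> nat)
    (nu : nat) (O : seq ('I_m * 'I_m)) (A : nat -> 'M[R]_(\sum_r p r)) : Prop :=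
  forall k i j, pivot_at O k = Some (i, j) ->
    if same_part p nu i j then diag_sorted le (pivot_submx i j (A k.+1))
    else diag_sorted le (submxblock (A k.+1) i i) /\
         diag_sorted le (submxblock (A k.+1) j j).

Definition plane_mx (R : realType) (n : nat) (a b : 'I_n) (xaa xab xba xbb : R) :
    'M[R]_n :=
  \matrix_(s, t)
    if (s == a) && (t == a) then xaa else if (s == a) && (t == b) then xab
    else if (s == b) && (t == a) then xba else if (s == b) && (t == b) then xbb
    else (s == t)%:R.

Definition plane_rotation (R : realType) (n : nat) (a b : 'I_n) (phi : R) : 'M[R]_n :=
  plane_mx a b (cos phi) (- sin phi) (sin phi) (cos phi).

Definition hyperbolic_rotation (R : realType) (n : nat) (a b : 'I_n) (y : R) :
    'M[R]_n :=
  let ch := (expR y + expR (- y)) / 2 in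
  let sh := (expR y - expR (- y)) / 2 in
  plane_mx a b ch sh sh ch.

(** One step of an element-wise (J-)Jacobi method with
    J = diag(1 if sg s else -1 | s). *)
Definition elementwise_step (R : realType) (n : nat) (sg : pred 'I_n)
    (B B' : 'M[R]_n) : Prop :=
  exists (a b : 'I_n) (G : 'M[R]_n),
    [/\ (a < b)%N,
        (if sg a == sg b
         then exists phi, [/\ - (pi / 4) <= phi, phi <= pi / 4 &
                              G = plane_rotation a b phi]
         else exists y, G = hyperbolic_rotation a b y),
        B' = G^T *m B *m G &
        B' a b = 0].

(** An algorithm is given by the set [K B] of the sequences of iterates that it
    may generate from the starting matrix B. *)
Definition elementwise_method (R : realType) (n : nat) (sg : pred 'I_n)
    (K : 'M[R]_n -> set (nat -> 'M[R]_n)) : Prop :=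
  forall B, sym_posdef B -> K B !=set0 /\
    forall X, K B X -> X 0%N = B /\ forall l, elementwise_step sg (X l) (X l.+1).

Definition globally_convergent (R : realType) (n : nat)
    (K : 'M[R]_n -> set (nat -> 'M[R]_n)) : Prop :=
  forall B, sym_posdef B -> forall X, K B X ->
    exists2 D : 'M[R]_n, is_diag_mx D & X @ \oo --> D.

(** The signs are those of J on the pivot submatrix, up to a global sign when i
    and j belong to the same part. *)
Definition pivot_signs (m : nat) (p : 'I_m -> nat) (nu : nat) (i j : 'I_m) :
    pred 'I_(p i + p j) :=
  fun s => same_part p nu i j || (s < p i)%N.
Arguments pivot_signs {m} p nu i j.

Definition elementwise_kernel (R : realType) (m : nat) (p : 'I_m -> nat)
    (nu : nat) (O : seq ('I_m * 'I_m)) (A : nat -> 'M[R]_(\sum_r p r)) : Prop :=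
  exists K : forall i j : 'I_m,
      'M[R]_(p i + p j) -> set (nat -> 'M[R]_(p i + p j)),
    (forall i j : 'I_m, (i < j)%N ->
       elementwise_method (pivot_signs p nu i j) (K i j) /\
       globally_convergent (K i j)) /\
    forall k i j, pivot_at O k = Some (i, j) ->
      exists2 X, K i j (pivot_submx i j (A k)) X &
                 X @ \oo --> pivot_submx i j (A k.+1).

Definition kernel_convention (R : realType) (m : nat) (p : 'I_m -> nat)
    (nu : nat) (O : seq ('I_m * 'I_m)) (A : nat -> 'M[R]_(\sum_r p r)) : Prop :=
  [\/ sorting_kernel >=%R nu O A,
      sorting_kernel <=%R nu O A |
      elementwise_kernel nu O A].

(* Main.v *)
Require Import Defs.
From mathcomp Require Import all_boot all_order all_algebra all_fingroup.
From mathcomp Require Import all_classical all_reals all_analysis.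
From mathcomp Require Import ring lra zify.

(** After passing to limits along a free ultrafilter, the method becomes an
    exact process. The trace of A^(k) is nonincreasing, and its drop in a
    hyperbolic step dominates the off-diagonal blocks of the transformation, so
    the limits of the transformations are all orthogonal; the UBCE condition
    keeps their diagonal blocks nonsingular. Among the limits of the A^(k),
    choose one for which the off-norm is the limit superior. Going back over
    the preceding steps, the off-norm is constant, so every pivot block
    vanishes before and after its step. Block column by block column, this
    forces the limit of a serial ordering to be block diagonal, and the property
    is inherited by all equivalent orderings.

    For the diagonal elements, det (A^(k) - x J) does not depend on k, so the
    sequence of diagonals has finitely many cluster points. A sorting kernel
    moves between them only in the direction of a strictly increasing
    functional (Ky Fan), and an element-wise kernel, with its small rotation
    angles, does not move between them at all. *)

Set Implicit Arguments.
Unset Strict Implicit.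
Unset Printing Implicit Defensive.

Import Order.TTheory GRing.Theory Num.Theory.
Import numFieldNormedType.Exports.

Local Open Scope classical_set_scope.
Local Open Scope ring_scope.

(** * Flows with vanishing pivot blocks *)

(** A single free ultrafilter replaces repeated passage to subsequences: along it every bounded
    sequence converges, so all the shifted sequences [A (g l + k)] have limits at once, and these
    limits are linked by exact steps. Two obstacles shape the argument. Hyperbolic transformations
    have no a priori bound; the trace drop supplies one after division by a diagonal entry, which
    stays positive in the limit because the determinant is invariant. And the transformations need
    not approach the identity, so consecutive matrices need not be close; hence only the vanishing
    of blocks is tracked, never distances. If block [(i, r)] is zero, a step [(r, j)] multiplies
    block [(i, j)] by an invertible diagonal block, so its vanishing afterwards implies its
    vanishing before. A step whose pivot block is zero on both sides is reversible, and this
    algebraic part works over any commutative unit ring. An element-wise kernel performs infinitely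
    many plane steps within one block step, so its estimates must not depend on their number; they
    are written in terms of the trace drop, which telescopes. *)

Section Supported.
Variables (R : comUnitRingType) (n : nat).
Implicit Types (A U : 'M[R]_n) (P : pred 'I_n).

Definition supported_on P U :=
  forall s t, ~~ (P s && P t) -> U s t = (s == t)%:R.

(** Its invertibility is that of the submatrix on [P], expressed without changing the order of the
    matrix. *)
Definition pinch P U : 'M[R]_n :=
  \matrix_(s, t) if P s && P t then U s t else (s == t)%:R.

Lemma mulmx_supported_out P U A s t :
  supported_on P U -> ~~ P t -> (A *m U) s t = A s t.
Proof.
move=> hU Pt; rewrite mxE (bigD1 t) //= big1 ?addr0.
  by rewrite hU ?eqxx ?mulr1 // (negPf Pt) andbF.
by move=> b bt; rewrite hU ?(negPf bt) ?mulr0 // (negPf Pt) andbF.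
Qed.

Lemma mulmx_supported_in P U A s t :
  supported_on P U -> P t -> (A *m U) s t = \sum_(b | P b) A s b * U b t.
Proof.
move=> hU Pt; rewrite mxE (bigID P) /= [X in _ + X]big1 ?addr0 // => b Pb.
rewrite hU ?(negPf Pb) //.
by rewrite (_ : b == t = false) ?mulr0 //; apply: contraNF Pb => /eqP->.
Qed.

Lemma tr_supported P U : supported_on P U -> supported_on P U^T.
Proof. by move=> h s t hs; rewrite mxE h 1?andbC // eq_sym. Qed.

Lemma congr_supported_row P U A s t : supported_on P U -> ~~ P s ->
  (U^T *m A *m U) s t = (A *m U) s t.
Proof.
move=> hU Ps; rewrite -mulmxA -[U^T *m _]trmxK mxE trmx_mul trmxK.
by rewrite (mulmx_supported_out _ _ hU Ps) mxE.
Qed.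

Lemma tr_pinch P U : (pinch P U)^T = pinch P U^T.
Proof. by apply/matrixP => s t; rewrite !mxE andbC eq_sym. Qed.

Lemma pinch_unit_row P U (x : 'I_n -> R) : pinch P U \in unitmx ->
  (forall t, P t -> \sum_(b | P b) x b * U b t = 0) -> forall b, P b -> x b = 0.
Proof.
move=> uU hx b Pb.
pose y : 'rV[R]_n := \row_t if P t then x t else 0.
suff y0 : y = 0 by move/rowP/(_ b): y0; rewrite !mxE Pb.
suff: y *m pinch P U = 0 by move/(canRL (mulmxK uU)) ->; rewrite mul0mx.
apply/rowP => t; rewrite !mxE.
rewrite (bigID P) /= [X in _ + X]big1 ?addr0; last first.
  by move=> c Pc; rewrite !mxE (negPf Pc) mul0r.
case Pt: (P t).
  rewrite -[RHS](hx t Pt); apply: eq_bigr => c Pc.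
  by rewrite !mxE Pc Pt.
rewrite big1 // => c Pc; rewrite !mxE Pc Pt /=.
by rewrite (_ : c == t = false) ?mulr0 //; apply: contraTF Pc => /eqP->; rewrite Pt.
Qed.

End Supported.

(** * Reversible steps with zero pivot blocks, and their compositions *)

Section Flow.
Variables (R : comUnitRingType) (m n : nat) (blk : 'I_n -> 'I_m).
Implicit Types (A B U : 'M[R]_n) (x : 'I_m * 'I_m) (w : seq ('I_m * 'I_m)).

Definition in_pair x : pred 'I_n := fun s => (blk s == x.1) || (blk s == x.2).

Definition in_blk (i : 'I_m) : pred 'I_n := fun s => blk s == i.

Definition zero_blk A (i j : 'I_m) :=
  forall s t, blk s = i -> blk t = j -> A s t = 0.

(* What a step of the method becomes in the limit. *)
Definition idle x A A' :=
  exists U, [/\ U^T *m U = 1%:M, supported_on (in_pair x) U,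
    pinch (in_blk x.1) U \in unitmx /\ pinch (in_blk x.2) U \in unitmx,
    A' = U^T *m A *m U &
    [/\ A^T = A, zero_blk A x.1 x.2 & zero_blk A' x.1 x.2]].

Fixpoint flow w A A' :=
  if w is x :: w' then exists2 B, idle x A B & flow w' B A' else A = A'.

Definition blkdiag_on (S : {pred 'I_m}) A :=
  forall s t, blk s \in S -> blk t \in S -> blk s != blk t -> A s t = 0.

Definition blkdiag A := forall s t, blk s != blk t -> A s t = 0.

Lemma zero_blk_sym A i j : A^T = A -> zero_blk A i j -> zero_blk A j i.
Proof. by move=> sA h s t hs ht; rewrite -sA mxE h. Qed.

Lemma idle_sym x A A' : idle x A A' -> A'^T = A'.
Proof. by case=> U [_ _ _ -> [sA _ _]]; rewrite !trmx_mul trmxK sA mulmxA. Qed.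

(** The requirements before and after a step are the same, so [U^T] is a step back. This allows
    information to be carried backwards in time. *)
Lemma idle_rev x A A' : idle x A A' -> idle x A' A.
Proof.
move=> h; have sA' := idle_sym h; case: h => U [oU hU [u1 u2] eA [sA z z']].
have oU' := mulmx1C oU.
exists U^T; split => //; first by rewrite trmxK.
- exact: tr_supported.
- by rewrite -!tr_pinch !unitmx_tr.
- by rewrite trmxK eA !mulmxA oU' mul1mx -mulmxA oU' mulmx1.
Qed.

Lemma idle_swap i j A A' : idle (i, j) A A' -> idle (j, i) A A'.
Proof.
move=> h; have sA' := idle_sym h; case: h => U [oU hU [u1 u2] eA [sA z z']].
exists U; split => //=; last by split => //; apply: zero_blk_sym.
by move=> s t; rewrite /in_pair /= ![(blk _ == j) || _]orbC; exact: hU.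
Qed.

Lemma idle_out x A A' s t : idle x A A' -> ~~ in_pair x s -> ~~ in_pair x t ->
  A' s t = A s t.
Proof.
case=> U [oU hU _ -> _] Ps Pt.
by rewrite (congr_supported_row _ _ hU Ps) (mulmx_supported_out _ _ hU Pt).
Qed.

(** In a row outside the pair the step only combines entries of the two pivot blocks, which are
    already zero; the pivot block of [A'] is zero by the definition of [idle]. *)
Lemma idle_blkdiag_on (S : {pred 'I_m}) x A A' :
  x.1 \in S -> x.2 \in S -> idle x A A' -> blkdiag_on S A -> blkdiag_on S A'.
Proof.
move=> S1 S2 h dA.
have half s t : ~~ in_pair x s -> blk s \in S -> blk t \in S ->
    blk s != blk t -> A' s t = 0.
  move=> Ps Ss St st; case Pt: (in_pair x t); last first.
    by rewrite (idle_out h Ps) ?dA ?Pt.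
  case: h => U [oU hU _ -> _].
  rewrite (congr_supported_row _ _ hU Ps) (mulmx_supported_in _ _ hU Pt).
  rewrite big1 // => b Pb; rewrite dA ?mul0r //.
    by case/orP: Pb => /eqP->.
  by apply: contraNneq Ps; rewrite /in_pair => ->.
have sA' := idle_sym h.
move=> s t Ss St st; case Ps: (in_pair x s); last by rewrite half ?Ps.
case Pt: (in_pair x t); last by rewrite -sA' mxE half ?Pt // eq_sym.
case: h => U [_ _ _ _ [_ _ z]].
case/orP: Ps => /eqP es; case/orP: Pt => /eqP et; try by rewrite es et eqxx in st.
  exact: z.
by rewrite -sA' mxE z.
Qed.

(* Row [i] is untouched by the rotation except through block [j]. *)
Lemma idle_zero_blk_back i r j A A' : i != r -> i != j ->
  idle (r, j) A A' -> zero_blk A i r -> zero_blk A' i j -> zero_blk A i j.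
Proof.
move=> ir ij [U [oU hU [_ u2] eA' _]] zr zj s b es eb.
apply: (pinch_unit_row (x := A s) u2); last by rewrite /in_blk eb.
move=> t et.
have Ps : ~~ in_pair (r, j) s by rewrite /in_pair es negb_or ir.
have Pt : in_pair (r, j) t by rewrite /in_pair (eqP et) eqxx orbT.
have := zj s t es (eqP et).
rewrite eA' (congr_supported_row _ _ hU Ps) (mulmx_supported_in _ _ hU Pt) => e0.
rewrite -[RHS]e0 [RHS](bigID (in_blk j)) /= [X in _ + X]big1 ?addr0; last first.
  move=> c /andP[]; rewrite /in_pair /in_blk /= => /orP[/eqP ec _|->//].
  by rewrite (zr s c) // mul0r.
by apply: eq_big => // c; rewrite /in_pair /in_blk /=; case: eqP; rewrite ?orbT ?andbF.
Qed.

Lemma flow_cat w1 w2 A A' :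
  flow (w1 ++ w2) A A' <-> exists2 B, flow w1 A B & flow w2 B A'.
Proof.
elim: w1 A => [|x w1 IH] A /=.
  by split=> [h|[B -> //]]; exists A.
split=> [[B h /IH[C h1 h2]]|[C [B h h1] h2]].
  by exists C => //; exists B.
by exists B => //; apply/IH; exists C.
Qed.

Lemma flow_rev w A A' : flow w A A' -> flow (rev w) A' A.
Proof.
elim: w A => [|x w IH] A /= => [-> //|[B h /IH h']].
rewrite rev_cons -cats1; apply/flow_cat; exists B => //=.
by exists A => //; apply: idle_rev.
Qed.

Lemma flow_blkdiag_on (S : {pred 'I_m}) w A A' :
  {subset w <= [pred x : 'I_m * 'I_m | (x.1 \in S) && (x.2 \in S)]} ->
  flow w A A' -> blkdiag_on S A -> blkdiag_on S A'.
Proof.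
elim: w A => [|x w IH] A /= hS => [<- //|[B h /IH h'] dA].
apply: h' => [y yw|]; first by apply: hS; rewrite inE yw orbT.
have /andP[S1 S2] := hS x (mem_head _ _).
exact: idle_blkdiag_on h dA.
Qed.

Lemma flow_blkdiag_on_back (S : {pred 'I_m}) w A A' :
  {subset w <= [pred x : 'I_m * 'I_m | (x.1 \in S) && (x.2 \in S)]} ->
  flow w A A' -> blkdiag_on S A' -> blkdiag_on S A.
Proof.
move=> hS /flow_rev; apply: flow_blkdiag_on => x; rewrite mem_rev; exact: hS.
Qed.

(** The steps [(r, j)] are undone from the last to the first. Each of them leaves the blocks
    [(i, r')] with other [r'] in [w] untouched, so these are still zero when their turn comes. *)
Lemma flow_star_zero_blk j (w : seq 'I_m) i A A' : i != j -> i \notin w ->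
  uniq w -> j \notin w -> flow [seq (r, j) | r <- w] A A' ->
  (forall r, r \in w -> zero_blk A i r) -> zero_blk A' i j -> zero_blk A i j.
Proof.
move=> ij; elim: w A => [|r w IH] A /= => [_ _ _ -> //|].
rewrite !inE !negb_or => /andP[ir iw] /andP[rw uw] /andP[jr jw] [B h fl] z zj.
have zB r' : r' \in w -> zero_blk B i r'.
  move=> r'w s t es et; rewrite (idle_out h).
  - by apply: (z r') => //; rewrite inE r'w orbT.
  - by rewrite /in_pair es negb_or ir ij.
  - rewrite /in_pair et negb_or /=; apply/andP; split.
      by apply: contraNneq rw => <-.
    by apply: contraNneq jw => <-.
have zBj := IH _ iw uw jw fl zB zj.
by apply: (idle_zero_blk_back ir ij h) => //; apply: z; rewrite mem_head.
Qed.

(** Block [(i, j)] is zero at the moment when it is the pivot; the earlier steps of the star can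
    then be undone because [A] is already block diagonal on the indices they involve besides [j]. *)
Lemma flow_star j (w : seq 'I_m) A A' : A^T = A -> uniq w -> j \notin w ->
  flow [seq (r, j) | r <- w] A A' ->
  blkdiag_on (mem w) A -> blkdiag_on (mem (j :: w)) A.
Proof.
move=> sA uw jw fl dA.
have key i : i \in w -> zero_blk A i j.
  move=> iw; case/splitPr: iw uw jw fl dA => w1 w2 uw jw.
  rewrite map_cat => /flow_cat[B f1 [C [U [_ _ _ _ [_ zB _]]] _]] dA.
  rewrite cat_uniq /= negb_or in uw.
  have /and3P[u1 /andP[iw1 _] _] := uw.
  have [jw1 jw2] : j \notin w1 /\ j \notin i :: w2.
    by apply/andP; rewrite -negb_or -mem_cat.
  apply: (flow_star_zero_blk _ iw1 u1 jw1 f1) => //.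
    by apply: contraNneq jw2 => ->; rewrite mem_head.
  move=> r rw1 s t es et; apply: dA; rewrite ?es ?et ?mem_cat ?rw1 ?mem_head ?orbT //.
  by apply: contraNneq iw1 => ->.
move=> s t; rewrite !inE => /predU1P[es|es] /predU1P[et|et] st.
- by rewrite es et eqxx in st.
- by rewrite -sA mxE (key (blk t)).
- by rewrite (key (blk s)).
- exact: dA.
Qed.

Definition star_word (c : 'I_m -> seq 'I_m) (cs : seq 'I_m) :=
  [seq (r, j) | j <- cs, r <- c j].

Lemma flow_sym w A A' : A^T = A -> flow w A A' -> A'^T = A'.
Proof. by elim: w A => [|x w IH] A sA /= => [<- //|[B /idle_sym]]; exact: IH. Qed.

(** Block diagonality on the indices before [j] travels forward to the matrix at which the star of
    [j] begins, gains the index [j] there, and travels back to [A]. *)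
Lemma flow_star_word (c : 'I_m -> seq 'I_m) cs A A' : A^T = A -> uniq cs ->
  (forall c1 j c2, cs = c1 ++ j :: c2 -> perm_eq (c j) c1) ->
  flow (star_word c cs) A A' -> blkdiag_on (mem cs) A.
Proof.
move=> sA; elim/last_ind: cs A' => [|cs j IH] A' //.
rewrite rcons_uniq => /andP[jcs ucs] hc.
rewrite /star_word map_rcons flatten_rcons => /flow_cat[B f1 f2].
have hc1 c1 i c2 : cs = c1 ++ i :: c2 -> perm_eq (c i) c1.
  by move=> e; apply: (hc c1 i (rcons c2 j)); rewrite e rcons_cat.
have pj : perm_eq (c j) cs by apply: (hc cs j [::]); rewrite cats1.
have dA := IH _ ucs hc1 f1.
have sub : {subset star_word c cs <=
    [pred x : 'I_m * 'I_m | (x.1 \in cs) && (x.2 \in cs)]}.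
  move=> x /allpairsPdep[i [r [ics ric ->]]] /=; rewrite inE /= ics andbT.
  have [c1 [c2 e]] : exists c1 c2, cs = c1 ++ i :: c2.
    by case/splitPr: ics => c1 c2; exists c1, c2.
  by rewrite e mem_cat -(perm_mem (hc1 _ _ _ e)) ric.
have dB := flow_blkdiag_on sub f1 dA.
have eqc : c j =i cs := perm_mem pj.
have dB' : blkdiag_on (mem (j :: c j)) B.
  apply: flow_star f2 _; first exact: flow_sym f1.
  - by rewrite (perm_uniq pj).
  - by rewrite eqc.
  - by move=> s t; rewrite !eqc; exact: dB.
have sub' : {subset star_word c cs <=
    [pred x : 'I_m * 'I_m | (x.1 \in j :: c j) && (x.2 \in j :: c j)]}.
  move=> x /sub; rewrite !inE /= !eqc => /andP[-> ->]; by rewrite !orbT.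
have dA' := flow_blkdiag_on_back sub' f1 dB'.
move=> s t; rewrite !mem_rcons !inE => hs ht.
by apply: dA'; rewrite inE eqc.
Qed.

Lemma blkdiag_flow w A A' : flow w A A' -> blkdiag A <-> blkdiag A'.
Proof.
move=> f; have h B B' : flow w B B' -> blkdiag B -> blkdiag B'.
  move=> f' d s t st; apply: (flow_blkdiag_on (S := predT) _ f') => //.
  by move=> ? ? _ _; exact: d.
split; first exact: h.
move=> d s t st; apply: (flow_blkdiag_on_back (S := predT) _ f) => //.
by move=> ? ? _ _; exact: d.
Qed.

(** The two transformations commute and neither alters the pivot submatrix of the other. The new
    intermediate matrix thus agrees with [A] on the pair [x] and with [C] on the pair [y], which
    supplies its zero blocks. *)
Lemma idle_commute x y A B C : disjoint_pairs x y ->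
  idle x A B -> idle y B C -> exists2 B', idle y A B' & idle x B' C.
Proof.
move=> /and4P[d1 d2 d3 d4] hx hy.
have sB := idle_sym hx.
have dis s : in_pair x s -> ~~ in_pair y s.
  by case/orP => /eqP e; rewrite /in_pair e negb_or ?d1 ?d2 ?d3 ?d4.
have dis' s : in_pair y s -> ~~ in_pair x s by apply: contraL; exact: dis.
case: (hx) => U [oU hU uU eB [sA zA zB]].
case: (hy) => V [oV hV uV eC [_ zB' zC]].
have inl (z : 'I_m * 'I_m) s i : (i == z.1) || (i == z.2) -> blk s = i -> in_pair z s.
  by move=> h e; rewrite /in_pair e.
have UV : U *m V = V *m U.
  apply/matrixP => s t.
  case Px: (in_pair x t).
    rewrite (mulmx_supported_out _ _ hV (dis _ Px)) (mulmx_supported_in _ _ hU Px).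
    case Qs: (in_pair x s).
      rewrite (bigD1 s) //= hV ?(negPf (dis _ Qs)) // eqxx mul1r big1 ?addr0 //.
      move=> b /andP[Pb bs]; rewrite hV ?(negPf (dis _ Qs)) //.
      by rewrite eq_sym (negPf bs) mul0r.
    rewrite hU ?Qs // big1 => [|b Pb].
      by case: eqP Qs => // ->; rewrite Px.
    rewrite hV ?(negPf (dis _ Pb)) ?andbF // (_ : s == b = false) ?mul0r //.
    by apply: contraFF Qs => /eqP->.
  rewrite (mulmx_supported_out _ _ hU) ?Px //.
  case Py: (in_pair y t); last first.
    by rewrite (mulmx_supported_out _ _ hV) ?Py // hV ?Py ?andbF // hU ?Px ?andbF.
  rewrite (mulmx_supported_in _ _ hV Py).
  case Qs: (in_pair y s).
    rewrite (bigD1 s) //= hU ?(negPf (dis' _ Qs)) // eqxx mul1r big1 ?addr0 //.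
    move=> b /andP[Pb bs]; rewrite hU ?(negPf (dis' _ Qs)) //.
    by rewrite eq_sym (negPf bs) mul0r.
  rewrite hV ?Qs // big1 => [|b Pb].
    by case: eqP Qs => // ->; rewrite Py.
  rewrite hU ?(negPf (dis' _ Pb)) ?andbF // (_ : s == b = false) ?mul0r //.
  by apply: contraFF Qs => /eqP->.
have zAy : zero_blk A y.1 y.2.
  move=> s t es et; rewrite -(idle_out hx); first exact: zB'.
    by apply: dis'; apply: inl es; rewrite eqxx.
  by apply: dis'; apply: inl et; rewrite eqxx orbT.
pose B' := V^T *m A *m V.
have eC' : C = U^T *m B' *m U.
  by rewrite eC eB /B' !mulmxA -!trmx_mul -!mulmxA UV.
have hy' s t : in_pair x s -> in_pair x t -> B' s t = A s t.
  move=> Ps Pt; rewrite (congr_supported_row _ _ hV (dis _ Ps)).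
  by rewrite (mulmx_supported_out _ _ hV (dis _ Pt)).
have hx' s t : in_pair y s -> in_pair y t -> B' s t = C s t.
  move=> Ps Pt; rewrite eC' (congr_supported_row _ _ hU (dis' _ Ps)).
  by rewrite (mulmx_supported_out _ _ hU (dis' _ Pt)).
have sB' : B'^T = B' by rewrite !trmx_mul trmxK sA mulmxA.
exists B'.
  exists V; split => //; split => // s t es et; rewrite hx' ?zC //.
    by apply: inl es; rewrite eqxx.
  by apply: inl et; rewrite eqxx orbT.
exists U; split => //; split => // s t es et.
  rewrite hy' ?zA //.
    by apply: inl es; rewrite eqxx.
  by apply: inl et; rewrite eqxx orbT.
have -> : C s t = B s t; last exact: zB.
rewrite (idle_out hy) //; apply: dis.
  by apply: inl es; rewrite eqxx.
by apply: inl et; rewrite eqxx orbT.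
Qed.

Lemma flow_adj_transposition w w' A A' :
  adj_transposition w w' -> flow w A A' -> flow w' A A'.
Proof.
case=> [u [v [x [y [d -> ->]]]]].
move=> /flow_cat[B f1 /= [C hx [D hy f2]]].
apply/flow_cat; exists B => //=.
by have [E h1 h2] := idle_commute d hx hy; exists E => //; exists D.
Qed.

End Flow.

(** * Orderings whose repetition forces block diagonality *)

Section Forcing.
Variables (R : comUnitRingType) (m : nat).
Implicit Types (w : seq ('I_m * 'I_m)).

Definition repeat_word M w := flatten (nseq M w).

(** The number [M] of sweeps is left free because a cyclic shift consumes one more sweep; [blk] is
    quantified so that a relabelling of the blocks can be absorbed into it. *)
Definition forcing w := exists M, forall n (blk : 'I_n -> 'I_m) (A A' : 'M[R]_n),
  A^T = A -> flow blk (repeat_word M w) A A' -> blkdiag blk A.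

Lemma forcing_star_word (c : 'I_m -> seq 'I_m) cs : uniq cs -> cs =i predT ->
  (forall c1 j c2, cs = c1 ++ j :: c2 -> perm_eq (c j) c1) ->
  forcing (star_word c cs).
Proof.
move=> ucs ics hc; exists 1%N => n blk A A' sA.
rewrite /repeat_word /= cats0 => /(flow_star_word sA ucs hc) d s t st.
by apply: d => //; rewrite ?inE ics.
Qed.

Lemma flow_map_swap n (blk : 'I_n -> 'I_m) w (A A' : 'M[R]_n) :
  flow blk [seq (x.2, x.1) | x <- w] A A' <-> flow blk w A A'.
Proof.
elim: w A => [|[i j] w IH] A //=; split=> -[B /idle_swap h /IH f]; by exists B.
Qed.

(** A step does not see the order within its pair. Row orderings, where the newly added index comes
    first, thereby become star words. *)
Lemma forcing_map_swap w : forcing [seq (x.2, x.1) | x <- w] -> forcing w.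
Proof.
case=> M h; exists M => n blk A A' sA f; apply: (h n blk A A' sA).
have -> : repeat_word M [seq (x.2, x.1) | x <- w] =
    [seq (x.2, x.1) | x <- repeat_word M w].
  by rewrite /repeat_word map_flatten map_nseq.
by apply/flow_map_swap.
Qed.

Lemma ltn_split_enum (c1 c2 : seq 'I_m) j :
  enum 'I_m = c1 ++ j :: c2 -> perm_eq [seq i : 'I_m <- enum 'I_m | (i < j)%N] c1.
Proof.
move=> e; have : pairwise (fun i k : 'I_m => (i < k)%N) (enum 'I_m).
  have := iota_ltn_sorted 0 m; rewrite sorted_pairwise; last exact: ltn_trans.
  by rewrite -val_enum_ord pairwise_map.
rewrite {}e pairwise_cat pairwise_cons => /and3P[a1 _ /andP[a2 _]].
rewrite filter_cat /= ltnn.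
have -> : [seq i : 'I_m <- c1 | (i < j)%N] = c1.
  apply/all_filterP/allP => i ic; move/allrelP: a1; apply => //.
  exact: mem_head.
suff -> : [seq i : 'I_m <- c2 | (i < j)%N] = [::] by rewrite cats0.
apply/eqP; rewrite -(negbK (_ == _)) -has_filter; apply/hasPn => i ic.
by rewrite -leqNgt ltnW // (allP a2).
Qed.

Lemma gtn_split_enum (c1 c2 : seq 'I_m) j :
  rev (enum 'I_m) = c1 ++ j :: c2 -> perm_eq [seq i : 'I_m <- enum 'I_m | (j < i)%N] c1.
Proof.
move=> e; have : pairwise (fun i k : 'I_m => (i < k)%N) (enum 'I_m).
  have := iota_ltn_sorted 0 m; rewrite sorted_pairwise; last exact: ltn_trans.
  by rewrite -val_enum_ord pairwise_map.
have -> : enum 'I_m = rev c2 ++ j :: rev c1.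
  by rewrite -[LHS]revK e rev_cat rev_cons cat_rcons.
rewrite pairwise_cat pairwise_cons => /and3P[a1 _ /andP[a2 _]].
rewrite filter_cat /= ltnn.
have -> : [seq i : 'I_m <- rev c1 | (j < i)%N] = rev c1.
  by apply/all_filterP/allP => i ic; rewrite (allP a2).
suff -> : [seq i : 'I_m <- rev c2 | (j < i)%N] = [::] by rewrite perm_rev.
apply/eqP; rewrite -(negbK (_ == _)) -has_filter; apply/hasPn => i ic.
rewrite -leqNgt ltnW //; move/allrelP: a1; apply => //; exact: mem_head.
Qed.

Lemma forcing_col w : col_ordering w -> forcing w.
Proof.
case=> t [ht ->]; apply: (forcing_star_word (c := t)).
- exact: enum_uniq.
- by move=> i; rewrite mem_enum.
- by move=> c1 j c2 /ltn_split_enum; apply: perm_trans.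
Qed.

Lemma forcing_row w : row_ordering w -> forcing w.
Proof.
case=> t [ht ->]; apply: forcing_map_swap.
have -> : [seq (x.2, x.1) | x <- [seq (i, j) | i <- rev (enum 'I_m), j <- t i]] =
    star_word t (rev (enum 'I_m)).
  by rewrite map_allpairs.
apply: forcing_star_word.
- by rewrite rev_uniq enum_uniq.
- by move=> i; rewrite mem_rev mem_enum.
- by move=> c1 j c2 /gtn_split_enum; apply: perm_trans.
Qed.

Lemma rev_repeat_word M w : rev (repeat_word M w) = repeat_word M (rev w).
Proof. by rewrite /repeat_word rev_flatten map_nseq rev_nseq. Qed.

(** The reversed flow starts at [A'] and forces it to be block diagonal; the flow itself carries
    this back to [A]. *)
Lemma forcing_rev w : forcing (rev w) -> forcing w.
Proof.
case=> M h; exists M => n blk A A' sA f.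
apply/(blkdiag_flow f); apply: (h n blk A' A (flow_sym sA f)).
by rewrite -rev_repeat_word; apply: flow_rev.
Qed.

Lemma forcing_serial w : serial_with_perm w -> forcing w.
Proof.
case=> -[h|h]; [exact: forcing_col|exact: forcing_row| |]; apply: forcing_rev.
  exact: forcing_col.
exact: forcing_row.
Qed.

Lemma forcing_adj_transposition w w' :
  adj_transposition w w' -> forcing w' -> forcing w.
Proof.
move=> a [M h]; exists M => n blk A A' sA f; apply: (h n blk A A' sA).
elim: M {h} A {sA} f => [|M IH] A //= /flow_cat[B f1 f2].
by apply/flow_cat; exists B; [apply: flow_adj_transposition f1|apply: IH].
Qed.

Lemma adj_transposition_sym w w' : adj_transposition w w' -> adj_transposition w' w.
Proof.
case=> [u [v [x [y [/and4P[d1 d2 d3 d4] -> ->]]]]]; exists u, v, y, x; split => //.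
by apply/and4P; rewrite ![y.1 == _]eq_sym ![y.2 == _]eq_sym.
Qed.

Lemma forcing_shift w w' : shift_equiv w w' -> forcing w' -> forcing w.
Proof.
case=> u [v [-> ->]] [M h]; exists M.+1 => n blk A A' sA.
(* The additional sweep pays for the incomplete pieces at the two ends. *)
have -> : repeat_word M.+1 (u ++ v) = u ++ repeat_word M (v ++ u) ++ v.
  rewrite /repeat_word /=; elim: M {h} => [|M IH] /=; first by rewrite cats0.
  by rewrite IH -!catA.
move=> /flow_cat[B f1 /flow_cat[C f2 _]].
by apply/(blkdiag_flow f1); apply: h f2; apply: flow_sym f1.
Qed.

Lemma forcing_equiv w w' : Defs.equiv w w' -> forcing w <-> forcing w'.
Proof.
elim=> [x y a|x|x y z _ xy _ yz]; last by rewrite xy.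
- split; apply: forcing_adj_transposition => //; exact: adj_transposition_sym.
- by [].
Qed.

Lemma forcing_weak_equiv w w' : weak_equiv w w' -> forcing w <-> forcing w'.
Proof.
elim=> [x y [a|a]|x|x y z _ xy _ yz]; last by rewrite xy.
- exact: forcing_equiv.
- split; apply: forcing_shift => //; by case: a => u [v [-> ->]]; exists v, u.
- by [].
Qed.

(** Block [i] of the composed map is block [q i] of [blk], so the matrices stay the same and only
    the names of the blocks change. *)
Lemma idle_relabel n (blk : 'I_n -> 'I_m) (q : 'S_m) x (A A' : 'M[R]_n) :
  idle blk (q x.1, q x.2) A A' -> idle (fun s => (q^-1)%g (blk s)) x A A'.
Proof.
have qE s i : ((q^-1)%g (blk s) == i) = (blk s == q i).
  by apply/eqP/eqP => [<-|->]; rewrite ?permKV ?permK.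
have zE B i j : zero_blk blk B (q i) (q j) -> zero_blk (fun s => (q^-1)%g (blk s)) B i j.
  by move=> z s t /eqP es /eqP et; apply: z; apply/eqP; rewrite -qE.
case=> U [oU hU [u1 u2] eA [sA z z']]; exists U; split => //=.
- by move=> s t; rewrite /in_pair !qE; exact: hU.
- have pE i : pinch (in_blk (fun s => (q^-1)%g (blk s)) i) U = pinch (in_blk blk (q i)) U.
    by apply/matrixP => s t; rewrite !mxE /in_blk !qE.
  by rewrite !pE.
- by split => //; apply: zE.
Qed.

Lemma forcing_relabel (q : 'S_m) w : forcing w -> forcing (relabel q w).
Proof.
case=> M h; exists M => n blk A A' sA f s t st.
have {}f : flow (fun s => (q^-1)%g (blk s)) (repeat_word M w) A A'.
  move: f; have -> : repeat_word M (relabel q w) = relabel q (repeat_word M w).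
    by rewrite /repeat_word /relabel map_flatten map_nseq.
  elim: (repeat_word M w) A {sA} => [|x v IH] A //= [B hx /IH f]; exists B => //.
  apply: idle_relabel; move: hx; rewrite /sort_pair; case: ifP => _ //.
  exact: idle_swap.
by apply: (h _ _ _ _ sA f); rewrite (inj_eq perm_inj).
Qed.


Theorem forcing_generalized_serial w : generalized_serial w -> forcing w.
Proof.
case=> _ [w' [w'' [_ /forcing_serial h [[[q ->] /forcing_weak_equiv e]|
  [/forcing_weak_equiv e [q eq]]]]]].
  by apply: forcing_relabel; apply/e.
by apply/e; rewrite eq; apply: forcing_relabel.
Qed.

End Forcing.

(** * Ultralimits *)

Section Ultralimit.
Variables (R : realType) (U : set_system nat).
Context {ultraU : UltraFilter U}.

Lemma ultra_bounded_cvg (x : nat -> R) M :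
  (\forall l \near U, `|x l| <= M) -> exists a : R, x @ U --> a.
Proof.
move=> hM; have := @segment_compact R (- M) M; rewrite compact_ultra => /(_ (x @ U)).
case=> [||a [_ ax]]; last by exists a.
(* The image filter is maximal: for each set, either its preimage or the complement of the preimage
   belongs to [U]. *)
- split; first exact: fmap_proper_filter.
  move=> G GF sG; rewrite predeqE => A; split; last exact: sG.
  move=> GA; have [//|nA] := in_ultra_setVsetC (x @^-1` A) ultraU.
  have GnA : G (~` A) by apply: sG.
  have GI : G (A `&` ~` A) by apply: filterI.
  by have [z []] := @filter_ex _ _ GF _ GI.
- apply: filterS hM => l /=; rewrite ler_norml => /andP[h1 h2].
  by rewrite in_itv /= h1 h2.
Qed.

Lemma ultra_pigeonhole (T : finType) (c : nat -> T) :
  exists a, \forall l \near U, c l = a.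
Proof.
suff h (s : seq T) : (\forall l \near U, c l \in s) -> exists a, \forall l \near U, c l = a.
  by apply: (h (enum T)); apply: nearW => l; rewrite mem_enum.
elim: s => [|a s IH] h; first by have /filter_ex[] := h.
have [ha|ha] := in_ultra_setVsetC [set l | c l = a] ultraU; first by exists a.
apply: IH; apply: filterS2 h ha => l; rewrite inE => /predU1P[ca|//] nca.
by case: nca.
Qed.

Lemma cvg_sum_ord (I : finType) (P : pred I) (x : I -> nat -> R) (a : I -> R) :
  (forall i, P i -> x i @ U --> a i) ->
  (fun l => \sum_(i | P i) x i l) @ U --> \sum_(i | P i) a i.
Proof. by move=> h; apply: cvg_big => // z; exact: add_continuous. Qed.

Lemma cvg_prod_ord (I : finType) (P : pred I) (x : I -> nat -> R) (a : I -> R) :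
  (forall i, P i -> x i @ U --> a i) ->
  (fun l => \prod_(i | P i) x i l) @ U --> \prod_(i | P i) a i.
Proof. by move=> h; apply: cvg_big => // z; exact: mul_continuous. Qed.

Lemma ultra_cvg_eq (x : nat -> R) (a b : R) : x @ U --> a -> x @ U --> b -> a = b.
Proof. exact: (cvg_unique (@norm_hausdorff _ R^o)). Qed.

Lemma ultra_cvg_near (x y : nat -> R) (a : R) :
  (\forall l \near U, x l = y l) -> x @ U --> a -> y @ U --> a.
Proof. by move=> h; apply: cvg_trans; apply: near_eq_cvg; apply: filterS h => l ->. Qed.

Lemma ultra_cvg_near_cst (y : nat -> R) (a : R) :
  (\forall l \near U, y l = a) -> y @ U --> a.
Proof.
move=> h; have c : (fun=> a) @ U --> a by exact: cvg_cst.
by apply: ultra_cvg_near c; apply: filterS h => l ->.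
Qed.

Lemma ultra_cvg_le (x y : nat -> R) (a b : R) : (\forall l \near U, x l <= y l) ->
  x @ U --> a -> y @ U --> b -> a <= b.
Proof. by move=> h xa yb; apply: (ler_cvg_to xa yb). Qed.

Definition mcvg p q (M : nat -> 'M[R]_(p, q)) (L : 'M[R]_(p, q)) :=
  forall s t, (fun l => M l s t) @ U --> L s t.

Lemma mcvg_cst p q (L : 'M[R]_(p, q)) : mcvg (fun=> L) L.
Proof. by move=> s t; apply: cvg_cst. Qed.

Lemma mcvg_eq p q (M : nat -> 'M[R]_(p, q)) L L' : mcvg M L -> mcvg M L' -> L = L'.
Proof. by move=> h h'; apply/matrixP => s t; apply: ultra_cvg_eq (h s t) (h' s t). Qed.

Lemma mcvg_near p q (M N : nat -> 'M[R]_(p, q)) L :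
  (\forall l \near U, M l = N l) -> mcvg M L -> mcvg N L.
Proof.
by move=> h hM s t; apply: ultra_cvg_near (hM s t); apply: filterS h => l ->.
Qed.

Lemma mcvg_mul p q r (M : nat -> 'M[R]_(p, q)) (N : nat -> 'M[R]_(q, r)) L K :
  mcvg M L -> mcvg N K -> mcvg (fun l => M l *m N l) (L *m K).
Proof.
move=> hM hN s t; rewrite mxE; under eq_cvg do rewrite mxE.
by apply: cvg_sum_ord => i _; apply: cvgM.
Qed.

Lemma mcvg_tr p q (M : nat -> 'M[R]_(p, q)) L :
  mcvg M L -> mcvg (fun l => (M l)^T) L^T.
Proof. by move=> hM s t; rewrite mxE; under eq_cvg do rewrite mxE; apply: hM. Qed.

Lemma mcvg_sub p q (M N : nat -> 'M[R]_(p, q)) L K :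
  mcvg M L -> mcvg N K -> mcvg (fun l => M l - N l) (L - K).
Proof.
move=> hM hN s t; rewrite !mxE; under eq_cvg do rewrite !mxE.
by apply: cvgB.
Qed.

Lemma cvg_det n (M : nat -> 'M[R]_n) L :
  mcvg M L -> (fun l => \det (M l)) @ U --> \det L.
Proof.
move=> hM; rewrite /determinant; apply: cvg_sum_ord => s _.
by apply: cvgM; [exact: cvg_cst|apply: cvg_prod_ord => i _].
Qed.

Lemma cvg_trace n (M : nat -> 'M[R]_n) L :
  mcvg M L -> (fun l => \tr (M l)) @ U --> \tr L.
Proof. by move=> hM; apply: cvg_sum_ord => s _. Qed.

Lemma mcvg_bounded p q (M : nat -> 'M[R]_(p, q)) (B : R) :
  (\forall l \near U, forall s t, `|M l s t| <= B) -> exists L, mcvg M L.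
Proof.
move=> h.
have e (x : 'I_p * 'I_q) : exists a : R, (fun l => M l x.1 x.2) @ U --> a.
  by apply: (@ultra_bounded_cvg _ B); apply: filterS h => l.
have [g hg] := choice e.
by exists (\matrix_(s, t) g (s, t)) => s t; rewrite mxE; exact: (hg (s, t)).
Qed.

Hypothesis freeU : \oo `<=` U.

Lemma cvg_subseq (x : nat -> R) (a : R) (f : nat -> nat) : (forall l, (l <= f l)%N) ->
  x @ \oo --> a -> (fun l => x (f l)) @ U --> a.
Proof.
move=> hf xa; suff h : (fun l => x (f l)) @ \oo --> a.
  by move=> B /h; exact: freeU.
apply: (cvg_comp f x); last exact: xa.
move=> B [N _ hB]; exists N => // l /= Nl; apply: hB => /=.
exact: leq_trans (hf l).
Qed.

End Ultralimit.

Arguments mcvg_cst {R} U {ultraU p q} L.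

Lemma free_ultrafilter : exists U : set_system nat, UltraFilter U /\ \oo `<=` U.
Proof. exact: ultraFilterLemma. Qed.

Lemma not_near_subseq (P : set nat) : ~ (\forall k \near \oo, P k) ->
  exists f : nat -> nat, forall l, (l <= f l)%N /\ ~ P (f l).
Proof.
move=> h.
suff hl l : exists k, (l <= k)%N /\ ~ P k by have [f hf] := choice hl; exists f.
apply: contrapT => /forallNP hk; apply: h; exists l => // k /= lk.
by apply: contrapT => nP; apply: (hk k).
Qed.

Lemma mx_cvg (R : realType) p q (M : nat -> 'M[R]_(p, q)) (L : 'M[R]_(p, q)) :
  (forall s t, (fun k => M k s t) @ \oo --> L s t) -> M @ \oo --> L.
Proof.
move=> h; apply/cvg_ballP => e e0; near=> k.
split=> // s t; move: s t; near: k.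
have : forall st : 'I_p * 'I_q, \forall k \near \oo, ball (L st.1 st.2) e (M k st.1 st.2).
  by move=> st; have /cvg_ballP := h st.1 st.2; apply.
by move=> /filter_forall; apply: filterS => k hk s t; exact: (hk (s, t)).
Unshelve. all: by end_near. Qed.

Lemma cvg_mx_entry (R : realType) (F : set_system nat) {FF : Filter F} p q
    (M : nat -> 'M[R]_(p, q)) (L : 'M[R]_(p, q)) s t :
  M @ F --> L -> (fun k => M k s t) @ F --> L s t.
Proof. 
move=> h; have c := @coord_continuous R p q s t L.
exact: (cvg_comp _ _ h c).
 Qed.

Lemma sqr_cvg0 (R : realType) (F : set_system nat) {FF : Filter F} (x : nat -> R) :
  (fun l => x l ^+ 2) @ F --> (0 : R) -> x @ F --> (0 : R).
Proof.
move=> h; apply/cvgr0Pnorm_lt => e e0.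
have /cvgr0Pnorm_lt/(_ _ (exprn_gt0 2 e0)) := h; apply: filterS => l.
by rewrite normrX ltr_pXn2r ?nnegrE // ltW.
Qed.

(** * Quadratic forms and J-orthogonal matrices *)

Section QuadraticForm.
Variables (R : realType).

Definition qform n (A : 'M[R]_n) (x : 'cV[R]_n) : R := (x^T *m A *m x) 0 0.

Definition psd n (A : 'M[R]_n) := forall x, 0 <= qform A x.

Definition nsq n (x : 'cV[R]_n) : R := \sum_s x s 0 ^+ 2.

Lemma nsq_ge0 n (x : 'cV[R]_n) : 0 <= nsq x.
Proof. by apply: sumr_ge0 => s _; rewrite sqr_ge0. Qed.

Lemma nsq_eq0 n (x : 'cV[R]_n) : (nsq x == 0) = (x == 0).
Proof.
rewrite psumr_eq0; last by move=> s _; rewrite sqr_ge0.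
apply/idP/eqP => [/allP h|->]; last by apply/allP => s _; rewrite mxE expr0n eqxx.
apply/colP => s; rewrite mxE; apply/eqP.
by rewrite -sqrf_eq0; apply: (h s); rewrite mem_index_enum.
Qed.

Lemma nsqE n (x : 'cV[R]_n) : nsq x = (x^T *m x) 0 0.
Proof. by rewrite mxE; apply: eq_bigr => s _; rewrite mxE expr2. Qed.

Lemma nsqZ n (a : R) (x : 'cV[R]_n) : nsq (a *: x) = a ^+ 2 * nsq x.
Proof. by rewrite mulr_sumr; apply: eq_bigr => s _; rewrite mxE exprMn. Qed.

Lemma entry_tr p q (A : 'M[R]_(p, q)) s t : A s t = A^T t s.
Proof. by rewrite mxE. Qed.

Lemma qformE n (A : 'M[R]_n) x : qform A x = \sum_s \sum_t x s 0 * A s t * x t 0.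
Proof.
rewrite /qform mxE exchange_big /=; apply: eq_bigr => t _.
rewrite mxE mulr_suml; apply: eq_bigr => s _; by rewrite mxE.
Qed.

Lemma qformZ n (A : 'M[R]_n) a x : qform A (a *: x) = a ^+ 2 * qform A x.
Proof.
rewrite !qformE mulr_sumr; apply: eq_bigr => s _; rewrite mulr_sumr.
by apply: eq_bigr => t _; rewrite !mxE; ring.
Qed.

Lemma qform_congr n (F A : 'M[R]_n) x : qform (F^T *m A *m F) x = qform A (F *m x).
Proof. by rewrite /qform trmx_mul !mulmxA. Qed.

Lemma qform_addl n (A : 'M[R]_n) (x y : 'cV[R]_n) (a : R) : A^T = A ->
  qform A (x + a *: y) =
  qform A x + 2 * a * (y^T *m (A *m x)) 0 0 + a ^+ 2 * qform A y.
Proof.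
move=> sA.
have e : (x^T *m (A *m y)) 0 0 = (y^T *m (A *m x)) 0 0.
  by rewrite [LHS]entry_tr !trmx_mul trmxK sA mulmxA.
have {e} e' : x^T *m (A *m y) = y^T *m (A *m x).
  by apply/matrixP => i j; rewrite !ord1.
have -> : qform A (x + a *: y) = ((x^T + a *: y^T) *m A *m (x + a *: y)) 0 0.
  by rewrite /qform; congr ((_ *m _ *m _) _ _); apply/matrixP => i j; rewrite !mxE.
rewrite /qform !mulmxDl !mulmxDr -!scalemxAl -!scalemxAr -!mulmxA e'.
by rewrite !mxE; ring.
Qed.

Lemma psd_kernel n (A : 'M[R]_n) x : A^T = A -> psd A -> qform A x = 0 -> A *m x = 0.
Proof.
move=> sA pA qx; apply/eqP; rewrite -nsq_eq0; apply/eqP.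
set c := nsq _; set d := qform A (A *m x).
have c0 : 0 <= c := nsq_ge0 _.
have d0 : 0 <= d := pA _.
(* The optimal multiplier would be [- c / d]; the denominator [d + 1] also covers [d = 0] and still
   makes the form negative unless [c = 0]. *)
have := pA (x + (- c / (d + 1)) *: (A *m x)).
rewrite qform_addl // qx -nsqE -/c -/d add0r.
have d1 : 0 < d + 1 by lra.
have -> : 2 * (- c / (d + 1)) * c + (- c / (d + 1)) ^+ 2 * d =
    - (c ^+ 2 * (d + 2)) / (d + 1) ^+ 2 by field; rewrite lt0r_neq0.
rewrite mulNr oppr_ge0 pmulr_lle0 ?invr_gt0 ?exprn_gt0 // pmulr_lle0; last lra.
by move=> h; apply/eqP; rewrite -sqrf_eq0 eq_le h sqr_ge0.
Qed.

Lemma psd_posdef n (A : 'M[R]_n) : A^T = A -> psd A -> \det A != 0 -> sym_posdef A.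
Proof.
move=> sA pA dA; split=> // x x0; rewrite lt_neqAle pA andbT eq_sym.
apply: contraNneq x0 => qx; have := psd_kernel sA pA qx.
have uA : A \in unitmx by rewrite unitmxE unitfE.
by move/(canRL (mulKmx uA)) ->; rewrite mulmx0.
Qed.

Lemma posdef_psd n (A : 'M[R]_n) : sym_posdef A -> psd A.
Proof.
case=> _ pA x; have [->|x0] := eqVneq x 0; first by rewrite /qform mulmx0 mxE.
exact/ltW/pA.
Qed.

Lemma posdef_det n (A : 'M[R]_n) : sym_posdef A -> \det A != 0.
Proof.
case=> sA pA; rewrite -det_tr; apply/det0P => -[v v0 vA].
have /pA : v^T != 0 by rewrite trmx_eq0.
by rewrite trmxK -sA vA mul0mx mxE ltxx.
Qed.

Lemma posdef_congr n (F A : 'M[R]_n) : F \in unitmx -> sym_posdef A ->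
  sym_posdef (F^T *m A *m F).
Proof.
move=> uF [sA pA]; split; first by rewrite !trmx_mul trmxK sA mulmxA.
move=> x x0; have := pA (F *m x); rewrite -/(qform _ _) -/(qform _ _) qform_congr; apply.
by apply: contraNneq x0 => /(canRL (mulKmx uF)) ->; rewrite mulmx0.
Qed.

Lemma qform_delta n (A : 'M[R]_n) s : qform A (delta_mx s 0) = A s s.
Proof. by rewrite /qform trmx_delta -rowE -colE !mxE. Qed.

Lemma posdef_diag n (A : 'M[R]_n) s : sym_posdef A -> 0 < A s s.
Proof.
case=> _ pA; rewrite -qform_delta; apply: pA.
by apply/eqP => /matrixP/(_ s 0)/eqP; rewrite !mxE !eqxx oner_eq0.
Qed.

Lemma psd_diag n (A : 'M[R]_n) s : psd A -> 0 <= A s s.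
Proof. by move=> pA; rewrite -qform_delta. Qed.

Lemma psd_diag_le_trace n (A : 'M[R]_n) s : psd A -> A s s <= \tr A.
Proof.
move=> pA; rewrite /mxtrace (bigD1 s) //= lerDl.
by apply: sumr_ge0 => t _; apply: psd_diag.
Qed.

(** The form is tested on the sum and the difference of two unit vectors. *)
Lemma psd_entry_le_trace n (A : 'M[R]_n) s t : A^T = A -> psd A -> `|A s t| <= \tr A.
Proof.
move=> sA pA; have hs := psd_diag_le_trace s pA; have ht := psd_diag_le_trace t pA.
have e : ((delta_mx t 0 : 'cV_n)^T *m (A *m (delta_mx s 0 : 'cV_n))) 0 0 = A s t.
  by rewrite trmx_delta -rowE -colE !mxE -[in LHS]sA mxE.
have := pA (delta_mx s 0 + 1 *: delta_mx t 0).
have := pA (delta_mx s 0 + (- 1) *: delta_mx t 0).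
rewrite !qform_addl // !qform_delta e ler_norml => h1 h2.
by apply/andP; split; lra.
Qed.

Lemma tr_gram n p (A : 'M[R]_(p, n)) : \tr (A^T *m A) = \sum_s \sum_t A s t ^+ 2.
Proof.
rewrite /mxtrace exchange_big /=; apply: eq_bigr => t _; rewrite mxE.
by apply: eq_bigr => s _; rewrite mxE expr2.
Qed.

End QuadraticForm.

Section Signature.
Variables (R : realType) (n : nat) (sg : pred 'I_n).
Implicit Types (A B F K : 'M[R]_n).

Definition sgn (s : 'I_n) : R := if sg s then 1 else -1.

Definition sgn_mx : 'M[R]_n := diag_mx (\row_s sgn s).

Lemma sgn_sqr s : sgn s * sgn s = 1.
Proof. by rewrite /sgn; case: ifP => _; rewrite ?mulrNN mulr1. Qed.

Lemma sgn_mxK : sgn_mx *m sgn_mx = 1%:M.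
Proof.
rewrite mulmx_diag -diag_const_mx; congr diag_mx; apply/rowP => s.
by rewrite !mxE sgn_sqr.
Qed.

Lemma tr_sgn_mx : sgn_mx^T = sgn_mx.
Proof. exact: tr_diag_mx. Qed.

Lemma sgn_mulmxE A s t : (sgn_mx *m A) s t = sgn s * A s t.
Proof. by rewrite mul_diag_mx !mxE. Qed.

Lemma mulmx_sgnE A s t : (A *m sgn_mx) s t = A s t * sgn t.
Proof. by rewrite mul_mx_diag !mxE. Qed.

Lemma J_orthogonal_inv F : J_orthogonal sgn_mx F ->
  sgn_mx *m F^T *m sgn_mx *m F = 1%:M.
Proof. by move=> h; rewrite -!mulmxA (mulmxA F^T) h sgn_mxK. Qed.

Lemma J_orthogonal_unit F : J_orthogonal sgn_mx F -> F \in unitmx.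
Proof. by move/J_orthogonal_inv/mulmx1_unit => []. Qed.

Lemma J_orthogonal_tr F : J_orthogonal sgn_mx F -> J_orthogonal sgn_mx F^T.
Proof.
move/J_orthogonal_inv/mulmx1C => h; rewrite /J_orthogonal trmxK.
have -> : F *m sgn_mx *m F^T = F *m (sgn_mx *m F^T *m sgn_mx) *m sgn_mx.
  by rewrite !mulmxA -[_ *m sgn_mx *m sgn_mx]mulmxA sgn_mxK mulmx1.
by rewrite h mul1mx.
Qed.

Lemma J_orthogonal_mul F K : J_orthogonal sgn_mx F -> J_orthogonal sgn_mx K ->
  J_orthogonal sgn_mx (F *m K).
Proof.
move=> hF hK; rewrite /J_orthogonal trmx_mul -!mulmxA (mulmxA sgn_mx).
by rewrite (mulmxA F^T) (mulmxA F^T) hF mulmxA.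
Qed.

(** The diagonal of [F J F^T = J] says that the same-sign squares of a row exceed the opposite-sign
    ones by 1. *)
Lemma J_orthogonal_row F s : J_orthogonal sgn_mx F ->
  \sum_t F s t ^+ 2 = 1 + 2 * \sum_(t | sg t != sg s) F s t ^+ 2.
Proof.
move/J_orthogonal_tr; rewrite /J_orthogonal trmxK => /matrixP/(_ s s).
rewrite mxE [RHS]mxE eqxx mulr1n mxE => h.
have {h} h : \sum_t sgn s * sgn t * F s t ^+ 2 = 1.
  rewrite -(sgn_sqr s) -[X in _ = _ * X]h mulr_sumr; apply: eq_bigr => t _.
  by rewrite mulmx_sgnE mxE; ring.
rewrite -[X in _ = X + _]h [X in X + _](bigID (fun t => sg t != sg s)) /=.
rewrite [LHS](bigID (fun t => sg t != sg s)) /=.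
rewrite [X in _ = X + _ + _](eq_bigr (fun t => - F s t ^+ 2)); last first.
  by move=> t; rewrite /sgn; do 2 case: ifP => _ //; rewrite ?mulN1r ?mul1r ?mulrN1 ?mulNr ?mul1r.
rewrite [X in _ = _ + X + _](eq_bigr (fun t => F s t ^+ 2)); last first.
  move=> t; rewrite negbK => /eqP ts.
  by rewrite /sgn ts; case: ifP => _; rewrite ?mulrNN !mul1r.
by rewrite sumrN; ring.
Qed.

(** By cyclicity this is the trace of [B K K^T]; the hypothesis leaves only products of diagonal
    entries, and those of [K K^T] are row norms. When [B] has positive diagonal, the excess over the
    trace of [B] is a sum of nonnegative terms that controls the opposite-sign entries of [K]. *)
Lemma trace_J_congr K B : J_orthogonal sgn_mx K ->
  (forall s t, s != t -> B s t = 0 \/ (K *m K^T) s t = 0) ->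
  \tr (K^T *m B *m K) =
  \tr B + 2 * \sum_s B s s * \sum_(t | sg t != sg s) K s t ^+ 2.
Proof.
move=> jK hB; rewrite -mulmxA mxtrace_mulC -mulmxA /mxtrace mulr_sumr -big_split /=.
apply: eq_bigr => s _; rewrite mxE (bigD1 s) //= [X in _ + X]big1 ?addr0; last first.
  move=> t; rewrite eq_sym => /hB[->|e]; first by rewrite mul0r.
  by rewrite [(K *m K^T) t s]entry_tr trmx_mul trmxK e mulr0.
have -> : (K *m K^T) s s = \sum_t K s t ^+ 2.
  by rewrite mxE; apply: eq_bigr => t _; rewrite mxE expr2.
by rewrite J_orthogonal_row //; ring.
Qed.

Lemma det_J_congr F A (x : R) : J_orthogonal sgn_mx F ->
  \det (F^T *m A *m F - x *: sgn_mx) = \det (A - x *: sgn_mx).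
Proof.
move=> jF; have -> : F^T *m A *m F - x *: sgn_mx = F^T *m (A - x *: sgn_mx) *m F.
  by rewrite mulmxBr mulmxBl -scalemxAr -scalemxAl jF.
rewrite !det_mulmx det_tr.
have uF := J_orthogonal_unit jF.
have : \det (F^T *m sgn_mx *m F) = \det sgn_mx by rewrite jF.
rewrite !det_mulmx det_tr.
have : \det sgn_mx != 0.
  apply/eqP => e; have := congr1 determinant sgn_mxK; rewrite det_mulmx e mul0r.
  by rewrite det1 => /esym/eqP; rewrite oner_eq0.
move=> d0 e; have e1 : \det F * \det F = 1.
  by apply: (mulfI d0); rewrite mulr1 -[RHS]e; ring.
by rewrite mulrAC e1 mul1r.
Qed.

(** Such an [F] commutes with [J], so [J] cancels from the relation. *)
Lemma J_orthogonal_orthogonal F : J_orthogonal sgn_mx F ->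
  (forall s t, sg s != sg t -> F s t = 0) -> F^T *m F = 1%:M.
Proof.
move=> jF hF; have e : sgn_mx *m F = F *m sgn_mx.
  apply/matrixP => s t; rewrite sgn_mulmxE mulmx_sgnE mulrC.
  have [st|st] := eqVneq (sg s) (sg t); first by rewrite /sgn st.
  by rewrite hF // !mul0r.
have := J_orthogonal_tr jF; rewrite /J_orthogonal trmxK -e -mulmxA => h.
apply: mulmx1C; have := congr1 (mulmx sgn_mx) h.
by rewrite mulmxA sgn_mxK mul1mx.
Qed.

End Signature.

(** * Smallest singular values *)

Section SmallestSingularValue.
Variables (R : realType) (U : set_system nat).
Context {ultraU : UltraFilter U}.
Hypothesis freeU : \oo `<=` U.

Lemma cvg_qform n (A : nat -> 'M[R]_n) L (x : nat -> 'cV[R]_n) y :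
  mcvg U A L -> mcvg U x y -> (fun l => qform (A l) (x l)) @ U --> qform L y.
Proof. by move=> hA hx; apply: mcvg_mul => //; apply: mcvg_mul => //; apply: mcvg_tr. Qed.

Lemma cvg_nsq n (x : nat -> 'cV[R]_n) y :
  mcvg U x y -> (fun l => nsq (x l)) @ U --> nsq y.
Proof.
by move=> hx; rewrite /nsq; apply: cvg_sum_ord => s _; rewrite expr2; apply: cvgM.
Qed.

Lemma nsq_entry_le n (x : 'cV[R]_n) s : x s 0 ^+ 2 <= nsq x.
Proof. by rewrite /nsq (bigD1 s) //= lerDl sumr_ge0 // => t _; rewrite sqr_ge0. Qed.

(** Since [sigma_min] is an infimum over eigenvalues, a norm bound requires that the infimum of the
    Rayleigh quotient be an eigenvalue. A minimizing sequence of unit vectors converges along [U] to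
    some [y]; the form of [B - lam I] is nonnegative and zero at [y], so [y] lies in its kernel. *)
Lemma min_qform_eigenvalue n (B : 'M[R]_n.+1) : B^T = B -> psd B ->
  exists lam, [/\ 0 <= lam, eigenvalue B lam &
    forall x, lam * nsq x <= qform B x].
Proof.
move=> sB pB; pose S := [set qform B x | x in [set x | nsq x = 1]].
have nsqd s : nsq (delta_mx s 0 : 'cV[R]_n.+1) = 1.
  rewrite /nsq (bigD1 s) //= big1 ?addr0 => [|t ts]; rewrite mxE.
    by rewrite !eqxx expr1n.
  by rewrite (negPf ts) expr0n.
have S0 : S !=set0 by exists (qform B (delta_mx 0 0)); exists (delta_mx 0 0).
have lS : lbound S 0 by move=> _ [x _ <-].
have iS : has_inf S by split=> //; exists 0.
pose lam := inf S.
have lam0 : 0 <= lam by apply: lb_le_inf.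
have hx l : exists x : 'cV[R]_n.+1, nsq x = 1 /\ qform B x < lam + l.+1%:R^-1.
  have e0 : 0 < l.+1%:R^-1 :> R by rewrite invr_gt0 ltr0n.
  by have [_ [x x1 <-] hx] := inf_adherent e0 iS; exists x.
have [x hx'] := choice hx.
have [y xy] : exists y, mcvg U x y.
  apply: (@mcvg_bounded _ _ _ _ _ _ 1); apply: nearW => l s t; rewrite ord1.
  have := nsq_entry_le (x l) s; rewrite (hx' l).1 => h.
  by rewrite -(@ler_pXn2r _ 2) ?nnegrE // expr1n real_normK ?num_real.
have y1 : nsq y = 1.
  apply: (@ultra_cvg_eq _ U _ _ _ _ (cvg_nsq xy)).
  by under eq_cvg do rewrite (hx' _).1; exact: cvg_cst.
have qy : qform B y <= lam.
  have c0 : (fun l : nat => lam + l.+1%:R^-1) @ U --> lam.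
    apply: (cvg_trans _ (_ : (fun l : nat => lam + l.+1%:R^-1) @ \oo --> lam)).
      by move=> A hA; apply: freeU.
    rewrite -[X in _ --> X]addr0; apply: cvgD; first exact: cvg_cst.
    exact: cvg_harmonic.
  have c1 : (fun l => qform B (x l)) @ U --> qform B y.
    by apply: cvg_qform xy; exact: mcvg_cst.
  apply: (ultra_cvg_le (U := U)) c1 c0.
  by apply: nearW => l; apply/ltW; case: (hx' l).
have hlam z : lam * nsq z <= qform B z.
  have [->|z0] := eqVneq z 0; first by rewrite /qform mulmx0 mxE nsqE mulmx0 mxE mulr0.
  have c0 : 0 < nsq z by rewrite lt_neqAle nsq_ge0 eq_sym nsq_eq0 z0.
  pose a := (Num.sqrt (nsq z))^-1.
  have a2 : a ^+ 2 = (nsq z)^-1 by rewrite /a exprVn sqr_sqrtr // ltW.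
  have : lam <= qform B (a *: z).
    apply: ge_inf; first by exists 0.
    by exists (a *: z) => //=; rewrite nsqZ a2 mulVf // gt_eqF.
  by rewrite qformZ a2 mulrC ler_pdivlMr.
exists lam; split=> //.
pose C := B - lam%:M.
have qC z : qform C z = qform B z - lam * nsq z.
  rewrite /qform mulmxBr mulmxBl mxE; congr (_ + _).
  by rewrite mul_mx_scalar -scalemxAl [LHS]mxE [X in - X]mxE nsqE.
have sC : C^T = C by rewrite /C linearB /= sB tr_scalar_mx.
have pC : psd C by move=> z; rewrite qC subr_ge0.
have : C *m y = 0.
  apply: psd_kernel => //; apply/eqP; rewrite eq_le pC andbT qC y1 mulr1 subr_le0 //.
move/eqP; rewrite mulmxBl subr_eq0 mul_scalar_mx => /eqP e.
apply/eigenvalueP; exists y^T.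
  by rewrite -[in LHS]sB -trmx_mul e linearZ.
by rewrite trmx_eq0 -nsq_eq0 y1 oner_eq0.
Qed.

Lemma nsq_sigma_min n (M : 'M[R]_n) (g : R) (x : 'cV[R]_n) : 0 <= g ->
  g <= sigma_min M -> g ^+ 2 * nsq x <= nsq (M *m x).
Proof.
move=> g0; case: n M x => [|n] M x.
  by move=> _; rewrite /nsq !big_ord0 mulr0.
have sB : (M^T *m M)^T = M^T *m M by rewrite trmx_mul trmxK.
have qB z : qform (M^T *m M) z = nsq (M *m z).
  by rewrite nsqE trmx_mul /qform !mulmxA.
have pB : psd (M^T *m M) by move=> z; rewrite qB nsq_ge0.
have [lam [lam0 ev h]] := min_qform_eigenvalue sB pB.
move=> gM; apply: le_trans (_ : lam * nsq x <= _); last by rewrite -qB.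
apply: ler_wpM2r; first exact: nsq_ge0.
have : g <= Num.sqrt lam.
  apply: le_trans gM _; apply: ge_inf; first by exists 0 => s [].
  by split; [exact: sqrtr_ge0|rewrite sqr_sqrtr].
by move=> h2; rewrite -(sqr_sqrtr lam0) ler_pXn2r ?nnegrE ?sqrtr_ge0.
Qed.

End SmallestSingularValue.

(** * Limits of J-Jacobi processes *)

Section BlockOff.
Variables (R : realType) (m n : nat) (blk : 'I_n -> 'I_m).
Implicit Types (A F : 'M[R]_n) (x : 'I_m * 'I_m).

Definition block_off A : R := \sum_s \sum_(t | blk s != blk t) A s t ^+ 2.

Lemma block_off_ge0 A : 0 <= block_off A.
Proof. by do 2! apply: sumr_ge0 => ? _; rewrite sqr_ge0. Qed.

Lemma block_off_blkdiag A : blkdiag blk A -> block_off A = 0.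
Proof.
move=> d; rewrite /block_off big1 // => s _.
by rewrite big1 // => t st; rewrite d ?expr0n.
Qed.

Lemma row_norm_orthogonal (F : 'M[R]_n) (A : 'M[R]_n) s : F^T *m F = 1%:M ->
  \sum_t (A *m F) s t ^+ 2 = \sum_t A s t ^+ 2.
Proof.
move=> oF; have h (B : 'M[R]_n) : \sum_t B s t ^+ 2 = (B *m B^T) s s.
  by rewrite mxE; apply: eq_bigr => t _; rewrite mxE expr2.
by rewrite !h trmx_mul mulmxA -(mulmxA A) (mulmx1C oF) mulmx1.
Qed.

(** Row norms are preserved in each row outside the pair, hence also its part outside its own block
    and its part inside the pair. Only the pivot submatrix loses off-block mass, and it loses all of
    it. *)
Lemma block_off_step x A F A' : F^T *m F = 1%:M -> supported_on (in_pair blk x) F ->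
  A^T = A -> A' = F^T *m A *m F ->
  (forall s t, in_pair blk x s -> in_pair blk x t -> blk s != blk t -> A' s t = 0) ->
  block_off A = block_off A' +
    \sum_(s | in_pair blk x s) \sum_(t | in_pair blk x t && (blk s != blk t)) A s t ^+ 2.
Proof.
move=> oF hF sA eA' z; set P := in_pair blk x.
have sA' : A'^T = A' by rewrite eA' !trmx_mul trmxK sA mulmxA.
have out s t : ~~ P s -> ~~ P t -> A' s t = A s t.
  move=> Ps Pt; rewrite eA' (congr_supported_row _ _ hF Ps).
  by rewrite (mulmx_supported_out _ _ hF Pt).
have row s : ~~ P s -> \sum_t A' s t ^+ 2 = \sum_t A s t ^+ 2.
  move=> Ps; rewrite -(row_norm_orthogonal A _ oF); apply: eq_bigr => t _.
  by rewrite eA' (congr_supported_row _ _ hF Ps).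
have off s : ~~ P s -> \sum_(t | blk s != blk t) A' s t ^+ 2 =
    \sum_(t | blk s != blk t) A s t ^+ 2.
  move=> Ps; have := row s Ps; rewrite (bigID (fun t => blk s != blk t)) /=.
  rewrite [RHS](bigID (fun t => blk s != blk t)) /=.
  suff -> : \sum_(t | ~~ (blk s != blk t)) A' s t ^+ 2 =
      \sum_(t | ~~ (blk s != blk t)) A s t ^+ 2 by move/addIr.
  apply: eq_bigr => t; rewrite negbK => /eqP st; rewrite out //.
  by rewrite /P /in_pair -st.
have mixed s : ~~ P s -> \sum_(t | P t) A' s t ^+ 2 = \sum_(t | P t) A s t ^+ 2.
  move=> Ps; have := row s Ps; rewrite (bigID P) /= [RHS](bigID P) /=.
  suff -> : \sum_(t | ~~ P t) A' s t ^+ 2 = \sum_(t | ~~ P t) A s t ^+ 2.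
    by move/addIr.
  by apply: eq_bigr => t Pt; rewrite out.
have split3 B : B^T = B -> block_off B =
    \sum_(s | ~~ P s) \sum_(t | blk s != blk t) B s t ^+ 2 +
    \sum_(s | ~~ P s) \sum_(t | P t) B s t ^+ 2 +
    \sum_(s | P s) \sum_(t | P t && (blk s != blk t)) B s t ^+ 2.
  move=> sB; rewrite /block_off (bigID P) /= addrC -addrA; congr (_ + _).
  rewrite [X in _ = X + _]exchange_big -big_split /=; apply: eq_bigr => s Ps.
  rewrite (bigID P) /= addrC; congr (_ + _); last by apply: eq_bigl => t; rewrite andbC.
  apply: eq_big => [t|t _]; last by rewrite -[in LHS]sB mxE.
  case Pt: (P t); rewrite ?andbF // andbT; apply: contraFneq Pt => st.
  by rewrite /P /in_pair -st.
rewrite (split3 A) // (split3 A') //.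
rewrite (eq_bigr _ off) (eq_bigr _ mixed); congr (_ + _).
suff -> : \sum_(s | P s) \sum_(t | P t && (blk s != blk t)) A' s t ^+ 2 = 0.
  by rewrite addr0.
rewrite big1 // => s Ps; rewrite big1 // => t /andP[Pt st]; by rewrite z ?expr0n.
Qed.

(** A null vector of the pinched matrix is supported on block [i] and [F] sends it to a vector
    vanishing there, so the bound makes it zero. *)
Lemma pinch_unit_lower_bound i F (g : R) : 0 < g ->
  (forall y : 'cV[R]_n, (forall s, blk s != i -> y s 0 = 0) ->
     g ^+ 2 * nsq y <= \sum_(s | blk s == i) (F *m y) s 0 ^+ 2) ->
  pinch (in_blk blk i) F \in unitmx.
Proof.
move=> g0 h; rewrite unitmxE unitfE -det_tr; apply/det0P => -[v v0 hv].
have {hv} hv : pinch (in_blk blk i) F *m v^T = 0.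
  by apply: trmx_inj; rewrite trmx_mul trmxK hv trmx0.
have y0 s : blk s != i -> v^T s 0 = 0.
  move=> si; move/matrixP/(_ s 0): hv; rewrite mxE (bigD1 s) //= big1 ?addr0.
    by rewrite !mxE /in_blk (negPf si) eqxx mul1r.
  by move=> t ts; rewrite !mxE /in_blk (negPf si) [s == t]eq_sym (negPf ts) mul0r.
have := h _ y0; rewrite big1 => [|s si]; last first.
  move/matrixP/(_ s 0): hv; rewrite [RHS]mxE => hv.
  rewrite -[RHS](expr0n _ 2) -[in RHS]hv; congr (_ ^+ _).
  rewrite !mxE; apply: eq_bigr => t _.
  case ti: (blk t == i); first by rewrite !mxE /in_blk (eqP si) eqxx ti.
  by rewrite y0 ?ti // !mulr0.
rewrite pmulr_rle0 ?exprn_gt0 // => h0.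
have : nsq v^T == 0 by rewrite eq_le h0 nsq_ge0.
by rewrite nsq_eq0 trmx_eq0 (negPf v0).
Qed.

End BlockOff.

(** * The trace drop and the limits of the transformations *)

Section Process.
Variables (R : realType) (U : set_system nat).
Context {ultraU : UltraFilter U}.
Hypothesis freeU : \oo `<=` U.
Variables (m n : nat) (blk : 'I_n -> 'I_m) (sg : pred 'I_n).
Variables (mixed : pred ('I_m * 'I_m)) (gam : 'I_m * 'I_m -> R).
Hypothesis gam_gt0 : forall x, 0 < gam x.
Hypothesis mixedP : forall x, mixed x -> forall s t,
  blk s = x.1 -> blk t = x.2 -> sg s != sg t.

(** The UBCE bound appears as an inequality of quadratic forms on vectors supported on one block, a
    form that passes to entrywise limits directly. *)
Definition jstep (x : 'I_m * 'I_m) (A F A' : 'M[R]_n) :=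
  [/\ supported_on (in_pair blk x) F, J_orthogonal (sgn_mx R sg) F,
    ~~ mixed x -> forall i, (i == x.1) || (i == x.2) -> forall y : 'cV[R]_n,
      (forall s, blk s != i -> y s 0 = 0) ->
      gam x ^+ 2 * nsq y <= \sum_(s | blk s == i) (F *m y) s 0 ^+ 2,
    A' = F^T *m A *m F &
    forall s t, in_pair blk x s -> in_pair blk x t -> s != t -> A' s t = 0].

Variables (pv : nat -> 'I_m * 'I_m) (A F : nat -> 'M[R]_n).
Hypothesis A0_posdef : sym_posdef (A 0%N).
Hypothesis A_step : forall k, jstep (pv k) (A k) (F k) (A k.+1).

Lemma process_posdef k : sym_posdef (A k).
Proof.
elim: k => [|k IH] //; have [_ jF _ -> _] := A_step k.
exact: posdef_congr (J_orthogonal_unit jF) IH.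
Qed.

Lemma process_sym k : (A k)^T = A k.
Proof. by case: (process_posdef k). Qed.

Lemma process_trace_step k : \tr (A k) = \tr (A k.+1) +
  2 * \sum_s A k.+1 s s * \sum_(t | sg t != sg s) F k t s ^+ 2.
Proof.
have [hF jF _ eA z] := A_step k.
(* [K] is the inverse of [F k]. The step is read backwards because it is [A k.+1] that is diagonal
   on the pivot, as the trace formula demands. *)
set J := sgn_mx R sg; pose K := J *m (F k)^T *m J.
have KE s t : K s t = sgn R sg s * F k t s * sgn R sg t.
  by rewrite mulmx_sgnE sgn_mulmxE mxE.
have KF : K *m F k = 1%:M by apply: J_orthogonal_inv.
have FK := mulmx1C KF.
have jK : J_orthogonal J K.
  have jJ : J_orthogonal J J by rewrite /J_orthogonal tr_sgn_mx sgn_mxK mul1mx.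
  by do 2! apply: J_orthogonal_mul => //; exact: J_orthogonal_tr.
have hK : supported_on (in_pair blk (pv k)) K.
  move=> s t hst; rewrite KE hF 1?andbC // eq_sym.
  by case: eqP => [->|_]; rewrite ?mulr0 ?mul0r // mulr1 sgn_sqr.
have eAk : A k = K^T *m A k.+1 *m K.
  have congrM (G H B : 'M[R]_n) :
      (G *m H)^T *m B *m (G *m H) = H^T *m (G^T *m B *m G) *m H.
    by rewrite trmx_mul !mulmxA.
  by have := congrM (F k) K (A k); rewrite FK trmx1 mul1mx mulmx1 -eA.
rewrite [in LHS]eAk (trace_J_congr jK) //; last first.
  move=> s t st; have [hs|hs] := boolP (in_pair blk (pv k) s); last first.
    right; rewrite entry_tr trmx_mul trmxK (mulmx_supported_out _ _ (tr_supported hK)) //.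
    by rewrite hK ?(negPf hs) ?andbF // eq_sym (negPf st).
  have [ht|ht] := boolP (in_pair blk (pv k) t); first by left; apply: z.
  right; rewrite [LHS](_ : _ = (K *m K^T) s t) // (mulmx_supported_out _ _ (tr_supported hK)) //.
  by rewrite hK ?(negPf ht) ?andbF // (negPf st).
congr (_ + _ * _); apply: eq_bigr => s _; congr (_ * _); apply: eq_bigr => t _.
by rewrite KE /sgn; do 2! case: ifP => _; rewrite ?mulN1r ?mulrN1 ?mul1r ?mulr1 ?sqrrN.
Qed.

Definition drop k := \tr (A k) - \tr (A k.+1).

Lemma drop_ge k s t : sg t != sg s -> 2 * (A k.+1 s s * F k t s ^+ 2) <= drop k.
Proof.
move=> ts; rewrite /drop process_trace_step addrAC subrr add0r ler_pM2l ?ltr0n //.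
have h0 u : 0 <= \sum_(t | sg t != sg u) F k t u ^+ 2.
  by apply: sumr_ge0 => v _; rewrite sqr_ge0.
have p0 u : 0 <= A k.+1 u u by apply/ltW/posdef_diag/process_posdef.
rewrite (bigD1 s) //= -[leLHS]addr0; apply: lerD.
  apply: ler_wpM2l => //; rewrite (bigD1 t) //= lerDl.
  by apply: sumr_ge0 => v _; rewrite sqr_ge0.
by apply: sumr_ge0 => u _; rewrite mulr_ge0.
Qed.

Lemma drop_ge0 k : 0 <= drop k.
Proof.
rewrite /drop process_trace_step addrAC subrr add0r mulr_ge0 //.
apply: sumr_ge0 => s _; apply: mulr_ge0; first exact/ltW/posdef_diag/process_posdef.
by apply: sumr_ge0 => v _; rewrite sqr_ge0.
Qed.

Lemma trace_le0 k : \tr (A k) <= \tr (A 0%N).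
Proof. by elim: k => // k; apply: le_trans; rewrite -subr_ge0; exact: drop_ge0. Qed.

Lemma process_entry_bound k s t : `|A k s t| <= \tr (A 0%N).
Proof.
apply: le_trans (trace_le0 k); apply: psd_entry_le_trace (process_sym k) _.
exact/posdef_psd/process_posdef.
Qed.

Lemma drop_cvg0 : drop @ \oo --> (0 : R).
Proof.
have cv : cvgn (fun k => \tr (A k)).
  apply: nonincreasing_is_cvgn.
    by apply/nonincreasing_seqP => k; rewrite -subr_ge0; exact: drop_ge0.
  exists 0 => _ [k _ <-]; apply: sumr_ge0 => s _.
  exact/ltW/posdef_diag/process_posdef.
rewrite -(subrr (limn (fun k => \tr (A k)))); apply: cvgB => //.
have := cv; rewrite -(cvg_shiftS (fun k => \tr (A k))); exact.
Qed.

Lemma process_limit (g : nat -> nat) : exists L, mcvg U (fun l => A (g l)) L.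
Proof.
apply: (@mcvg_bounded _ _ _ _ _ _ (\tr (A 0%N))).
by apply: nearW => l s t; exact: process_entry_bound.
Qed.

Lemma process_det k x : \det (A k - x *: sgn_mx R sg) = \det (A 0%N - x *: sgn_mx R sg).
Proof. by elim: k => [|k <-] //; have [_ jF _ -> _] := A_step k; rewrite det_J_congr. Qed.

Lemma limit_det (g : nat -> nat) L x : mcvg U (fun l => A (g l)) L ->
  \det (L - x *: sgn_mx R sg) = \det (A 0%N - x *: sgn_mx R sg).
Proof.
move=> hL.
have h : (fun l => \det (A (g l) - x *: sgn_mx R sg)) @ U --> \det (L - x *: sgn_mx R sg).
  by apply: cvg_det; apply: mcvg_sub => //; exact: mcvg_cst.
apply: (ultra_cvg_eq (U := U) h).
by under eq_cvg do rewrite process_det; exact: cvg_cst.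
Qed.

(** A limit is a priori only semidefinite; the invariance of [det (A - x J)] at [x = 0] excludes a
    zero determinant. *)
Lemma limit_posdef (g : nat -> nat) L : mcvg U (fun l => A (g l)) L -> sym_posdef L.
Proof.
move=> hL; apply: psd_posdef.
- have hT := mcvg_tr hL; apply: mcvg_eq hL; apply: mcvg_near hT.
  by apply: nearW => l; rewrite process_sym.
- move=> y; have c : (fun l => qform (A (g l)) y) @ U --> qform L y.
    by apply: cvg_qform => //; exact: mcvg_cst.
  have c0 : (fun=> 0 : R) @ U --> (0 : R) by exact: cvg_cst.
  apply: (ultra_cvg_le (U := U)) c0 c.
  by apply: nearW => l; apply/posdef_psd/process_posdef.
- have := limit_det 0 hL; rewrite !scale0r !subr0 => ->; exact: posdef_det.
Qed.


Lemma transformation_cvg0 (f : nat -> nat) s t : (forall l, (l <= f l)%N) ->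
  sg t != sg s -> (fun l => F (f l) t s) @ U --> (0 : R).
Proof.
move=> hf ts; apply: sqr_cvg0.
have [L' hL'] := process_limit (fun l => (f l).+1).
have pL' := limit_posdef hL'.
have a0 : 0 < L' s s := posdef_diag s pL'.
have d0 : (fun l => drop (f l)) @ U --> (0 : R) by apply: cvg_subseq hf drop_cvg0.
(* The half is compensated by the factor 2 in [drop_ge], so the squared entry is at most the drop
   divided by [L' s s]. *)
have near_a : \forall l \near U, L' s s / 2 < A (f l).+1 s s.
  by apply: (cvgr_gt (L' s s)); [exact: hL'|rewrite ltr_pdivrMr // mulr_natr mulr2n ltrDl].
have u0 : (fun l => drop (f l) * (L' s s)^-1) @ U --> (0 : R).
  by rewrite -[X in _ --> X](mul0r (L' s s)^-1); apply: cvgM => //; exact: cvg_cst.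
have z0 : (fun=> 0 : R) @ U --> (0 : R) by exact: cvg_cst.
apply: (squeeze_cvgr _ z0 u0); apply: filterS near_a => l hl.
rewrite sqr_ge0 /= ler_pdivlMr // mulrC; apply: le_trans (drop_ge (f l) ts).
rewrite mulrA; apply: ler_wpM2r; first exact: sqr_ge0.
by move: hl; rewrite ltr_pdivrMr // mulrC => /ltW.
Qed.

(* The limits of the hyperbolic transformations are orthogonal: the trace
   drop kills their off-diagonal blocks. *)
Lemma transformation_limit (f : nat -> nat) : (forall l, (l <= f l)%N) ->
  exists G, [/\ mcvg U (fun l => F (f l)) G, G^T *m G = 1%:M &
    forall s t, sg s != sg t -> G s t = 0].
Proof.
move=> hf.
(* With this threshold the opposite-sign squares of a row sum to at most 1. The squared row norm is
   then at most 3, whence the entry bound 2 below. *)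
have small : \forall l \near U, forall st : 'I_n * 'I_n, sg st.1 != sg st.2 ->
    `|F (f l) st.1 st.2| <= n.+1%:R^-1.
  apply: filter_forall => -[s t] /=; case: (boolP (sg s != sg t)) => st; last exact: nearW.
  have e0 : 0 < n.+1%:R^-1 :> R by rewrite invr_gt0 ltr0n.
  have /cvgr0Pnorm_lt/(_ _ e0) := transformation_cvg0 hf st.
  by apply: filterS => l /ltW hl _.
have [G hG] : exists G, mcvg U (fun l => F (f l)) G.
  apply: (@mcvg_bounded _ _ _ _ _ _ 2); apply: filterS small => l hl s t.
  have [_ jF _ _ _] := A_step (f l).
  have h := J_orthogonal_row s jF.
  have : \sum_(t0 | sg t0 != sg s) F (f l) s t0 ^+ 2 <= 1.
    apply: le_trans (_ : \sum_(t0 : 'I_n) n.+1%:R^-1 <= _); last first.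
      have h1 : n%:R / n.+1%:R <= 1 :> R by rewrite ler_pdivrMr ?ltr0n // mul1r ler_nat leqnSn.
      by rewrite sumr_const card_ord -[_ *+ n]mulr_natl.
    rewrite [leRHS](bigID (fun t0 => sg t0 != sg s)) /= -[leLHS]addr0.
    apply: lerD; last by apply: sumr_ge0 => u _; rewrite invr_ge0.
    apply: ler_sum => u us; have := hl (s, u); rewrite /= eq_sym => /(_ us) hu.
    rewrite -real_normK ?num_real // -[leRHS]mulr1 expr2 ler_pM //.
    by apply: le_trans hu _; rewrite invf_le1 ?ltr0n // ler1n.
  have : F (f l) s t ^+ 2 <= \sum_t F (f l) s t ^+ 2.
    by rewrite (bigD1 t) //= lerDl sumr_ge0 // => u _; rewrite sqr_ge0.
  rewrite h => h1 h2.
  rewrite -(@ler_pXn2r _ 2) ?nnegrE // real_normK ?num_real //.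
  by apply: le_trans h1 _; lra.
have G0 s t : sg s != sg t -> G s t = 0.
  by move=> st; apply: (ultra_cvg_eq (U := U)) (hG s t) (transformation_cvg0 hf st).
exists G; split=> //; apply: (J_orthogonal_orthogonal (sg := sg)) => //.
have h1 : mcvg U (fun l => (F (f l))^T *m sgn_mx R sg *m F (f l)) (G^T *m sgn_mx R sg *m G).
  apply: mcvg_mul => //; apply: mcvg_mul; [exact: mcvg_tr|exact: mcvg_cst].
apply: (mcvg_eq h1); apply: mcvg_near (mcvg_cst U (sgn_mx R sg)).
by apply: nearW => l; have [_ -> _ _ _] := A_step (f l).
Qed.

Lemma process_limit_step (f : nat -> nat) x L L' : (forall l, (l <= f l)%N) ->
  x.1 != x.2 -> (\forall l \near U, pv (f l) = x) ->
  mcvg U (fun l => A (f l)) L -> mcvg U (fun l => A (f l).+1) L' ->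
  exists G, [/\ G^T *m G = 1%:M, supported_on (in_pair blk x) G,
    pinch (in_blk blk x.1) G \in unitmx /\ pinch (in_blk blk x.2) G \in unitmx,
    L' = G^T *m L *m G &
    (forall s t, sg s != sg t -> G s t = 0) /\
    forall s t, in_pair blk x s -> in_pair blk x t -> s != t -> L' s t = 0].
Proof.
move=> hf x12 hx hL hL'; have [G [hG oG G0]] := transformation_limit hf.
have sG : supported_on (in_pair blk x) G.
  move=> s t st; apply: (ultra_cvg_eq (U := U)) (hG s t) _.
  apply: ultra_cvg_near_cst; apply: filterS hx => l xl.
  by have [-> //] := A_step (f l); rewrite xl.
exists G; split=> //.
- have lb i : (i == x.1) || (i == x.2) -> exists2 g, 0 < g & forall y : 'cV[R]_n,
      (forall s, blk s != i -> y s 0 = 0) ->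
      g ^+ 2 * nsq y <= \sum_(s | blk s == i) (G *m y) s 0 ^+ 2.
    move=> ix; case: (boolP (mixed x)) => mx.
      (* For a mixed pair the limit [G] is orthogonal and does not connect the two blocks, so it
         maps vectors supported on block [i] isometrically into block [i]. *)
      exists 1 => // y hy; rewrite expr1n mul1r.
      have -> : nsq y = nsq (G *m y).
        by rewrite !nsqE trmx_mul mulmxA -(mulmxA y^T) oG mulmx1.
      rewrite /nsq (bigID (fun s => blk s == i)) /= -[leRHS]addr0 lerD2l.
      rewrite big1 // => s si; rewrite mxE big1 ?expr0n // => t _.
      case: (eqVneq (blk t) i) => ti; last by rewrite hy ?mulr0.
      suff -> : G s t = 0 by rewrite mul0r.
      case Ps: (in_pair blk x s); last first.
        rewrite sG ?Ps // (_ : s == t = false) //.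
        by apply: contraNF si => /eqP->; rewrite ti.
      apply: G0; case/orP: Ps => /eqP es; case/orP: ix => /eqP ei.
      + by rewrite es ei eqxx in si.
      + by apply: (mixedP mx) es _; rewrite ti.
      + by rewrite eq_sym; apply: (mixedP mx) es; rewrite ti.
      + by rewrite es ei eqxx in si.
    exists (gam x) => // y hy.
    have c : (fun l => \sum_(s | blk s == i) (F (f l) *m y) s 0 ^+ 2) @ U -->
        \sum_(s | blk s == i) (G *m y) s 0 ^+ 2.
      apply: cvg_sum_ord => s _; rewrite expr2.
      have c : (fun l => (F (f l) *m y) s 0) @ U --> (G *m y) s 0.
        by apply: mcvg_mul => //; exact: mcvg_cst.
      by under eq_cvg do rewrite expr2; apply: cvgM.
    have c0 : (fun=> gam x ^+ 2 * nsq y) @ U --> gam x ^+ 2 * nsq y by exact: cvg_cst.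
    apply: (ultra_cvg_le (U := U)) c0 c; apply: filterS hx => l xl.
    by have [_ _ h _ _] := A_step (f l); rewrite xl in h; apply: h.
  have [g1 g10 h1] := lb x.1 (introT orP (or_introl (eqxx _))).
  have [g2 g20 h2] := lb x.2 (introT orP (or_intror (eqxx _))).
  by split; [exact: (pinch_unit_lower_bound g10)|exact: (pinch_unit_lower_bound g20)].
- have h1 : mcvg U (fun l => (F (f l))^T *m A (f l) *m F (f l)) (G^T *m L *m G).
    by apply: mcvg_mul => //; apply: mcvg_mul => //; exact: mcvg_tr.
  apply: (mcvg_eq hL'); apply: mcvg_near h1.
  by apply: nearW => l; have [_ _ _ -> _] := A_step (f l).
- split=> // s t Ps Pt st; apply: (ultra_cvg_eq (U := U)) (hL' s t) _.
  apply: ultra_cvg_near_cst; apply: filterS hx => l xl.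
  by have [_ _ _ _ -> //] := A_step (f l); rewrite xl.
Qed.

End Process.

(** * Convergence of the off-norm *)

Section OffNormLimit.
Variables (R : realType) (U : set_system nat).
Context {ultraU : UltraFilter U}.
Hypothesis freeU : \oo `<=` U.
Variables (m n : nat) (blk : 'I_n -> 'I_m) (sg : pred 'I_n).
Variables (mixed : pred ('I_m * 'I_m)) (gam : 'I_m * 'I_m -> R).
Hypothesis gam_gt0 : forall x, 0 < gam x.
Hypothesis mixedP : forall x, mixed x -> forall s t,
  blk s = x.1 -> blk t = x.2 -> sg s != sg t.
Variables (A F : nat -> 'M[R]_n) (x0 : 'I_m * 'I_m) (O : seq ('I_m * 'I_m)).
Local Notation pv := (fun k => nth x0 O (k %% size O)).
Hypothesis O_neq0 : (0 < size O)%N.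
Hypothesis O_neq : forall x, x \in O -> x.1 != x.2.
Hypothesis A0_posdef : sym_posdef (A 0%N).
Hypothesis A_step : forall k, jstep blk sg mixed gam (pv k) (A k) (F k) (A k.+1).

Lemma repeat_word_iota M :
  repeat_word M O = [seq pv k | k <- iota 0 (M * size O)].
Proof.
rewrite /repeat_word; elim: M => [|M IH] //=.
rewrite IH mulSn iotaD map_cat; congr (_ ++ _).
  rewrite -[LHS](mkseq_nth x0); apply/eq_in_map => k.
  by rewrite mem_iota add0n /= => kO; rewrite modn_small.
rewrite add0n (_ : iota (size O) _ = [seq (size O + i)%N | i <- iota 0 (M * size O)]).
  by rewrite -map_comp; apply: eq_map => k /=; rewrite modnDl.
by rewrite -iotaDl addn0.
Qed.

Lemma pv_neq k : (pv k).1 != (pv k).2.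
Proof. by apply/O_neq/mem_nth; rewrite ltn_mod. Qed.

Lemma cvg_block_off (M : nat -> 'M[R]_n) L : mcvg U M L ->
  (fun l => block_off blk (M l)) @ U --> block_off blk L.
Proof.
move=> hM; apply: cvg_sum_ord => s _; apply: cvg_sum_ord => t _.
by rewrite expr2; under eq_cvg do rewrite expr2; apply: cvgM.
Qed.

Lemma block_off_le (A' : 'M[R]_n) (c : R) : (forall s t, `|A' s t| <= c) ->
  block_off blk A' <= \sum_(s < n) \sum_(t < n) c ^+ 2.
Proof.
move=> h; apply: ler_sum => s _; rewrite [leRHS](bigID (fun t => blk s != blk t)) /=.
rewrite -[leLHS]addr0; apply: lerD; last by apply: sumr_ge0 => t _; rewrite sqr_ge0.
apply: ler_sum => t _; rewrite -real_normK ?num_real // ler_pXn2r ?nnegrE //.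
exact: le_trans (h s t).
Qed.

(* The limit superior [lam] is attained by limit matrices; along the preceding
   steps the off-norm cannot decrease, so all their pivot blocks vanish. *)
Lemma block_off_cvg0 : forcing R O -> (fun k => block_off blk (A k)) @ \oo --> (0 : R).
Proof.
case=> M forced; pose b k := block_off blk (A k).
pose B := \sum_(s < n) \sum_(t < n) \tr (A 0%N) ^+ 2.
have bB k : b k <= B.
  by apply: block_off_le => s t; apply: process_entry_bound A_step _ _ _.
have b0 k : 0 <= b k := block_off_ge0 _ _.
(* The infimum of the eventual upper bounds is the limit superior. *)
pose S := [set z | exists K, forall k, (K <= k)%N -> b k <= z].
have S0 : S !=set0 by exists B; exists 0%N.
have lS : lbound S 0 by move=> z [K hK]; apply: le_trans (hK K (leqnn K)).
have iS : has_inf S by split=> //; exists 0.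
pose lam := inf S.
have above e : 0 < e -> \forall k \near \oo, b k <= lam + e.
  move=> e0; have [z [K hK] hz] := inf_adherent e0 iS.
  by exists K => // k /= /hK h; apply: le_trans h (ltW hz).
have below e : 0 < e -> ~ \forall k \near \oo, b k <= lam - e.
  move=> e0 [K _ hK]; have : lam <= lam - e by apply: ge_inf => //; [exists 0|exists K].
  by rewrite lerBrDr gerDl leNgt e0.
suff lam0 : lam <= 0.
  apply/cvgr0Pnorm_le => e e0; apply: filterS (above e e0) => k hk.
  rewrite ger0_norm ?block_off_ge0 //; apply: (le_trans hk).
  by rewrite gerDr.
(* Room for [M] full sweeps before the sweep that contains [f l]. *)
pose T := size O; pose N := ((M + 1) * T)%N.
have hf l : exists k, (l + N <= k)%N /\ lam - l.+1%:R^-1 < b k.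
  have e0 : 0 < l.+1%:R^-1 :> R by rewrite invr_gt0 ltr0n.
  apply: contrapT => /forallNP h; apply: (below _ e0); exists (l + N)%N => // k /= lk.
  by rewrite leNgt; apply/negP => h'; apply: (h k).
have [f hf'] := choice hf.
(* A time at which a sweep begins, so that the pivot at time [g l + k] does not depend on [l]. *)
pose g l := (f l %/ T * T - M * T)%N.
have gE l : f l = (g l + (M * T + f l %% T))%N.
  have := (hf' l).1; rewrite /N /g => h.
  have e := divn_eq (f l) T; have := ltn_pmod (f l) O_neq0; rewrite -/T => h2.
  have : (M * T <= f l %/ T * T)%N by lia.
  lia.
have gl l : (l <= g l)%N.
  have := (hf' l).1; have := gE l; rewrite /N => h h'.
  have := ltn_pmod (f l) O_neq0; rewrite -/T => h2; lia.
have gT l k : pv (g l + k)%N = pv k.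
  by rewrite /g -mulnBl modnMDl.
(* The position of [f l] within its sweep is constant along [U]; the near-extremal times thus share
   the offset [M * T + r] from [g l]. *)
have [r hr] : exists r : 'I_T, \forall l \near U, (f l %% T)%N = r.
  have [r hr] := ultra_pigeonhole (U := U) (fun l => Ordinal (ltn_pmod (f l) O_neq0)).
  by exists r; apply: filterS hr => l <-.
have hL k : exists L, mcvg U (fun l => A (g l + k)%N) L.
  by apply: process_limit A_step _.
have [L hL'] := choice hL.
have gk k l : (l <= g l + k)%N by apply: leq_trans (gl l) (leq_addr _ _).
have hLS k : mcvg U (fun l => A (g l + k).+1) (L k.+1).
  by move=> s t; have := hL' k.+1 s t; under eq_cvg do rewrite addnS.
have step k : exists G, [/\ G^T *m G = 1%:M, supported_on (in_pair blk (pv k)) G,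
    pinch (in_blk blk (pv k).1) G \in unitmx /\ pinch (in_blk blk (pv k).2) G \in unitmx,
    L k.+1 = G^T *m L k *m G &
    (forall s t, sg s != sg t -> G s t = 0) /\
    forall s t, in_pair blk (pv k) s -> in_pair blk (pv k) t -> s != t ->
      L k.+1 s t = 0].
  apply: (process_limit_step freeU gam_gt0 mixedP A0_posdef A_step (gk k)) => //.
  - exact: pv_neq.
  - by apply: nearW => l; exact: gT.
have symL k : (L k)^T = L k by have [] := limit_posdef A0_posdef A_step (hL' k).
have offS k : block_off blk (L k) = block_off blk (L k.+1) +
    \sum_(s | in_pair blk (pv k) s)
      \sum_(t | in_pair blk (pv k) t && (blk s != blk t)) L k s t ^+ 2.
  have [G [oG sG _ eL [_ z]]] := step k.
  apply: (block_off_step oG sG (symL k) eL) => s t Ps Pt st; apply: z => //.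
  by apply: contraNneq st => ->.
have le_lam k : block_off blk (L k) <= lam.
  apply/ler_addgt0Pr => e e0.
  have c0 : (fun=> lam + e) @ U --> lam + e by exact: cvg_cst.
  apply: (ultra_cvg_le (U := U)) (cvg_block_off (hL' k)) c0.
  have [K _ hK] := above e e0; apply: freeU; exists K => // l /= Kl.
  by apply: hK => /=; apply: leq_trans Kl (gk k l).
have ge_lam : lam <= block_off blk (L (M * T + r)%N).
  have c0 : (fun l : nat => lam - l.+1%:R^-1) @ U --> lam.
    have c : (fun l : nat => lam - l.+1%:R^-1) @ \oo --> lam.
      rewrite -[X in _ --> X]subr0; apply: cvgB; first exact: cvg_cst.
      exact: cvg_harmonic.
    by move=> V /c; exact: freeU.
  apply: (ultra_cvg_le (U := U)) c0 (cvg_block_off (hL' _)).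
  by apply: filterS hr => l <-; rewrite -gE ltW // (hf' l).2.
have geS k d : block_off blk (L (k + d)%N) <= block_off blk (L k).
  elim: d => [|d IH]; first by rewrite addn0.
  apply: le_trans IH; rewrite addnS [leRHS]offS lerDl.
  by do 2! apply: sumr_ge0 => ? _; rewrite sqr_ge0.
(* The off-norm of [L k] is nonincreasing in [k], never above [lam], and at least [lam] at the last
   offset. *)
have eq_lam k : (k <= M * T + r)%N -> block_off blk (L k) = lam.
  move=> hk; apply/eqP; rewrite eq_le le_lam; apply: le_trans ge_lam _.
  by rewrite -(subnKC hk).
have idleL k : (k < M * T)%N -> idle blk (pv k) (L k) (L k.+1).
  move=> hk; have [G [oG sG uG eL [_ z]]] := step k.
  exists G; split=> //; split=> // [s t es et|s t es et]; last first.
    apply: z; rewrite /in_pair ?es ?et ?eqxx ?orbT //.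
    by apply: contraNneq (pv_neq k) => st; rewrite -es -et st.
  (* Nothing is lost in this step, so the pivot mass of [L k], a sum of squares, is zero. *)
  have := offS k; rewrite !eq_lam; [|lia|lia].
  rewrite -[X in X = _]addr0 => /addrI/esym/eqP; rewrite psumr_eq0; last first.
    by move=> u _; apply: sumr_ge0 => v _; rewrite sqr_ge0.
  move=> /allP/(_ s (mem_index_enum _)); rewrite /in_pair es eqxx /=.
  rewrite psumr_eq0; last by move=> v _; rewrite sqr_ge0.
  move=> /allP/(_ t (mem_index_enum _)); rewrite et eqxx orbT (pv_neq k) /=.
  by rewrite sqrf_eq0 => /eqP.
have fl : flow blk (repeat_word M O) (L 0%N) (L (M * T)%N).
  rewrite repeat_word_iota.
  suff h j k : (k + j <= M * T)%N -> flow blk [seq pv k | k <- iota k j] (L k) (L (k + j)%N).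
    by have := h (M * T)%N 0%N (leqnn _).
  elim: j k => [|j IH] k hk /=; first by rewrite addn0.
  exists (L k.+1); first by apply: idleL; lia.
  by rewrite -addSnnS; apply: IH; lia.
have := forced n blk _ _ (symL 0%N) fl => /block_off_blkdiag.
by rewrite eq_lam // => ->.
Qed.

Hypothesis O_cover : forall i : 'I_m, exists2 x, x \in O & (i == x.1) || (i == x.2).

(** A diagonal block becomes diagonal when its index first occurs in a pivot. Later steps either
    leave it alone or diagonalize it again. *)
Lemma process_block_diag k s t : (size O <= k)%N -> blk s = blk t -> s != t -> A k s t = 0.
Proof.
move=> hk st ne.
have keep j : A j s t = 0 -> A j.+1 s t = 0.
  move=> z; have [hF _ _ eA zA] := A_step j.
  case Ps: (in_pair blk (pv j) s).
    by apply: zA => //; rewrite /in_pair -st.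
  have Pt : ~~ in_pair blk (pv j) t by rewrite /in_pair -st -/(in_pair _ _ s) Ps.
  by rewrite eA (congr_supported_row _ _ hF) ?Ps // (mulmx_supported_out _ _ hF Pt).
have [x xO xs] := O_cover (blk s).
have hi : (index x O < size O)%N by rewrite index_mem.
have z : A (index x O).+1 s t = 0.
  have [_ _ _ _ zA] := A_step (index x O); apply: zA => //.
    by rewrite modn_small // nth_index // /in_pair.
  by rewrite modn_small // nth_index // /in_pair -st.
have le : ((index x O).+1 <= k)%N by apply: leq_trans hk.
rewrite -(subnKC le); elim: (k - _)%N => [|d IH]; first by rewrite addn0.
by rewrite addnS keep.
Qed.

Lemma off_norm_cvg0 : forcing R O -> (fun k => off_norm (A k)) @ \oo --> (0 : R).
Proof.
move=> fO; have h := block_off_cvg0 fO.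
apply: sqr_cvg0.
have z0 : (fun=> 0 : R) @ \oo --> (0 : R) by exact: cvg_cst.
apply: (squeeze_cvgr _ z0 h); exists (size O) => // k /= hk.
rewrite sqr_ge0 /= /off_norm sqr_sqrtr; last by do 2! apply: sumr_ge0 => ? _.
apply: ler_sum => s _; rewrite [leLHS]big_mkcond [leRHS]big_mkcond /=.
apply: ler_sum => t _; rewrite real_normK ?num_real //.
case: (eqVneq (blk s) (blk t)) => st /=; last by case: ifP; rewrite ?sqr_ge0.
case: ifP => // lt; rewrite (process_block_diag hk st) ?expr0n //.
by apply: contraTneq lt => ->; rewrite ltnn.
Qed.

End OffNormLimit.

(** * Convergence of the diagonal elements *)

Section FiniteCluster.
Variables (R : realType) (U : set_system nat).
Context {ultraU : UltraFilter U}.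
Hypothesis freeU : \oo `<=` U.

(** Finitely many cluster points alone do not exclude wandering among them; the strict increase of
    [Phi] along every genuine move does. Moves are compared through the vectors [v tau], since
    distinct indices may carry the same vector. *)
Lemma finite_cluster (T : finType) n (v : T -> 'I_n -> R) (Phi : ('I_n -> R) -> R)
    (d : nat -> 'I_n -> R) :
  (forall f, (forall l, (l <= f l)%N) ->
     exists tau, forall s, (fun l => d (f l) s) @ U --> v tau s) ->
  (forall f tau tau', (forall l, (l <= f l)%N) ->
     (forall s, (fun l => d (f l) s) @ U --> v tau s) ->
     (forall s, (fun l => d (f l).+1 s) @ U --> v tau' s) ->
     v tau = v tau' \/ Phi (v tau) < Phi (v tau')) ->
  exists tau, forall s, (fun k => d k s) @ \oo --> v tau s.
Proof.
move=> H1 H2.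
pose dist k tau := \sum_s `|d k s - v tau s|.
have dist_ge k tau s : `|d k s - v tau s| <= dist k tau.
  by rewrite /dist (bigD1 s) //= lerDl sumr_ge0.
have [tau0 _] := H1 id (fun=> leqnn _).
(* The candidate nearest to the vector at time [k]; its distance tends to 0. *)
pose p k := [arg min_(tau < tau0) dist k tau]%O.
have pmin k tau : dist k (p k) <= dist k tau.
  by rewrite /p; case: arg_minP => // i _ h; apply: h.
have close e : 0 < e -> \forall k \near \oo, dist k (p k) < e.
  move=> e0; apply: contrapT => /not_near_subseq[f hf].
  have [tau htau] := H1 f (fun l => (hf l).1).
  have c : (fun l => dist (f l) tau) @ U --> \sum_(s < n) `|v tau s - v tau s|.
    apply: cvg_sum_ord => s _; apply: cvg_norm; apply: cvgB => //; exact: cvg_cst.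
  have [] : exists l, dist (f l) tau < e.
    have h : \forall l \near U, dist (f l) tau < e.
      by apply: (cvgr_lt _ c); rewrite big1 // => s _; rewrite subrr normr0.
    by have [l hl] := filter_ex h; exists l.
  by move=> l hl; apply: (hf l).2; apply: le_lt_trans hl.
have conv f tau : (forall l, (l <= f l)%N) -> (\forall l \near U, v (p (f l)) = v tau) ->
    forall s, (fun l => d (f l) s) @ U --> v tau s.
  move=> hf hp s; apply/cvgrPdistC_lt => e e0.
  have [K _ hK] := close e e0.
  have hK' : \forall l \near U, dist (f l) (p (f l)) < e.
    by apply: freeU; exists K => // l /= Kl; apply: hK => /=; apply: leq_trans (hf l).
  apply: filterS2 hp hK' => l hp hl; apply: le_lt_trans hl.
  by rewrite -hp; exact: dist_ge.
have [K _ hK] : \forall k \near \oo, v (p k) = v (p k.+1) \/ Phi (v (p k)) < Phi (v (p k.+1)).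
  apply: contrapT => /not_near_subseq[f hf].
  have hf1 l : (l <= f l)%N := (hf l).1.
  have hf2 l : (l <= (f l).+1)%N by apply: leqW.
  have [[tau tau'] ht] := ultra_pigeonhole (U := U) (fun l => (p (f l), p (f l).+1)).
  have h := H2 f tau tau' hf1.
  have /h{}h : forall s, (fun l => d (f l) s) @ U --> v tau s.
    by apply: conv => //; apply: filterS ht => l [-> _].
  have /h{}h : forall s, (fun l => d (f l).+1 s) @ U --> v tau' s.
    by apply: (conv (fun l => (f l).+1)) => //; apply: filterS ht => l [_ ->].
  by have [l [e1 e2]] := filter_ex ht; apply: (hf l).2; rewrite e1 e2.
(* Among the candidates visited after [K], one that maximizes [Phi] can never be left. *)
pose Q := [pred tau | `[< exists2 k, (K <= k)%N & p k = tau >]].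
have QK : Q (p K) by apply/asboolP; exists K.
have [tm /asboolP[k0 Kk0 pk0] hmax] :=
  @Order.TotalTheory.arg_maxP _ _ _ (p K) Q (fun tau => Phi (v tau)) QK.
have const k : (k0 <= k)%N -> v (p k) = v tm.
  move=> /subnKC <-; elim: (k - k0)%N => [|j IH]; first by rewrite addn0 pk0.
  have := hK (k0 + j)%N (leq_trans Kk0 (leq_addr _ _)); rewrite IH addnS => -[->//|].
  rewrite ltNge; case/negP; apply: hmax; apply/asboolP; exists (k0 + j).+1 => //.
  by apply: leqW; apply: leq_trans Kk0 (leq_addr _ _).
exists tm => s; apply/cvgrPdistC_lt => e e0.
have h0 : \forall k \near \oo, (k0 <= k)%N by exists k0.
apply: filterS2 h0 (close e e0) => k /const <- hk; apply: le_lt_trans hk; exact: dist_ge.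
Qed.

End FiniteCluster.

(** * Majorization of sorted diagonals *)

Section SortedTransition.
Variables (R : realType) (n : nat).
Implicit Types (d : 'I_n -> R).

(** The sum of all prefix sums: once each of them is known not to decrease, equality of the totals
    forces equality of every one, hence of the vectors. *)
Definition prefix_weight d : R := \sum_(r < n) \sum_(s < n | (s <= r)%N) d s.

Lemma prefix_sums_inj d d' :
  (forall r : 'I_n, \sum_(s < n | (s <= r)%N) d s = \sum_(s < n | (s <= r)%N) d' s) ->
  forall s, d s = d' s.
Proof.
move=> h s; have [k sk] := ubnP (s : nat).
elim: k s sk => // k IH s sk; have := h s.
rewrite (bigD1 s) //= [RHS](bigD1 s) //=.
suff -> : \sum_(i < n | (i <= s)%N && (i != s)) d i =
    \sum_(i < n | (i <= s)%N && (i != s)) d' i by move/addIr.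
apply: eq_bigr => i /andP[le ne]; apply: IH.
by rewrite -ltnS; apply: leq_trans sk; rewrite ltnS ltn_neqAle ne.
Qed.

(* Ky Fan: the prefix sums of a vector sorted on each class dominate those of
   its orthostochastic averages. *)
Lemma sorted_transition (C : eqType) (kap : 'I_n -> C) (G : 'M[R]_n) d d' :
  G^T *m G = 1%:M -> (forall s t, kap s != kap t -> G s t = 0) ->
  (forall s, d s = \sum_t G s t ^+ 2 * d' t) ->
  (forall s t, kap s = kap t -> (s <= t)%N -> d' t <= d' s) ->
  (forall s, d s = d' s) \/ prefix_weight d < prefix_weight d'.
Proof.
move=> oG G0 dE hd'; have oG' := mulmx1C oG.
have row1 s : \sum_t G s t ^+ 2 = 1.
  move/matrixP/(_ s s): oG'; rewrite !mxE eqxx mulr1n => <-.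
  by apply: eq_bigr => t _; rewrite mxE expr2.
have col1 t : \sum_s G s t ^+ 2 = 1.
  move/matrixP/(_ t t): oG; rewrite !mxE eqxx mulr1n => <-.
  by apply: eq_bigr => s _; rewrite mxE expr2.
have le_prefix (r : 'I_n) :
    \sum_(s < n | (s <= r)%N) d s <= \sum_(s < n | (s <= r)%N) d' s.
  pose c t := \sum_(s < n | (s <= r)%N) G s t ^+ 2.
  have c0 t : 0 <= c t by apply: sumr_ge0 => s _; rewrite sqr_ge0.
  have c1 t : c t <= 1.
    rewrite -(col1 t) [leRHS](bigID (fun s : 'I_n => (s <= r)%N)) /= lerDl.
    by apply: sumr_ge0 => s _; rewrite sqr_ge0.
  (* A threshold for each class: as [d'] is nonincreasing there, its value at the last index up to
     [r] separates the two sides. *)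
  have hth z : exists th, forall t, kap t = z ->
      ((t <= r)%N -> th <= d' t) /\ ((r < t)%N -> d' t <= th).
    case: (pickP (fun t : 'I_n => (kap t == z) && (t <= r)%N)) => [t1 ht1|none]; last first.
      (* A class without indices up to [r] only needs an upper bound of its values. *)
      exists (\sum_t `|d' t|) => t kt; split=> [tr|_].
        by have := none t; rewrite kt eqxx tr.
      by apply: le_trans (ler_norm _) _; rewrite (bigD1 t) //= lerDl sumr_ge0.
    have [t0 /andP[/eqP k0 r0] hmax] :=
      @arg_maxnP _ t1 (fun t : 'I_n => (kap t == z) && (t <= r)%N) (fun t => t : nat) ht1.
    exists (d' t0) => t kt; split=> tr.
      by apply: hd'; rewrite ?kt ?k0 //; apply: hmax; rewrite kt eqxx.
    by apply: hd'; rewrite ?kt ?k0 // (leq_trans r0) // ltnW.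
  have th z : {th | forall t, kap t = z ->
      ((t <= r)%N -> th <= d' t) /\ ((r < t)%N -> d' t <= th)} by apply: cid.
  pose theta s := projT1 (th (kap s)).
  have thP (s : 'I_n) : ((s <= r)%N -> theta s <= d' s) /\ ((r < s)%N -> d' s <= theta s).
    by apply: (projT2 (th (kap s))).
  have thk s t : kap s = kap t -> theta s = theta t by rewrite /theta => ->.
  have swap (e : 'I_n -> R) : \sum_(s < n | (s <= r)%N) \sum_t G s t ^+ 2 * e t =
      \sum_t c t * e t.
    by rewrite exchange_big /=; apply: eq_bigr => t _; rewrite mulr_suml.
  have e1 : \sum_(s < n | (s <= r)%N) d s = \sum_t c t * d' t.
    by rewrite -swap; apply: eq_bigr => s _; exact: dE.
  have e2 : \sum_(s < n | (s <= r)%N) theta s = \sum_t c t * theta t.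
    rewrite -swap; apply: eq_bigr => s _; rewrite -[LHS]mul1r -(row1 s) mulr_suml.
    apply: eq_bigr => t _; have [st|st] := eqVneq (kap s) (kap t); first by rewrite (thk s t).
    by rewrite G0 // expr0n !mul0r.
  rewrite e1 -subr_ge0.
  (* [theta] is constant on classes and [G] does not connect classes, so subtracting it leaves the
     difference unchanged; every term becomes a product of two factors of the same sign. *)
  have -> : \sum_(s < n | (s <= r)%N) d' s - \sum_t c t * d' t =
      \sum_(t < n) ((t <= r)%N%:R - c t) * (d' t - theta t).
    transitivity (\sum_(s < n | (s <= r)%N) (d' s - theta s) -
        \sum_t c t * (d' t - theta t)).
      rewrite sumrB e2; under [X in _ = _ - X]eq_bigr do rewrite mulrBr.
      by rewrite sumrB; ring.
    rewrite big_mkcond -sumrB /=; apply: eq_bigr => t _.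
    by case: (t <= r)%N => /=; ring.
  apply: sumr_ge0 => t _; have [h1 h2] := thP t.
  case: leqP => tr; first by rewrite mulr_ge0 // subr_ge0 // h1.
  by rewrite mulr_le0 // ?sub0r ?oppr_le0 ?subr_le0 // h2.
have lePhi : prefix_weight d <= prefix_weight d' by apply: ler_sum.
have [e|ne] := eqVneq (prefix_weight d) (prefix_weight d'); last first.
  by right; rewrite lt_neqAle ne.
left; apply: prefix_sums_inj => r; apply/eqP; rewrite eq_sym -subr_eq0.
have : \sum_(r < n) (\sum_(s < n | (s <= r)%N) d' s - \sum_(s < n | (s <= r)%N) d s) == 0.
  by rewrite sumrB subr_eq0 eq_sym; apply/eqP.
rewrite psumr_eq0; last by move=> i _; rewrite subr_ge0.
by move=> /allP/(_ r (mem_index_enum _)).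
Qed.

End SortedTransition.

(** * Cluster points of the sequence of diagonals *)

Section DiagonalLimit.
Variables (R : realType) (U : set_system nat).
Context {ultraU : UltraFilter U}.
Hypothesis freeU : \oo `<=` U.
Variables (m n : nat) (blk : 'I_n -> 'I_m) (sg : pred 'I_n).
Variables (mixed : pred ('I_m * 'I_m)) (gam : 'I_m * 'I_m -> R).
Hypothesis gam_gt0 : forall x, 0 < gam x.
Hypothesis mixedP : forall x, mixed x -> forall s t,
  blk s = x.1 -> blk t = x.2 -> sg s != sg t.
Variables (pv : nat -> 'I_m * 'I_m) (A F : nat -> 'M[R]_n).
Hypothesis A0_posdef : sym_posdef (A 0%N).
Hypothesis A_step : forall k, jstep blk sg mixed gam (pv k) (A k) (F k) (A k.+1).
Hypothesis pv_neq : forall k, (pv k).1 != (pv k).2.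
Hypothesis offdiag0 : forall s t, s != t -> (fun k => A k s t) @ \oo --> (0 : R).

Lemma limit_offdiag0 (f : nat -> nat) L : (forall l, (l <= f l)%N) ->
  mcvg U (fun l => A (f l)) L -> forall s t, s != t -> L s t = 0.
Proof.
move=> hf hL s t st; apply: (ultra_cvg_eq (U := U)) (hL s t) _.
by apply: (cvg_subseq freeU hf (offdiag0 st)).
Qed.

(* The polynomial [det (A_k - x J)] is invariant, so the diagonals of two
   limits agree up to order and signs. *)
Lemma limit_diag_values (f g : nat -> nat) D L :
  (forall l, (l <= f l)%N) -> (forall l, (l <= g l)%N) ->
  mcvg U (fun l => A (f l)) D -> mcvg U (fun l => A (g l)) L ->
  forall s, exists tb : 'I_n * bool, L s s = (-1) ^+ tb.2 * D tb.1 tb.1.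
Proof.
move=> hf hg hD hL s.
pose x := sgn R sg s * L s s.
have detE (M : 'M[R]_n) : (forall s t, s != t -> M s t = 0) ->
    \det (M - x *: sgn_mx R sg) = \prod_t (M t t - x * sgn R sg t).
  move=> M0; have -> : M - x *: sgn_mx R sg = diag_mx (\row_t (M t t - x * sgn R sg t)).
    apply/matrixP => i j; rewrite !mxE; have [->|ij] := eqVneq i j; first by rewrite !mulr1n.
    by transitivity (0 - x * 0 : R); [rewrite (M0 _ _ ij)|rewrite mulr0 subr0].
  by rewrite det_diag; apply: eq_bigr => t _; rewrite mxE.
have : \prod_t (D t t - x * sgn R sg t) = 0.
  rewrite -detE; last exact: limit_offdiag0 hD.
  rewrite (limit_det A_step x hD) -(limit_det A_step x hL) detE; last exact: limit_offdiag0 hL.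
  by rewrite (bigD1 s) //= /x mulrAC sgn_sqr mul1r subrr mul0r.
move/eqP/prodf_eq0 => [t _]; rewrite subr_eq0 => /eqP e.
have {}e : L s s = sgn R sg s * sgn R sg t * D t t.
  transitivity ((sgn R sg s * sgn R sg s) * (sgn R sg t * sgn R sg t) * L s s).
    by rewrite !sgn_sqr !mul1r.
  by rewrite e /x; ring.
exists (t, sg s != sg t); rewrite e; congr (_ * _); rewrite /sgn.
by do 2! case: ifP => _; rewrite ?mulrNN ?mulr1 ?mul1r //= ?expr0 ?expr1.
Qed.

Lemma process_diag_cvg (Phi : ('I_n -> R) -> R) :
  (forall f x L L', (forall l, (l <= f l)%N) -> (\forall l \near U, pv (f l) = x) ->
     mcvg U (fun l => A (f l)) L -> mcvg U (fun l => A (f l).+1) L' ->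
     (forall s t, s != t -> L s t = 0) -> (forall s t, s != t -> L' s t = 0) ->
     (forall s, L s s = L' s s) \/
     Phi (fun s => L s s) < Phi (fun s => L' s s)) ->
  exists2 D : 'M[R]_n, is_diag_mx D & A @ \oo --> D.
Proof.
move=> trans.
have hid l : (l <= id l)%N by [].
have [D hD] : exists D, mcvg U (fun l => A (id l)) D by apply: process_limit A_step _.
(* Every cluster diagonal consists of signed diagonal entries of one reference limit [D]; the
   choices of index and sign form a finite type. *)
pose v (tau : {ffun 'I_n -> 'I_n * bool}) s := (-1) ^+ (tau s).2 * D (tau s).1 (tau s).1.
have [f hf|f tau tau' hf c c'|tau htau] := @finite_cluster R U _ freeU _ n v Phi
    (fun k s => A k s s).
- have [L hL] : exists L, mcvg U (fun l => A (f l)) L by apply: process_limit A_step _.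
  have [tb htb] := choice (limit_diag_values hid hf hD hL).
  exists [ffun s => tb s] => s; rewrite /v ffunE -htb; exact: hL.
- have hf1 l : (l <= (f l).+1)%N by apply: leqW.
  have [L hL] : exists L, mcvg U (fun l => A (f l)) L by apply: process_limit A_step _.
  have [L' hL'] : exists L, mcvg U (fun l => A (f l).+1) L.
    by apply: (process_limit A0_posdef A_step (fun l => (f l).+1)).
  have [x hx] := ultra_pigeonhole (U := U) (fun l => pv (f l)).
  have eL : v tau = fun s => L s s.
    by apply: funext => s; apply: (ultra_cvg_eq (U := U)) (c s) (hL s s).
  have eL' : v tau' = fun s => L' s s.
    by apply: funext => s; apply: (ultra_cvg_eq (U := U)) (c' s) (hL' s s).
  rewrite eL eL'; case: (trans f x L L' hf hx hL hL'); last by right.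
  + exact: limit_offdiag0 hL.
  + exact: (limit_offdiag0 hf1 hL').
  + by move=> h; left; apply: funext.
- exists (diag_mx (\row_s v tau s)); first exact: diag_mx_is_diag.
  apply: mx_cvg => s t; rewrite !mxE; have [<-|st] := eqVneq s t; last exact: offdiag0.
  by rewrite mulr1n; exact: htau.
Qed.

Definition sorted_process (le : rel R) := forall k s t,
  in_pair blk (pv k) s -> in_pair blk (pv k) t ->
  (mixed (pv k) -> blk s = blk t) -> (s <= t)%N -> le (A k.+1 s s) (A k.+1 t t).

Lemma limit_averages f x L L' : (forall l, (l <= f l)%N) ->
  (\forall l \near U, pv (f l) = x) ->
  mcvg U (fun l => A (f l)) L -> mcvg U (fun l => A (f l).+1) L' ->
  (forall s t, s != t -> L' s t = 0) ->
  exists (G : 'M[R]_n) (kap : 'I_n -> 'I_m + 'I_n),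
  [/\ G^T *m G = 1%:M, forall s t, kap s != kap t -> G s t = 0,
    forall s, L s s = \sum_t G s t ^+ 2 * L' t t &
    forall s t, kap s = kap t -> s = t \/
      [/\ in_pair blk x s, in_pair blk x t & mixed x -> blk s = blk t]].
Proof.
move=> hf hx hL hL' L'0.
have x12 : x.1 != x.2 by have [l <-] := filter_ex hx; exact: pv_neq.
have [G [oG sG _ eL' [G0 _]]] :=
  process_limit_step freeU gam_gt0 mixedP A0_posdef A_step hf x12 hx hL hL'.
have oG' := mulmx1C oG.
(* A class is a single pivot block for a mixed pair, the whole pair otherwise, and a singleton
   outside the pair. These are the index sets along which the kernel sorts and which [G] does not
   connect. *)
exists G, (fun s => if in_pair blk x s then inl (if mixed x then blk s else x.1) else inr s).
split=> // [s t|s|s t].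
- case Ps: (in_pair blk x s); case Pt: (in_pair blk x t); last first.
  + have [->|st _] := eqVneq s t; first by rewrite eqxx.
    by rewrite sG ?Ps // (negPf st).
  + by move=> _; rewrite sG ?Ps //; case: eqP Ps => // ->; rewrite Pt.
  + by move=> _; rewrite sG ?Pt ?andbF //; case: eqP Ps => // ->; rewrite Pt.
  case: ifP => mx; last by rewrite eqxx.
  move=> ne; have {}ne : blk s != blk t by apply: contraNneq ne => ->.
  apply: G0; case/orP: Ps => /eqP es; case/orP: Pt => /eqP et.
  + by rewrite es et eqxx in ne.
  + exact: (mixedP mx).
  + by rewrite eq_sym; exact: (mixedP mx).
  + by rewrite es et eqxx in ne.
- have eL : L = G *m L' *m G^T.
    by rewrite eL' !mulmxA oG' mul1mx -mulmxA oG' mulmx1.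
  rewrite [in LHS]eL mxE; apply: eq_bigr => t _; rewrite mxE (bigD1 t) //= big1 ?addr0.
    by rewrite mxE; ring.
  by move=> i it; rewrite L'0 ?mulr0.
- case Ps: (in_pair blk x s); case Pt: (in_pair blk x t) => // -[e]; last by left.
  by right; split=> // mx; move: e; rewrite mx.
Qed.

Lemma sorted_process_cvg : sorted_process >=%R \/ sorted_process <=%R ->
  exists2 D : 'M[R]_n, is_diag_mx D & A @ \oo --> D.
Proof.
case=> srt.
- apply: (process_diag_cvg (Phi := @prefix_weight R n)) => f x L L' hf hx hL hL' L0 L'0.
  have [G [kap [oG G0 LE hk]]] := limit_averages hf hx hL hL' L'0.
  apply: (sorted_transition oG G0 LE) => s t /hk[->|[Ps Pt st]] le //.
  apply: (ultra_cvg_le (U := U)) (hL' t t) (hL' s s); apply: filterS hx => l xl.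
  by apply: srt => //; rewrite xl.
(* Negating the diagonal turns the nondecreasing order into the nonincreasing one. *)
- apply: (process_diag_cvg (Phi := fun d => prefix_weight (fun s => - d s))).
  move=> f x L L' hf hx hL hL' L0 L'0.
  have [G [kap [oG G0 LE hk]]] := limit_averages hf hx hL hL' L'0.
  have LE' s : - L s s = \sum_t G s t ^+ 2 * - L' t t.
    by rewrite LE -sumrN; apply: eq_bigr => t _; rewrite mulrN.
  have [s t /hk[->|[Ps Pt st]] le //|h|] := sorted_transition oG G0 LE'.
  + rewrite lerN2; apply: (ultra_cvg_le (U := U)) (hL' s s) (hL' t t).
    apply: filterS hx => l xl; by apply: srt => //; rewrite xl.
  + by left=> s; apply: oppr_inj.
  + by right.
Qed.

End DiagonalLimit.

(** * Element-wise kernels *)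

Section PlaneTransformation.
Variables (R : realType) (n : nat).
Implicit Types (X G : 'M[R]_n).

Lemma sum_split2 (a b : 'I_n) (f : 'I_n -> R) : a != b ->
  \sum_s f s = f a + (f b + \sum_(s | (s != a) && (s != b)) f s).
Proof. by move=> ab; rewrite (bigD1 a) //= (bigD1 b) 1?eq_sym. Qed.

Lemma sum_pair (a b : 'I_n) (f : 'I_n -> R) : a != b ->
  \sum_(s | (s == a) || (s == b)) f s = f a + f b.
Proof.
move=> ab; rewrite (bigD1 a) ?eqxx //= (bigD1 b) ?eqxx ?orbT 1?eq_sym //=.
by rewrite big1 ?addr0 // => s /andP[/andP[/orP[/eqP->|/eqP->]]]; rewrite ?eqxx.
Qed.

Variables (a b : 'I_n) (xaa xab xba xbb : R).
Hypothesis ab : a != b.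
Local Notation G := (plane_mx a b xaa xab xba xbb).
Local Notation P := (fun s : 'I_n => (s == a) || (s == b)).

Let ba : b == a = false. Proof. by rewrite eq_sym (negPf ab). Qed.

Let Gaa : G a a = xaa. Proof. by rewrite mxE !eqxx. Qed.
Let Gab : G a b = xab. Proof. by rewrite mxE !eqxx ba. Qed.
Let Gba : G b a = xba. Proof. by rewrite mxE !eqxx ba. Qed.
Let Gbb : G b b = xbb. Proof. by rewrite mxE !eqxx ba. Qed.

Lemma plane_supported : supported_on P G.
Proof.
move=> s t; rewrite negb_and !negb_or mxE => /orP[/andP[/negPf-> /negPf->] //|].
by move=> /andP[/negPf-> /negPf->]; rewrite !andbF.
Qed.

Lemma mulmx_plane_a X s : (X *m G) s a = X s a * xaa + X s b * xba.
Proof. by rewrite (mulmx_supported_in _ _ plane_supported) ?eqxx // sum_pair // Gaa Gba. Qed.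

Lemma mulmx_plane_b X s : (X *m G) s b = X s a * xab + X s b * xbb.
Proof.
by rewrite (mulmx_supported_in _ _ plane_supported) ?eqxx ?orbT // sum_pair // Gab Gbb.
Qed.

Lemma plane_congr X : X^T = X ->
  [/\ (G^T *m X *m G) a a = xaa ^+ 2 * X a a + 2 * xaa * xba * X a b + xba ^+ 2 * X b b,
      (G^T *m X *m G) b b = xab ^+ 2 * X a a + 2 * xab * xbb * X a b + xbb ^+ 2 * X b b,
      (G^T *m X *m G) a b =
        xaa * xab * X a a + (xaa * xbb + xba * xab) * X a b + xba * xbb * X b b &
      forall s t, ~~ P s -> ~~ P t -> (G^T *m X *m G) s t = X s t].
Proof.
move=> sX; have Xba : X b a = X a b by rewrite -[in LHS]sX mxE.
have tr s t : (G^T *m X) s t = (X *m G) t s.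
  by rewrite [LHS]entry_tr trmx_mul trmxK sX.
split.
- by rewrite mulmx_plane_a !tr !mulmx_plane_a Xba; ring.
- by rewrite mulmx_plane_b !tr !mulmx_plane_b Xba; ring.
- by rewrite mulmx_plane_b !tr !mulmx_plane_a Xba; ring.
- move=> s t Ps Pt; rewrite (congr_supported_row _ _ plane_supported Ps).
  by rewrite (mulmx_supported_out _ _ plane_supported Pt).
Qed.

Lemma plane_J_orthogonal (sg : pred 'I_n) (sa := sgn R sg a) (sb := sgn R sg b) :
  sa * xaa ^+ 2 + sb * xba ^+ 2 = sa -> sa * xab ^+ 2 + sb * xbb ^+ 2 = sb ->
  sa * xaa * xab + sb * xba * xbb = 0 -> J_orthogonal (sgn_mx R sg) G.
Proof.
move=> h1 h2 h3; rewrite /J_orthogonal.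
set J := sgn_mx R sg; have sJ : J^T = J := tr_sgn_mx R sg.
have JE s t : J s t = sgn R sg s *+ (s == t) by rewrite !mxE.
have [eaa ebb eab out] := plane_congr sJ.
have sC : (G^T *m J *m G)^T = G^T *m J *m G by rewrite !trmx_mul trmxK sJ mulmxA.
have half s t : ~~ P s -> (G^T *m J *m G) s t = J s t.
  move=> Ps; have [Pt|Pt] := boolP (P t); last exact: out.
  rewrite (congr_supported_row _ _ plane_supported Ps).
  move: Ps; rewrite negb_or => /andP[/negPf sa' /negPf sb'].
  case/orP: Pt => /eqP->; rewrite ?mulmx_plane_a ?mulmx_plane_b !JE sa' sb' /=;
    by rewrite !mulr0n !mul0r addr0.
have Jaa : J a a = sa by rewrite JE eqxx.
have Jbb : J b b = sb by rewrite JE eqxx.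
have Jab : J a b = 0 by rewrite JE (negPf ab).
have Caa : (G^T *m J *m G) a a = J a a.
  by rewrite eaa Jaa Jbb Jab -[RHS]h1; ring.
have Cbb : (G^T *m J *m G) b b = J b b.
  by rewrite ebb Jaa Jbb Jab -[RHS]h2; ring.
have Cab : (G^T *m J *m G) a b = J a b.
  by rewrite eab Jaa Jbb Jab -[RHS]h3; ring.
apply/matrixP => s t; have [Ps|Ps] := boolP (P s); last exact: half.
have [Pt|Pt] := boolP (P t); last first.
  by rewrite -[in LHS]sC -[in RHS]sJ [LHS]mxE [RHS]mxE half.
case/orP: Ps => /eqP->; case/orP: Pt => /eqP-> //.
by rewrite -[in LHS]sC -[in RHS]sJ [LHS]mxE [RHS]mxE Cab.
Qed.

End PlaneTransformation.

(** * Change of the diagonal in one plane transformation *)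

Section ElementwiseStep.
Variables (R : realType).

Lemma sin_le_cos_quarter (phi : R) : - (pi / 4) <= phi <= pi / 4 ->
  0 < cos phi /\ `|sin phi| <= cos phi.
Proof.
have pi0 := pi_gt0 R.
have half : forall x : R, - (pi / 4) <= x <= pi / 4 -> sin x <= cos x.
  move=> x /andP[x1 x2].
  have c4 : 0 < cos (pi / 4) :> R by apply: cos_gt0_pihalf; apply/andP; split; lra.
  have s4 : sin (pi / 4) = cos (pi / 4) :> R.
    have := cosDpihalf (- (pi / 4) : R).
    have -> : - (pi / 4) + pi / 2 = pi / 4 :> R by lra.
    by rewrite sinN opprK => ->.
  have : 0 <= cos (x + pi / 4) by apply: cos_ge0_pihalf; apply/andP; split; lra.
  by rewrite cosD s4 -mulrBl pmulr_lge0 // subr_ge0.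
move=> /andP[p1 p2]; split; first by apply: cos_gt0_pihalf; apply/andP; split; lra.
rewrite ler_norml half ?p1 ?p2 // andbT lerNl -sinN -cosN.
by apply: half; apply/andP; split; lra.
Qed.

(** Annihilation gives [c (x' - x) = s z], so the angle bound, in the form [|s| <= c], limits the
    change of the diagonal by the annihilated entry. Larger angles could exchange the two diagonal
    elements. *)
Lemma rotation_scalars (c s x y z x' y' : R) : 0 < c -> `|s| <= c ->
  c ^+ 2 + s ^+ 2 = 1 ->
  x' = c ^+ 2 * x + 2 * c * s * z + s ^+ 2 * y ->
  y' = (- s) ^+ 2 * x + 2 * - s * c * z + c ^+ 2 * y ->
  c * - s * x + (c * c + s * - s) * z + s * c * y = 0 ->
  [/\ x' + y' = x + y, x ^+ 2 + y ^+ 2 <= x' ^+ 2 + y' ^+ 2,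
      `|x' - x| <= `|z| & `|y' - y| <= `|z|].
Proof.
move=> c0 sc e ex ey ez.
have bound u : c * u = s * z \/ c * u = - (s * z) -> `|u| <= `|z|.
  move=> hu; rewrite -(ler_pM2l c0) -{1}(gtr0_norm c0) -normrM.
  have -> : `|c * u| = `|s| * `|z| by case: hu => ->; rewrite ?normrN normrM.
  exact: ler_wpM2r.
have c2 : c ^+ 2 = 1 - s ^+ 2 by lra.
have hx : c * (x' - x) = s * z.
  have : c * (x' - x) - s * z - s * (c * - s * x + (c * c + s * - s) * z + s * c * y)
     = (c ^+ 2 + s ^+ 2 - 1) * (c * x + s * z) by rewrite ex; ring.
  by rewrite ez e; lra.
have sxy : x' + y' = x + y.
  have : x' + y' = (c ^+ 2 + s ^+ 2) * (x + y) by rewrite ex ey; ring.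
  by rewrite e mul1r.
split=> //.
- have : x' ^+ 2 + y' ^+ 2 + 2 * (c * - s * x + (c * c + s * - s) * z + s * c * y) ^+ 2 =
      (c ^+ 2 + s ^+ 2) ^+ 2 * (x ^+ 2 + y ^+ 2 + 2 * z ^+ 2) by rewrite ex ey; ring.
  rewrite ez e; have := sqr_ge0 z; lra.
- by apply: bound; left.
- apply: bound; right; rewrite -hx; have -> : y' - y = - (x' - x) by lra.
  by rewrite mulrN.
Qed.

(** Both diagonal elements move by the same amount [k <= 0], so the trace drop [d = - 2 k] controls
    their displacement and the loss in their squares. *)
Lemma hyperbolic_scalars (c s x y z x' y' T : R) : 0 < c -> c ^+ 2 - s ^+ 2 = 1 ->
  0 <= x + y -> x + y <= T ->
  x' = c ^+ 2 * x + 2 * c * s * z + s ^+ 2 * y ->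
  y' = s ^+ 2 * x + 2 * s * c * z + c ^+ 2 * y ->
  c * s * x + (c * c + s * s) * z + s * c * y = 0 ->
  let d := (x + y) - (x' + y') in
  [/\ 0 <= d, x ^+ 2 + y ^+ 2 - T * d <= x' ^+ 2 + y' ^+ 2,
      `|x' - x| <= d & `|y' - y| <= d].
Proof.
move=> c0 e xy0 xyT ex ey ez.
pose k := s ^+ 2 * (x + y) + 2 * c * s * z.
have c2 : c ^+ 2 = 1 + s ^+ 2 by lra.
have x'E : x' = x + k by rewrite ex c2 /k; ring.
have y'E : y' = y + k by rewrite ey c2 /k; ring.
have k0 : k <= 0.
  have : (c ^+ 2 + s ^+ 2) * k = - (s ^+ 2 * (x + y)) * (c ^+ 2 - s ^+ 2) +
      2 * c * s * (c * s * x + (c * c + s * s) * z + s * c * y) by rewrite /k; ring.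
  rewrite ez e mulr1 mulr0 addr0 => h.
  have p : 0 < c ^+ 2 + s ^+ 2 by have := sqr_ge0 s; lra.
  by rewrite -(pmulr_rle0 _ p) h oppr_le0 mulr_ge0 ?sqr_ge0.
rewrite /= x'E y'E; have -> : x + y - (x + k + (y + k)) = - (2 * k) by ring.
split; first by lra.
- have : 0 <= (- k) * (T - (x + y)) by rewrite mulr_ge0 ?oppr_ge0 ?subr_ge0.
  have := sqr_ge0 k; nra.
- by rewrite addrAC subrr add0r ler0_norm //; lra.
- by rewrite addrAC subrr add0r ler0_norm //; lra.
Qed.

Variables (n : nat) (sg : pred 'I_n).
Implicit Types (X : 'M[R]_n).

Definition offsum X : R := \sum_s \sum_(t | s != t) `|X s t|.

Lemma entry_le_offsum X a b : a != b -> `|X a b| <= offsum X.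
Proof.
move=> ab; rewrite /offsum (bigD1 a) //= (bigD1 b) //= -addrA lerDl.
by apply: addr_ge0; apply: sumr_ge0 => // i _; apply: sumr_ge0.
Qed.

Lemma offsum_ge0 X : 0 <= offsum X.
Proof. by do 2! apply: sumr_ge0 => ? _. Qed.

(** Rotations and hyperbolic rotations are brought under common bounds in which the possible loss of
    diagonal squares is proportional to the trace drop, so that losses add up over a run. *)
Lemma elementwise_step_facts X X' T : sym_posdef X -> \tr X <= T ->
  elementwise_step sg X X' ->
  exists G, [/\ J_orthogonal (sgn_mx R sg) G, X' = G^T *m X *m G, \tr X' <= \tr X,
    \sum_s X s s ^+ 2 - T * (\tr X - \tr X') <= \sum_s X' s s ^+ 2 &
    forall s, `|X' s s - X s s| <= offsum X + (\tr X - \tr X')].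
Proof.
move=> pX XT [a [b [G [lt_ab hG eX' zX']]]].
have ab : a != b by rewrite -val_eqE /= ltn_eqF.
have sX : X^T = X by case: pX.
have d0 s : 0 < X s s := posdef_diag s pX.
have xyT : X a a + X b b <= T.
  apply: le_trans XT; rewrite /mxtrace (sum_split2 _ ab) lerD2l lerDl.
  by apply: sumr_ge0 => s _; exact: ltW.
have pack : J_orthogonal (sgn_mx R sg) G ->
    (forall s, s != a -> s != b -> X' s s = X s s) ->
    let d := (X a a + X b b) - (X' a a + X' b b) in
    [/\ 0 <= d, X a a ^+ 2 + X b b ^+ 2 - T * d <= X' a a ^+ 2 + X' b b ^+ 2,
      `|X' a a - X a a| <= `|X a b| + d & `|X' b b - X b b| <= `|X a b| + d] ->
    exists G, [/\ J_orthogonal (sgn_mx R sg) G, X' = G^T *m X *m G, \tr X' <= \tr X,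
      \sum_s X s s ^+ 2 - T * (\tr X - \tr X') <= \sum_s X' s s ^+ 2 &
      forall s, `|X' s s - X s s| <= offsum X + (\tr X - \tr X')].
  move=> jG out d [dge sq ha hb].
  have dE : \tr X - \tr X' = d.
    rewrite /mxtrace !(sum_split2 _ ab) /d.
    have -> : \sum_(s | (s != a) && (s != b)) X' s s =
        \sum_(s | (s != a) && (s != b)) X s s.
      by apply: eq_bigr => s /andP[]; exact: out.
    by ring.
  exists G; split=> //.
  - by rewrite -subr_ge0 dE.
  - rewrite dE !(sum_split2 _ ab).
    have -> : \sum_(s | (s != a) && (s != b)) X' s s ^+ 2 =
        \sum_(s | (s != a) && (s != b)) X s s ^+ 2.
      by apply: eq_bigr => s /andP[sa sb]; rewrite out.
    by lra.
  - move=> s; rewrite dE; have ho := entry_le_offsum X ab.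
    have [->|sa] := eqVneq s a; first lra.
    have [->|sb] := eqVneq s b; first lra.
    by rewrite out // subrr normr0 addr_ge0 ?offsum_ge0.
case: ifP hG => sab.
  move=> [phi [p1 p2 eG]].
  have [c0 sc] := sin_le_cos_quarter (introT andP (conj p1 p2)).
  have [eaa ebb eab out] := plane_congr (cos phi) (- sin phi) (sin phi) (cos phi) ab sX.
  rewrite -/(plane_rotation a b phi) -eG -eX' in eaa ebb eab out.
  rewrite zX' in eab.
  have [e1 e2 e3 e4] := rotation_scalars c0 sc (cos2Dsin2 phi) eaa ebb (esym eab).
  apply: pack => /=.
  - rewrite eG; apply: plane_J_orthogonal => //; rewrite /sgn (eqP sab).
    + by rewrite -mulrDr cos2Dsin2 mulr1.
    + by rewrite sqrrN -mulrDr addrC cos2Dsin2 mulr1.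
    + by ring.
  - by move=> s sa sb; rewrite out // negb_or sa.
  - by rewrite e1 subrr mulr0 !addr0 subr0.
move=> [y eG]; set ch := (expR y + expR (- y)) / 2; set sh := (expR y - expR (- y)) / 2.
have E : expR y * expR (- y) = 1 by rewrite expRN divff // expR_eq0.
have ch0 : 0 < ch by rewrite /ch; have := expR_gt0 y; have := expR_gt0 (- y); lra.
have e : ch ^+ 2 - sh ^+ 2 = 1 by rewrite /ch /sh -[RHS]E; field.
have [eaa ebb eab out] := plane_congr ch sh sh ch ab sX.
rewrite -/(hyperbolic_rotation a b y) -eG -eX' in eaa ebb eab out.
rewrite zX' in eab.
have xy0 : 0 <= X a a + X b b by apply: addr_ge0; apply: ltW.
have [e1 e2 e3 e4] := hyperbolic_scalars ch0 e xy0 xyT eaa ebb (esym eab).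
apply: pack => /=.
- rewrite eG; apply: plane_J_orthogonal => //; move: sab; rewrite /sgn;
    by case: (sg a); case: (sg b) => // _; rewrite -/ch -/sh; lra.
- by move=> s sa sb; rewrite out // negb_or sa.
- split=> //; apply: (le_trans (y := X a a + X b b - (X' a a + X' b b))) => //; by rewrite lerDr.
Qed.


Definition elementwise_run (B : 'M[R]_n) (X : nat -> 'M[R]_n) (C : 'M[R]_n) :=
  [/\ sym_posdef B, X 0%N = B, forall q, elementwise_step sg (X q) (X q.+1) &
    X @ \oo --> C].

(** The trace decreases along the run towards that of [C], so the step estimates telescope to bounds
    independent of [q]. *)
Lemma elementwise_run_facts (B : 'M[R]_n) (X : nat -> 'M[R]_n) (C : 'M[R]_n) :
  elementwise_run B X C ->
  [/\ forall q, sym_posdef (X q), forall q, \tr C <= \tr (X q) <= \tr B,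
    forall q, exists2 H, J_orthogonal (sgn_mx R sg) H & X q = H^T *m B *m H,
    forall q, \sum_s B s s ^+ 2 - \tr B * (\tr B - \tr C) <= \sum_s X q s s ^+ 2 &
    forall q s, `|X q.+1 s s - X q s s| <= offsum (X q) + (\tr B - \tr C)].
Proof.
case=> pB X0 hX XC.
have inv q : [/\ sym_posdef (X q), \tr (X q) <= \tr B &
    exists2 H, J_orthogonal (sgn_mx R sg) H & X q = H^T *m B *m H].
  elim: q => [|q [pX tX [H jH eX]]].
    rewrite X0; split=> //; exists 1%:M; last by rewrite trmx1 mul1mx mulmx1.
    by rewrite /J_orthogonal trmx1 mul1mx mulmx1.
  have [G [jG eX' tX' _ _]] := elementwise_step_facts pX tX (hX q).
  split.
  - by rewrite eX'; apply: posdef_congr pX; exact: J_orthogonal_unit jG.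
  - exact: le_trans tX' tX.
  - exists (H *m G); first exact: J_orthogonal_mul.
    by rewrite eX' eX trmx_mul !mulmxA.
have step q := let: And3 pX tX _ := inv q in elementwise_step_facts pX tX (hX q).
have dec q : \tr (X q.+1) <= \tr (X q) by have [G []] := step q.
have trC : (fun q => \tr (X q)) @ \oo --> \tr C.
  rewrite /mxtrace; apply: cvg_big => [|s _]; first by move=> z; exact: add_continuous.
  exact: cvg_mx_entry.
have geC q : \tr C <= \tr (X q).
  have decn j : \tr (X (q + j)%N) <= \tr (X q).
    by elim: j => [|j IH]; rewrite ?addn0 // addnS; apply: le_trans IH.
  have c0 : (fun=> \tr (X q)) @ \oo --> \tr (X q) by exact: cvg_cst.
  apply: (ler_cvg_to trC c0); exists q => // k /= qk.
  by rewrite -(subnKC qk); exact: decn.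
have tX q : \tr (X q) <= \tr B by case: (inv q).
have trB0 : 0 <= \tr B.
  by apply: sumr_ge0 => s _; apply/ltW/posdef_diag.
split=> //.
- by move=> q; case: (inv q).
- by move=> q; rewrite geC tX.
- by move=> q; case: (inv q).
(* The induction needs the drop accumulated up to [q], not the total drop. *)
- move=> q; apply: (le_trans (y := \sum_s B s s ^+ 2 - \tr B * (\tr B - \tr (X q)))).
    by rewrite lerD2l lerN2 ler_wpM2l // lerD2l lerN2.
  elim: q => [|q IH]; first by rewrite X0 subrr mulr0 subr0.
  have [G [_ _ _ h _]] := step q; apply: le_trans h.
  have := IH; rewrite !mulrBr; lra.
- move=> q s; have [G [_ _ _ _ h]] := step q; apply: le_trans (h s) _.
  rewrite lerD2l; have := geC q.+1; have := tX q; lra.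
Qed.

End ElementwiseStep.

(** * Intermediate iterates of the kernel in the limit *)

Section KernelLimit.
Variables (R : realType) (U : set_system nat).
Context {ultraU : UltraFilter U}.
Hypothesis freeU : \oo `<=` U.
Variables (n : nat) (sg : pred 'I_n).
Variables (B C : nat -> 'M[R]_n) (X : nat -> nat -> 'M[R]_n) (D D' : 'M[R]_n).
Hypothesis runX : \forall l \near U, elementwise_run sg (B l) (X l) (C l).
Hypothesis BD : mcvg U B D.
Hypothesis CD : mcvg U C D'.
Hypothesis D_posdef : sym_posdef D.
Hypothesis D_diag : forall s t, s != t -> D s t = 0.
Hypothesis trDD' : \tr D = \tr D'.

Lemma pos_family_lower_bound (I : finType) (x : I -> R) : (forall i, 0 < x i) ->
  exists2 c, 0 < c & forall i, c <= x i.
Proof.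
move=> x0; have y0 : 0 < 1 + \sum_i (x i)^-1.
  apply: ltr_pwDl => //; apply: sumr_ge0 => i _; by rewrite invr_ge0 ltW.
(* The leading 1 covers an empty family. *)
exists (1 + \sum_i (x i)^-1)^-1 => [|i]; first by rewrite invr_gt0.
rewrite -[leRHS]invrK lef_pV2 ?posrE ?invr_gt0 // (bigD1 i) //= addrCA lerDl.
by apply: addr_ge0 => //; apply: sumr_ge0 => j _; rewrite invr_ge0 ltW.
Qed.

Lemma near_qform_lower_bound : exists2 c, 0 < c &
  \forall l \near U, forall y, c * nsq y <= qform (B l) y.
Proof.
have [c c0 hc] := pos_family_lower_bound (fun s => posdef_diag s D_posdef).
(* Entrywise errors below [e] change the form by at most [e * n * nsq y], which is at most half of
   its lower bound [c * nsq y]. *)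
pose e := c / 2 / n.+1%:R.
have e0 : 0 < e by rewrite /e !divr_gt0 ?ltr0n.
have near_e : \forall l \near U, forall st : 'I_n * 'I_n, `|B l st.1 st.2 - D st.1 st.2| < e.
  apply: filter_forall => -[s t]; have /cvgrPdistC_lt   := @BD s t; exact.
exists (c / 2); first by rewrite divr_gt0.
apply: filterS near_e => l hl y.
have qD : c * nsq y <= qform D y.
  rewrite qformE mulr_sumr; apply: ler_sum => s _; rewrite (bigD1 s) //= big1 ?addr0.
    have -> : y s 0 * D s s * y s 0 = D s s * y s 0 ^+ 2 by ring.
    by rewrite ler_wpM2r ?sqr_ge0.
  by move=> t ts; rewrite D_diag 1?eq_sym // mulr0 mul0r.
have diff : `|qform (B l) y - qform D y| <= c / 2 * nsq y.
  rewrite !qformE -sumrB; under eq_bigr do rewrite -sumrB.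
  apply: (le_trans (ler_norm_sum _ _ _)).
  apply: (le_trans (y := \sum_(s < n) \sum_(t < n) e * ((y s 0 ^+ 2 + y t 0 ^+ 2) / 2))).
    apply: ler_sum => s _; apply: (le_trans (ler_norm_sum _ _ _)); apply: ler_sum => t _.
    have -> : y s 0 * B l s t * y t 0 - y s 0 * D s t * y t 0 =
        (B l s t - D s t) * (y s 0 * y t 0) by ring.
    rewrite normrM; apply: ler_pM => //; first exact/ltW/(hl (s, t)).
    rewrite ler_norml; have h1 := sqr_ge0 (y s 0 + y t 0); have h2 := sqr_ge0 (y s 0 - y t 0).
    by apply/andP; split; nra.
  have -> : \sum_(s < n) \sum_(t < n) e * ((y s 0 ^+ 2 + y t 0 ^+ 2) / 2) =
      e * n%:R * nsq y.
    under eq_bigr do rewrite -mulr_sumr -mulr_suml big_split /= sumr_const card_ord.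
    rewrite -mulr_sumr -mulr_suml big_split /= sumr_const card_ord sumrMnl -/(nsq y).
    by rewrite -[nsq y *+ n]mulr_natl; field.
  apply: ler_wpM2r; first exact: nsq_ge0.
  have h1 : n.+1%:R^-1 * n%:R <= 1 :> R by rewrite mulrC ler_pdivrMr ?ltr0n // mul1r ler_nat.
  by rewrite /e -mulrA ler_piMr // divr_ge0 // ltW.
move: diff; rewrite ler_norml => /andP[h _].
have := nsq_ge0 y; lra.
Qed.

(** Whatever iterate is selected in each run, the accumulated transformations converge to some [G]
    with [L = G^T D G]. Equality of traces makes [G] orthogonal, and conservation of the diagonal
    squares then makes [L] diagonal. *)
Lemma iterate_limit (q : nat -> nat) : exists L,
  [/\ mcvg U (fun l => X l (q l)) L, forall s t, s != t -> L s t = 0 &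
    forall s, exists t, L s s = D t t].
Proof.
have near_tr : \forall l \near U, \tr (B l) <= \tr D + 1.
  by apply: (cvgr_le _ (cvg_trace (@BD))); rewrite ltrDl.
have [L hL] : exists L, mcvg U (fun l => X l (q l)) L.
  apply: (@mcvg_bounded _ _ _ _ _ _ (\tr D + 1)); apply: filterS2 runX near_tr => l rl tl s t.
  have [pX /(_ (q l))/andP[_ tX] _ _ _] := elementwise_run_facts rl.
  apply: le_trans (le_trans tX tl); have [sX _] := pX (q l).
  exact: psd_entry_le_trace (posdef_psd (pX _)).
have hH l : exists H, elementwise_run sg (B l) (X l) (C l) ->
    J_orthogonal (sgn_mx R sg) H /\ X l (q l) = H^T *m B l *m H.
  have [rl|nrl] := pselect (elementwise_run sg (B l) (X l) (C l)); last by exists 0.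
  have [_ _ /(_ (q l))[H jH eX] _ _] := elementwise_run_facts rl; by exists H.
have [H hH'] := choice hH.
have [c c0 hc] := near_qform_lower_bound.
have [G hG] : exists G, mcvg U H G.
  (* A column of [H l] has form value equal to a diagonal entry of the iterate, hence at most
     [\tr D + 1], and this bounds its norm. *)
  pose T := (\tr D + 1) / c.
  apply: (@mcvg_bounded _ _ _ _ _ _ (T + 1)).
  apply: filterS3 runX near_tr hc => l rl tl cl s t.
  have [_ /(_ (q l))/andP[_ tX] _ _ _] := elementwise_run_facts rl.
  have [jH eX] := hH' l rl.
  have colE u : X l (q l) u u = qform (B l) (col u (H l)).
    by rewrite eX -qform_delta qform_congr -colE.
  have hu : c * nsq (col t (H l)) <= \tr D + 1.
    apply: le_trans (cl _) _; rewrite -colE //.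
    apply: le_trans (le_trans tX tl); apply: psd_diag_le_trace; apply: posdef_psd.
    by have [pX _ _ _ _] := elementwise_run_facts rl.
  have h2 : H l s t ^+ 2 <= T.
    have := nsq_entry_le (col t (H l)) s; rewrite mxE => h; apply: le_trans h _.
    by rewrite /T ler_pdivlMr // mulrC.
  have T0 : 0 <= T by apply: le_trans h2; exact: sqr_ge0.
  rewrite -(@ler_pXn2r _ 2) ?nnegrE ?addr_ge0 // real_normK ?num_real //.
  apply: le_trans h2 _; nra.
have jG : J_orthogonal (sgn_mx R sg) G.
  have h1 : mcvg U (fun l => (H l)^T *m sgn_mx R sg *m H l) (G^T *m sgn_mx R sg *m G).
    apply: mcvg_mul => //; apply: mcvg_mul; [exact: mcvg_tr|exact: mcvg_cst].
  apply: (mcvg_eq h1); apply: mcvg_near (mcvg_cst U (sgn_mx R sg)).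
  by apply: filterS runX => l rl; have [-> _] := hH' l rl.
have eL : L = G^T *m D *m G.
  have h1 : mcvg U (fun l => (H l)^T *m B l *m H l) (G^T *m D *m G).
    by apply: mcvg_mul => //; apply: mcvg_mul => //; exact: mcvg_tr.
  apply: (mcvg_eq hL); apply: mcvg_near h1.
  by apply: filterS runX => l rl; have [_ ->] := hH' l rl.
have trL : \tr L = \tr D.
  apply/eqP; rewrite eq_le; apply/andP; split.
    apply: (ultra_cvg_le (U := U)) (cvg_trace hL) (cvg_trace (@BD)).
    by apply: filterS runX => l /elementwise_run_facts[_ /(_ (q l))/andP[]].
  rewrite trDD'; apply: (ultra_cvg_le (U := U)) (cvg_trace (@CD)) (cvg_trace hL).
  by apply: filterS runX => l /elementwise_run_facts[_ /(_ (q l))/andP[]].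
(* Equal traces annihilate the excess in the trace formula, whose weights are the positive diagonal
   entries of [D]. *)
have G0 s t : sg s != sg t -> G s t = 0.
  move=> st; have := trL; rewrite eL (trace_J_congr jG); last by move=> ? ? ?; left; exact: D_diag.
  rewrite -[RHS]addr0 => /addrI/eqP; rewrite mulf_eq0 pnatr_eq0 /=.
  have pos u : 0 <= \sum_(v | sg v != sg u) G u v ^+ 2.
    by apply: sumr_ge0 => v _; rewrite sqr_ge0.
  rewrite psumr_eq0; last by move=> u _; apply: mulr_ge0 => //; apply/ltW/posdef_diag.
  move=> /allP/(_ s (mem_index_enum _)); rewrite /= mulf_eq0 gt_eqF ?posdef_diag //=.
  rewrite psumr_eq0; last by move=> v _; rewrite sqr_ge0.
  move=> /allP/(_ t (mem_index_enum _)); rewrite eq_sym st /= sqrf_eq0 => /eqP //.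
have oG : G^T *m G = 1%:M := J_orthogonal_orthogonal jG G0.
have oG' := mulmx1C oG.
have frob : \sum_s \sum_t L s t ^+ 2 = \sum_s D s s ^+ 2.
  have -> : \sum_s D s s ^+ 2 = \sum_s \sum_t D s t ^+ 2.
    apply: eq_bigr => s _; rewrite [RHS](bigD1 s) //= big1 ?addr0 // => t ts.
    by rewrite D_diag 1?eq_sym // expr0n.
  rewrite -!tr_gram eL !trmx_mul trmxK.
  have -> : G^T *m (D^T *m G) *m (G^T *m D *m G) = G^T *m (D^T *m D *m G).
    by rewrite -!mulmxA [G *m (G^T *m _)]mulmxA oG' mul1mx.
  by rewrite mxtrace_mulC -[D^T *m D *m G *m G^T]mulmxA oG' mulmx1.
(* The diagonal squares lose at most [\tr (B l)] times the trace drop, which tends to 0. As the sum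
   of all squares is preserved, nothing remains off the diagonal of [L]. *)
have dsq : \sum_s D s s ^+ 2 <= \sum_s L s s ^+ 2.
  have sqc (M : nat -> 'M[R]_n) K : mcvg U M K ->
      (fun l => \sum_s M l s s ^+ 2) @ U --> \sum_s K s s ^+ 2.
    move=> hM; apply: cvg_sum_ord => s _; rewrite expr2.
    by under eq_cvg do rewrite expr2; apply: cvgM.
  have c1 : (fun l => \sum_s B l s s ^+ 2 - \tr (B l) * (\tr (B l) - \tr (C l))) @ U -->
      \sum_s D s s ^+ 2 - \tr D * (\tr D - \tr D').
    apply: cvgB; first exact: sqc.
    by apply: cvgM; [|apply: cvgB]; exact: cvg_trace.
  rewrite trDD' subrr mulr0 subr0 in c1.
  apply: (ultra_cvg_le (U := U)) c1 (sqc _ _ hL).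
  by apply: filterS runX => l /elementwise_run_facts[_ _ _ h _].
have L0 s t : s != t -> L s t = 0.
  move=> st; have : \sum_s \sum_(t | t != s) L s t ^+ 2 <= 0.
    rewrite -(lerD2l (\sum_s L s s ^+ 2)) addr0 -big_split /=.
    apply: le_trans dsq; rewrite -frob; apply: ler_sum => u _.
    by rewrite [leRHS](bigD1 u).
  have pos u : 0 <= \sum_(v | v != u) L u v ^+ 2 by apply: sumr_ge0 => v _; rewrite sqr_ge0.
  move=> h; have : \sum_s \sum_(t | t != s) L s t ^+ 2 == 0.
    by rewrite eq_le h sumr_ge0.
  rewrite psumr_eq0 // => /allP/(_ s (mem_index_enum _)) /=.
  rewrite psumr_eq0; last by move=> v _; rewrite sqr_ge0.
  move=> /allP/(_ t (mem_index_enum _)); rewrite eq_sym st /= sqrf_eq0 => /eqP //.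
exists L; split=> // s.
have [t Gts] : exists t, G t s != 0.
  apply: contrapT => /forallNP h; have := congr1 (fun M : 'M[R]_n => M s s) oG.
  rewrite mxE big1 => [|t _]; last by have /negP/negPn/eqP-> := h t; rewrite mulr0.
  by rewrite mxE eqxx => /eqP; rewrite eq_sym oner_eq0.
(* Both [L] and [D] are diagonal, so a nonzero entry of [G] identifies the two diagonal values. *)
exists t; have : (G *m L) t s = (D *m G) t s by rewrite eL !mulmxA oG' mul1mx.
rewrite !mxE (bigD1 s) //= big1 ?addr0; last by move=> u us; rewrite L0 ?mulr0.
rewrite (bigD1 t) //= big1 ?addr0; last by move=> u ut; rewrite D_diag 1?eq_sym // mul0r.
by rewrite mulrC; apply: mulIf.
Qed.

(* If the kernel moved the diagonal, some iterate would jump over the gap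
   around D while the off-diagonal entries and the trace drop tend to 0. *)
Lemma kernel_limit s : D s s = D' s s.
Proof.
apply/eqP/negPn/negP => ne.
(* A lower bound for the distance from [D s s] to the different values on the diagonal of [D]; the
   value 1 is a dummy for equal ones. *)
have [mu mu0 hmu] : exists2 mu, 0 < mu &
    forall t, mu <= (if D t t == D s s then 1 else `|D t t - D s s|).
  apply: pos_family_lower_bound => t; case: eqVneq => // h.
  by rewrite normr_gt0 subr_eq0.
pose e := `|D' s s - D s s|; have e0 : 0 < e by rewrite normr_gt0 subr_eq0 eq_sym.
pose rho := Num.min mu e / 2.
have rho0 : 0 < rho by rewrite divr_gt0 // lt_min mu0 e0.
have rmu : rho < mu.
  have : Num.min mu e <= mu by rewrite ge_min lexx.
  by rewrite /rho; lra.
have re : rho < e.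
  have : Num.min mu e <= e by rewrite ge_min lexx orbT.
  by rewrite /rho; lra.
(* An exit from the [rho]-neighbourhood of [D s s]; the run must make one, since it starts inside
   and its limit lies outside. *)
pose good l q := `|X l q s s - D s s| < rho /\ rho <= `|X l q.+1 s s - D s s|.
have nearB : \forall l \near U, `|B l s s - D s s| < rho.
  by have /cvgrPdistC_lt := @BD s s; apply.
have nearC : \forall l \near U, rho < `|C l s s - D s s|.
  have c : (fun l => `|C l s s - D s s|) @ U --> e.
    by apply: cvg_norm; apply: cvgB => //; exact: cvg_cst.
  exact: (cvgr_gt _ c).
have near_good : \forall l \near U, exists q, good l q.
  apply: filterS3 runX nearB nearC => l [_ X0 _ XC] hB hC.
  have c : (fun q => `|X l q s s - D s s|) @ \oo --> `|C l s s - D s s|.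
    by apply: cvg_norm; apply: cvgB; [exact: cvg_mx_entry|exact: cvg_cst].
  have [K _ hK] : \forall q \near \oo, rho < `|X l q s s - D s s| by exact: (cvgr_gt _ c).
  have ex : exists q, rho <= `|X l q s s - D s s| by exists K; apply/ltW/hK => /=.
  case: (ex_minnP ex) => -[|q] hq hmin; first by move: hq; rewrite X0 leNgt hB.
  exists q; split=> //; rewrite ltNge; apply/negP => /hmin; by rewrite ltnn.
have hq l : exists q, (exists q, good l q) -> good l q.
  by have [[q hq]|nq] := pselect (exists q, good l q); [exists q|exists 0%N].
have [q hq'] := choice hq.
have [L [hL L0 LD]] := iterate_limit q.
have [L' [hL' L'0 L'D]] := iterate_limit (fun l => (q l).+1).
have distc (M : nat -> 'M[R]_n) K : mcvg U M K ->
    (fun l => `|M l s s - D s s|) @ U --> `|K s s - D s s|.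
  by move=> hM; apply: cvg_norm; apply: cvgB => //; exact: cvg_cst.
have crho : (fun=> rho) @ U --> rho by exact: cvg_cst.
(* [L s s] is one of the diagonal values of [D] and lies within [rho < mu] of [D s s]. *)
have Ls : L s s = D s s.
  have h : `|L s s - D s s| <= rho.
    apply: (ultra_cvg_le (U := U)) (distc _ _ hL) crho.
    by apply: filterS near_good => l /hq'[/ltW].
  have [t et] := LD s; rewrite et in h *; apply/eqP; apply: contraTT h => net.
  by rewrite -ltNge; apply: (lt_le_trans rmu); have := hmu t; rewrite (negPf net).
have L's : rho <= `|L' s s - D s s|.
  apply: (ultra_cvg_le (U := U)) crho (distc _ _ hL').
  by apply: filterS near_good => l /hq'[].
suff e1 : L' s s = L s s by move: L's; rewrite e1 Ls subrr normr0 leNgt rho0.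
have c1 : (fun l => `|X l (q l).+1 s s - X l (q l) s s|) @ U --> `|L' s s - L s s|.
  by apply: cvg_norm; apply: cvgB.
have c2 : (fun l => offsum (X l (q l)) + (\tr (B l) - \tr (C l))) @ U --> (0 : R).
  rewrite -[X in _ --> X](addr0 0); apply: cvgD; last first.
    rewrite -(subrr (\tr D)) {2}trDD'; apply: cvgB; exact: cvg_trace.
  have -> : 0 = \sum_s \sum_(t | s != t) `|L s t|.
    by rewrite big1 // => u _; rewrite big1 // => v uv; rewrite L0 ?normr0.
  by apply: cvg_sum_ord => u _; apply: cvg_sum_ord => v _; exact: cvg_norm.
have : `|L' s s - L s s| <= 0.
  apply: (ultra_cvg_le (U := U)) c1 c2.
  by apply: filterS runX => l /elementwise_run_facts[_ _ _ _ h].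
by rewrite normr_le0 subr_eq0 => /eqP.
Qed.

End KernelLimit.

(** * Pivot submatrices *)

Lemma sum_single (V : nmodType) (I : finType) (k : I) (f : I -> V) :
  (forall l, l != k -> f l = 0) -> \sum_l f l = f k.
Proof. by move=> h; rewrite (bigD1 k) //= big1 ?addr0. Qed.

Section BlockIndex.
Variables (m : nat) (p : 'I_m -> nat).
Local Notation N := (\sum_r p r)%N.
Local Notation blk := (tagnat.sig1 : 'I_N -> 'I_m).

Lemma sum_block (V : nmodType) (i : 'I_m) (f : 'I_N -> V) :
  \sum_(s | blk s == i) f s = \sum_a f (tagnat.Rank i a).
Proof.
rewrite big_mkcond (reindex _ tagnat.rank_bij_on) /=.
transitivity (\sum_r \sum_(a < p r) if r == i then f (tagnat.Rank r a) else 0).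
  rewrite sig_big_dep /=; apply: eq_big => [[r a]|[r a] _] //=.
  by rewrite -[tagnat.rank _]/(tagnat.Rank r a) tagnat.Rank1K.
rewrite (bigD1 i) //= [X in _ + X]big1 ?addr0 => [|r /negPf ri].
  by apply: eq_bigr => a _; rewrite eqxx.
by rewrite big1 // => a _; rewrite ri.
Qed.

Lemma Rank_of_block (i : 'I_m) (s : 'I_N) : blk s = i -> exists a, s = tagnat.Rank i a.
Proof. by move=> <-; exists (tagnat.sig2 s); rewrite tagnat.sig2K. Qed.

Lemma block_mono (s t : 'I_N) : (s <= t)%N -> (blk s <= blk t)%N.
Proof. by move=> st; have := @tagnat.le_sig1 _ _ s t st. Qed.

Variables (i j : 'I_m).

Definition pivot_index (a : 'I_(p i + p j)) : 'I_N :=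
  match fintype.split a with
  | inl u => tagnat.Rank i u
  | inr v => tagnat.Rank j v
  end.

Lemma pivot_index_l u : pivot_index (lshift _ u) = tagnat.Rank i u.
Proof.
by rewrite /pivot_index; have := unsplitK (inl u : 'I_(p i) + 'I_(p j)) => /= ->.
Qed.

Lemma pivot_index_r v : pivot_index (rshift _ v) = tagnat.Rank j v.
Proof.
by rewrite /pivot_index; have := unsplitK (inr v : 'I_(p i) + 'I_(p j)) => /= ->.
Qed.

Lemma pivot_submxE (T : Type) (A : 'M[T]_N) a b :
  pivot_submx i j A a b = A (pivot_index a) (pivot_index b).
Proof.
rewrite /pivot_submx /pivot_index !mxE; case: (fintype.split a) => u; rewrite !mxE;
  by case: (fintype.split b) => v; rewrite !mxE.
Qed.

Lemma in_pair_pivot_index s : in_pair blk (i, j) s -> exists a, s = pivot_index a.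
Proof.
case/orP => /eqP /Rank_of_block[a ->].
  by exists (lshift _ a); rewrite pivot_index_l.
by exists (rshift _ a); rewrite pivot_index_r.
Qed.

Hypothesis ij : (i < j)%N.

Lemma pivot_index_lt (a b : 'I_(p i + p j)) : (a < b)%N -> (pivot_index a < pivot_index b)%N.
Proof.
rewrite -(splitK a) -(splitK b).
case: (fintype.split a) => u; case: (fintype.split b) => v /=;
  rewrite ?pivot_index_l ?pivot_index_r => h.
- by have := @tagnat.lt_Rank m p i u v; rewrite !ltEord => ->.
- rewrite ltnNge; apply/negP => /block_mono; rewrite !tagnat.Rank1K.
  by rewrite leqNgt ij.
- by have := ltn_ord v; lia.
- have := @tagnat.lt_Rank m p j u v; rewrite !ltEord => ->; lia.
Qed.

Lemma pivot_index_inj : injective pivot_index.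
Proof.
move=> a b e; apply: val_inj; case: (ltngtP a b) => // /pivot_index_lt;
  by rewrite e ltnn.
Qed.

Lemma pivot_index_le (a b : 'I_(p i + p j)) : (pivot_index a <= pivot_index b)%N -> (a <= b)%N.
Proof. by apply: contraTT; rewrite -!ltnNge; exact: pivot_index_lt. Qed.

Lemma sum_pivot_index (V : nmodType) (f : 'I_N -> V) :
  \sum_a f (pivot_index a) = \sum_(s | in_pair blk (i, j) s) f s.
Proof.
rewrite big_split_ord /=; under eq_bigr do rewrite pivot_index_l.
under [X in _ + X]eq_bigr do rewrite pivot_index_r.
rewrite -!sum_block [RHS](bigID (fun s => blk s == i)) /=; congr (_ + _).
  by apply: eq_bigl => s; rewrite /in_pair /=; case: eqP; rewrite ?orbT ?andbF.
apply: eq_bigl => s; rewrite /in_pair /=; case: (eqVneq (blk s) i) => [->|] /=.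
  by apply/negbTE; rewrite -val_eqE /= ltn_eqF.
by rewrite andbT.
Qed.

Lemma pivot_submx_posdef (R : realType) (A : 'M[R]_N) :
  sym_posdef A -> sym_posdef (pivot_submx i j A).
Proof.
case=> sA pA; split.
  by apply/matrixP => a b; rewrite mxE !pivot_submxE -[in LHS]sA mxE.
(* The columns are the unit vectors of the pivot coordinates, so the form of the pivot submatrix is
   that of [A] on vectors extended by zero. *)
pose E : 'M[R]_(N, p i + p j) := \matrix_(s, a) (s == pivot_index a)%:R.
have eP : pivot_submx i j A = E^T *m A *m E.
  apply/matrixP => a b; rewrite pivot_submxE.
  rewrite mxE (sum_single (k := pivot_index b)); last first.
    by move=> s /negPf h; rewrite [E _ _]mxE h mulr0.
  rewrite !mxE eqxx mulr1 (sum_single (k := pivot_index a)).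
    by rewrite !mxE eqxx mul1r.
  by move=> s /negPf h; rewrite !mxE h mul0r.
move=> y y0; rewrite eP.
have -> : (y^T *m (E^T *m A *m E) *m y) 0 0 = ((E *m y)^T *m A *m (E *m y)) 0 0.
  by rewrite trmx_mul !mulmxA.
apply: pA; apply: contraNneq y0 => Ey; apply/eqP/colP => a.
move/matrixP/(_ (pivot_index a) 0): Ey; rewrite !mxE (sum_single (k := a)).
  by rewrite mxE eqxx mul1r.
move=> b ba; rewrite mxE (_ : _ == _ = false) ?mul0r //.
by apply: contraNF ba => /eqP/pivot_index_inj->.
Qed.

Lemma pivot_submx_diag (R : realType) (A : 'M[R]_N) s t : is_diag_mx (pivot_submx i j A) ->
  in_pair blk (i, j) s -> in_pair blk (i, j) t -> s != t -> A s t = 0.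
Proof.
move=> /is_diag_mxP h /in_pair_pivot_index[a ->] /in_pair_pivot_index[b ->] ab.
rewrite -pivot_submxE; apply: h; apply: contraNneq ab => e.
by rewrite (val_inj e).
Qed.

Lemma block_elementary_supported (R : realType) (Fh : 'M[R]_(p i + p j)) :
  supported_on (in_pair blk (i, j)) (block_elementary Fh).
Proof.
move=> s t; rewrite /in_pair /= => h; rewrite /block_elementary mxE.
do 4! (case: ifP => [/andP[es et]|_]; first by rewrite es et ?orbT in h).
by rewrite mxE !tagnat.sig2K mxE.
Qed.

Lemma block_elementary_ii (R : realType) (Fh : 'M[R]_(p i + p j)) :
  submxblock (block_elementary Fh) i i = ulsubmx Fh.
Proof. by rewrite mxblockK eqxx /= conform_mx_id. Qed.

Lemma block_elementary_jj (R : realType) (Fh : 'M[R]_(p i + p j)) :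
  submxblock (block_elementary Fh) j j = drsubmx Fh.
Proof.
have ji : j == i = false by apply/negbTE; rewrite -val_eqE /= gtn_eqF.
by rewrite mxblockK ji eqxx /= conform_mx_id.
Qed.

End BlockIndex.

Lemma block_lower_bound (R : realType) (m : nat) (p : 'I_m -> nat) (i : 'I_m)
    (F : 'M[R]_(\sum_r p r)) (g : R) : 0 <= g -> g <= sigma_min (submxblock F i i) ->
  forall y : 'cV[R]_(\sum_r p r), (forall s, tagnat.sig1 s != i -> y s 0 = 0) ->
  g ^+ 2 * nsq y <= \sum_(s | tagnat.sig1 s == i) (F *m y) s 0 ^+ 2.
Proof.
move=> g0 hg y hy; have [U [ultraU freeU]] := free_ultrafilter.
pose u : 'cV[R]_(p i) := \col_a y (tagnat.Rank i a) 0.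
have h := nsq_sigma_min freeU u g0 hg.
have e1 : nsq y = nsq u.
  rewrite /nsq (bigID (fun s => tagnat.sig1 s == i)) /= [X in _ + X]big1 ?addr0.
    by rewrite sum_block; apply: eq_bigr => a _; rewrite mxE.
  by move=> s /hy ->; rewrite expr0n.
rewrite e1; apply: le_trans (h ultraU) _; rewrite sum_block /nsq; apply: ler_sum => a _.
rewrite le_eqVlt; apply/orP; left; apply/eqP; congr (_ ^+ 2); rewrite !mxE.
rewrite [RHS](bigID (fun s => tagnat.sig1 s == i)) /= [X in _ + X]big1 ?addr0.
  by rewrite sum_block; apply: eq_bigr => b _; rewrite !mxE.
by move=> s /hy ->; rewrite mulr0.
Qed.

Section PartSigns.
Variables (m : nat) (p : 'I_m -> nat) (nu : nat).
Hypothesis p_gt0 : forall i, (0 < p i)%N.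
Hypothesis p_refines : refines p nu.

(** Because the partition refines [(nu, n - nu)], no block straddles [nu], and the sign of an index
    is determined by its block. *)
Lemma in_first_partE (s : 'I_(\sum_r p r)) :
  (s < nu)%N = in_first_part p nu (tagnat.sig1 s).
Proof.
case: p_refines => r rm rE; rewrite /in_first_part.
set i := tagnat.sig1 s.
have sE : s = (\sum_(k < m | (k < i)%N) p k + tagnat.sig2 s)%N :> nat := tagnat.rect s.
have si := ltn_ord (tagnat.sig2 s); rewrite -/i in si.
have le_i : (\sum_(k < m | (k <= i)%N) p k = \sum_(k < m | (k < i)%N) p k + p i)%N.
  rewrite (bigD1 i) //= addnC; congr (_ + _)%N; apply: eq_bigl => k.
  by rewrite ltn_neqAle andbC.
have sub (P Q : pred 'I_m) : (forall k, P k -> Q k) ->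
    (\sum_(k < m | P k) p k <= \sum_(k < m | Q k) p k)%N.
  move=> PQ; rewrite [leqRHS](bigID P) /= -[leqLHS]addn0 leq_add //.
  rewrite leq_eqVlt; apply/orP; left; apply/eqP; apply: eq_bigl => k.
  by case Pk: (P k); rewrite ?andbF // andbT; apply/esym/PQ.
case: (ltnP i r) => ir.
  have h : (\sum_(k < m | (k <= i)%N) p k <= nu)%N.
    by rewrite -rE; apply: sub => k h; apply: leq_ltn_trans h ir.
  rewrite h; apply/idP; rewrite sE; rewrite le_i in h; apply: leq_trans h.
  by rewrite ltn_add2l.
have h : (nu <= \sum_(k < m | (k < i)%N) p k)%N.
  by rewrite -rE; apply: sub => k h; apply: leq_trans h ir.
rewrite le_i sE ltnNge (leq_trans h (leq_addr _ _)) /=; apply/esym/negbTE.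
by rewrite -ltnNge (leq_ltn_trans h) // -[ltnLHS]addn0 ltn_add2l.
Qed.

End PartSigns.

Lemma ubce_bound_gt0 (R : realType) (ni nj : nat) : (0 < ni)%N -> (0 < nj)%N ->
  0 < ubce_bound R ni nj.
Proof.
move=> ni0 nj0; rewrite /ubce_bound divr_gt0 // sqrtr_gt0 mulr_gt0 //.
have h1 : 1 <= 4 ^+ ni :> R by apply: exprn_ege1; rewrite ler1n.
have h2 : 0 < nj%:R :> R by rewrite ltr0n.
lra.
Qed.

Lemma entry_le_off_norm (R : realType) n (A : 'M[R]_n) s t : A^T = A -> s != t ->
  `|A s t| <= off_norm A.
Proof.
move=> sA; wlog lt : s t / (s < t)%N => [hw|_].
  case: (ltngtP s t) => [|ts _|/val_inj ->]; [exact: hw| |by rewrite eqxx].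
  by rewrite -[in leLHS]sA mxE; apply: hw => //; rewrite -val_eqE /= ltn_eqF.
have h0 (u : 'I_n) : 0 <= \sum_(v < n | (u < v)%N) `|A u v| ^+ 2.
  by apply: sumr_ge0 => v _; rewrite sqr_ge0.
rewrite -[leLHS]normr_id -sqrtr_sqr /off_norm ler_sqrt ?sumr_ge0 //.
rewrite (bigD1 s) //= (bigD1 t) //= -addrA lerDl addr_ge0 ?sumr_ge0 //.
Qed.

(** * The full block J-Jacobi method *)

Section BlockJacobi.
Variables (R : realType) (m : nat) (p : 'I_m -> nat) (nu : nat).
Variables (O : seq ('I_m * 'I_m)).
Hypothesis m_ge2 : (2 <= m)%N.
Hypothesis p_gt0 : forall i, (0 < p i)%N.
Hypothesis p_refines : refines p nu.
Hypothesis O_sg : generalized_serial O.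
Variables (A F : nat -> 'M[R]_(\sum_i p i)).
Hypothesis A0_posdef : sym_posdef (A 0%N).
Hypothesis A_method : block_J_jacobi nu O A F.

Local Notation N := (\sum_i p i)%N.
Local Notation blk := (tagnat.sig1 : 'I_N -> 'I_m).
Let sg : pred 'I_N := fun s => (s < nu)%N.
Let mixed : pred ('I_m * 'I_m) := fun x => ~~ same_part p nu x.1 x.2.
Let gam (x : 'I_m * 'I_m) : R := ubce_bound R (p x.1) (p x.2).
Let x0 : 'I_m * 'I_m :=
  (Ordinal (leq_trans (isT : (0 < 2)%N) m_ge2), Ordinal (leq_trans (isT : (1 < 2)%N) m_ge2)).
Local Notation pv := (fun k => nth x0 O (k %% size O)).

Let O_mem x : (x \in O) = (x.1 < x.2)%N. Proof. by case: O_sg => h _; rewrite h inE. Qed.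

Let O_gt0 : (0 < size O)%N.
Proof. by have : x0 \in O; [rewrite O_mem|case: (O)]. Qed.

Let O_cover (i : 'I_m) : exists2 x, x \in O & (i == x.1) || (i == x.2).
Proof.
have [i0|i0] := posnP i.
  by exists x0; rewrite ?O_mem // -val_eqE /= i0.
by exists (x0.1, i); rewrite ?O_mem //= eqxx orbT.
Qed.

Let pv_mem k : pv k \in O. Proof. by apply: mem_nth; rewrite ltn_mod O_gt0. Qed.

Let pv_lt k : ((pv k).1 < (pv k).2)%N. Proof. by rewrite -O_mem pv_mem. Qed.

Let pv_neq k : (pv k).1 != (pv k).2.
Proof. by rewrite -val_eqE /= ltn_eqF // pv_lt. Qed.

Let pivot_atE k : pivot_at O k = Some ((pv k).1, (pv k).2).
Proof. by rewrite /pivot_at onthE (nth_map x0) ?ltn_mod ?O_gt0 // -surjective_pairing. Qed.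

Let gam_gt0 x : 0 < gam x. Proof. exact: ubce_bound_gt0. Qed.

Let mixedP x : mixed x -> forall s t, blk s = x.1 -> blk t = x.2 -> sg s != sg t.
Proof.
by move=> mx s t es et; rewrite /sg !(in_first_partE p_gt0 p_refines) es et.
Qed.

Let A_step k : jstep blk sg mixed gam (pv k) (A k) (F k) (A k.+1).
Proof.
have [Fh [eF jF kF eA dA]] := A_method (pivot_atE k).
have ij := pv_lt k.
split=> //.
- by move=> s t st; rewrite eF block_elementary_supported // -surjective_pairing.
- rewrite negbK => sp i ix y hy.
  move: kF; rewrite sp => -[_ [e1 e2]].
  apply: block_lower_bound hy; first exact: ltW.
  (* The UBCE lower bound concerns the first diagonal block; equality of the smallest singular
     values transfers it to the second. *)
  case/orP: ix => /eqP->; rewrite eF.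
    by rewrite block_elementary_ii.
  by rewrite block_elementary_jj // -e1.
- by move=> s t Ps Pt st; apply: (pivot_submx_diag dA) => //; rewrite -surjective_pairing.
Qed.

Lemma block_jacobi_off_norm_cvg0 : (fun k => off_norm (A k)) @ \oo --> (0 : R).
Proof.
have [U [ultraU freeU]] := free_ultrafilter.
apply: (off_norm_cvg0 freeU gam_gt0 mixedP O_gt0 _ A0_posdef A_step O_cover).
  by move=> x; rewrite O_mem => h; rewrite -val_eqE /= ltn_eqF.
exact: forcing_generalized_serial.
Qed.

Let offdiag0 s t : s != t -> (fun k => A k s t) @ \oo --> (0 : R).
Proof.
move=> st; apply/cvgr0Pnorm_lt => e e0.
have /cvgr0Pnorm_lt/(_ _ e0) := block_jacobi_off_norm_cvg0; apply: filterS => k.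
apply: le_lt_trans; apply: le_trans (ler_norm _).
by apply: entry_le_off_norm st; case: (process_posdef A0_posdef A_step k).
Qed.

(** As [i < j], the order along the pivot submatrix is the order of the global indices. *)
Lemma sorting_kernel_sorted (le : rel R) : sorting_kernel le nu O A ->
  sorted_process blk mixed pv A le.
Proof.
move=> h k s t Ps Pt bst st; have := h k _ _ (pivot_atE k).
have ij := pv_lt k.
rewrite (surjective_pairing (pv k)) in Ps Pt.
case: ifP => sp.
  have [a ea] := in_pair_pivot_index Ps; have [b eb] := in_pair_pivot_index Pt.
  rewrite ea eb in st *; move/(_ a b (pivot_index_le ij st)).
  by rewrite !pivot_submxE.
have {}bst := bst (negbT sp).
have same (i : 'I_m) : blk s = i -> diag_sorted le (submxblock (A k.+1) i i) ->
    le (A k.+1 s s) (A k.+1 t t).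
  move=> es; have et : blk t = i by rewrite -bst.
  have [a ea] := Rank_of_block es; have [b eb] := Rank_of_block et.
  rewrite ea eb in st *; have ab : (a <= b)%N.
    by have := @tagnat.le_Rank m p i a b; rewrite !leEord st => <-.
  by move/(_ a b ab); rewrite !mxE.
by case=> hi hj; case/orP: Ps => /eqP es; apply: same es _.
Qed.

Lemma elementwise_kernel_cvg : elementwise_kernel nu O A ->
  exists2 D : 'M[R]_N, is_diag_mx D & A @ \oo --> D.
Proof.
case=> K [hK runs]; have [U [ultraU freeU]] := free_ultrafilter.
(* A constant [Phi] never increases strictly, so the limits before and after a step must be shown to
   have equal diagonals. *)
apply: (process_diag_cvg freeU A0_posdef A_step offdiag0 (Phi := fun=> 0)).
move=> f x L L' hf hx hL hL' L0 L'0; left.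
have ij : (x.1 < x.2)%N by have [l <-] := filter_ex hx; exact: pv_lt.
have out s : ~~ in_pair blk x s -> L s s = L' s s.
  move=> Ps; apply: (ultra_cvg_eq (U := U)) (hL s s) _.
  apply: ultra_cvg_near (hL' s s); apply: filterS hx => l xl.
  have [hF _ _ -> _] := A_step (f l); rewrite xl in hF.
  by rewrite (congr_supported_row _ _ hF Ps) (mulmx_supported_out _ _ hF Ps).
(* The trace drop of the block method tends to 0. Since the diagonal outside the pivot is fixed, the
   limits of the pivot submatrices have equal traces as well, as [kernel_limit] requires. *)
have trLL' : \tr L = \tr L'.
  apply/eqP; rewrite -subr_eq0; apply/eqP.
  have c : (fun l => drop A (f l)) @ U --> \tr L - \tr L'.
    by apply: cvgB; exact: cvg_trace.
  apply: (ultra_cvg_eq (U := U)) c _.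
  by apply: cvg_subseq hf (drop_cvg0 A0_posdef A_step).
pose i := x.1; pose j := x.2.
(* The [l] with another pivot are negligible along [U], so any sequence serves there. *)
have hX l : exists X, pv (f l) = x -> elementwise_run (pivot_signs p nu i j)
    (pivot_submx i j (A (f l))) X (pivot_submx i j (A (f l).+1)).
  have [xl|nx] := pselect (pv (f l) = x); last by exists (fun=> 0).
  have := pivot_atE (f l); rewrite xl => /runs[X KX XC].
  have [eK _] := hK i j ij.
  have pB : sym_posdef (pivot_submx i j (A (f l))).
    by apply: pivot_submx_posdef => //; exact: (process_posdef A0_posdef A_step).
  have [_ /(_ X KX)[X0 hX]] := eK _ pB.
  by exists X.
have [X hX'] := choice hX.
have sub M M' : mcvg U M M' -> mcvg U (fun l => pivot_submx i j (M l)) (pivot_submx i j M').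
  move=> h a b; rewrite pivot_submxE; under eq_cvg do rewrite pivot_submxE; exact: h.
have trE (M : 'M[R]_N) : \tr (pivot_submx i j M) = \sum_(s | in_pair blk (i, j) s) M s s.
  by rewrite -sum_pivot_index //; apply: eq_bigr => a _; rewrite pivot_submxE.
have key a : pivot_submx i j L a a = pivot_submx i j L' a a.
  apply: (@kernel_limit R U ultraU _ (pivot_signs p nu i j) _ _ X).
  - by apply: filterS hx => l; exact: hX'.
  - exact: sub.
  - exact: sub.
  - by apply: pivot_submx_posdef => //; exact: (limit_posdef A0_posdef A_step hL).
  - move=> s t st; rewrite pivot_submxE L0 //.
    by apply: contraNneq st => /(pivot_index_inj ij) ->.
  - rewrite !trE; have := trLL'; rewrite /mxtrace (bigID (in_pair blk (i, j))) /=.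
    rewrite [RHS](bigID (in_pair blk (i, j))) /=.
    suff -> : \sum_(s | ~~ in_pair blk (i, j) s) L s s =
        \sum_(s | ~~ in_pair blk (i, j) s) L' s s by move/addIr.
    by apply: eq_bigr => s; rewrite -surjective_pairing; exact: out.
move=> s; case Ps: (in_pair blk x s); last by rewrite out ?Ps.
rewrite (surjective_pairing x) in Ps; have [a ->] := in_pair_pivot_index Ps.
by have := key a; rewrite !pivot_submxE.
Qed.

Lemma block_jacobi_cvg : kernel_convention nu O A ->
  exists2 D : 'M[R]_N, is_diag_mx D & A @ \oo --> D.
Proof.
have [U [ultraU freeU]] := free_ultrafilter.
case=> [h|h|]; last exact: elementwise_kernel_cvg.
  apply: (sorted_process_cvg freeU gam_gt0 mixedP A0_posdef A_step pv_neq offdiag0).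
  by left; exact: sorting_kernel_sorted.
apply: (sorted_process_cvg freeU gam_gt0 mixedP A0_posdef A_step pv_neq offdiag0).
by right; exact: sorting_kernel_sorted.
Qed.

End BlockJacobi.

Theorem theorem5p4 (R : realType) (m : nat) (p : 'I_m -> nat) (nu : nat)
    (O : seq ('I_m * 'I_m))
    (m_ge2 : (2 <= m)%N)
    (p_gt0 : forall i, (0 < p i)%N)
    (nu_le : (nu <= \sum_i p i)%N)
    (p_refines : refines p nu)
    (O_sg : generalized_serial O)
    (A0 : 'M[R]_(\sum_i p i))
    (A0_posdef : sym_posdef A0)
    (A F : nat -> 'M[R]_(\sum_i p i))
    (A_init : A 0%N = A0)
    (A_method : block_J_jacobi nu O A F) :
  ((fun k => off_norm (A k)) @ \oo --> (0 : R)) /\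
  (kernel_convention nu O A ->
   exists2 D : 'M[R]_(\sum_i p i), is_diag_mx D & A @ \oo --> D).
Proof.
rewrite -A_init in A0_posdef.
split; first exact: (block_jacobi_off_norm_cvg0 m_ge2 p_gt0 p_refines O_sg A0_posdef A_method).
exact: (block_jacobi_cvg m_ge2 p_gt0 p_refines O_sg A0_posdef A_method).
Qed.
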